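(* Let $X_t=\mu t+\sigma W_t$ with $\mu\in\mathbb{R}$, $\sigma>0$, let $a>0$, and let $\tilde\tau_a^n$ be the $n$-th drawdown time with recovery. For all $\lambda>0$, $n\in\mathbb{N}$ and $x\ge -a$, $$\mathbb{E}\left[e^{-\lambda\tilde\tau_a^n};\,X_{\tilde\tau_a^n}>x\right]=\left(\frac{c_\lambda}{b_\lambda}\right)^n e^{-(n-1)\beta_\lambda^+a}\sum_{m=0}^{n-1}\frac{(b_\lambda(x+a))^m}{m!}e^{-b_\lambda(x+a)}.$$
   Context: $X_t=\mu t+\sigma W_t$ ($X_0=0$) with $W$ a standard Brownian motion, $\mu\in\mathbb{R}$, $\sigma>0$; $M_t=\sup_{0\le s\le t}X_s$; $a>0$ is fixed; $\mathbb{N}=\{1,2,\dots\}$; $\inf\emptyset=\infty$. The drawdown times with recovery are defined by $\tilde\tau_a^0=0$ and $$\tilde\tau_a^n=\inf\{t>\tilde\tau_a^{n-1}:\ M_t-X_t\ge a,\ M_t>M_{\tilde\tau_a^{n-1}}\},$$ with $\tilde\tau_a^n=\infty$ if $\tilde\tau_a^{n-1}=\infty$. Notation: $\mathbb{E}[Y;U]=\mathbb{E}[Y1_U]$, with $e^{-\lambda\cdot\infty}=0$. Constants: $\beta_\lambda^{\pm}=\dfrac{-\mu\pm\sqrt{\mu^2+2\lambda\sigma^2}}{\sigma^2}$, $b_\lambda=\dfrac{\beta_\lambda^+e^{-\beta_\lambda^-a}-\beta_\lambda^-e^{-\beta_\lambda^+a}}{e^{-\beta_\lambda^-a}-e^{-\beta_\lambda^+a}}$,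 $c_\lambda=\dfrac{\beta_\lambda^+-\beta_\lambda^-}{e^{-\beta_\lambda^-a}-e^{-\beta_\lambda^+a}}$. The $m=0$ power is $1$ (also for $x=-a$). *)

(* Defs.v *)
From HB Require Import structures.
From mathcomp Require Import all_boot all_order all_algebra.
From mathcomp Require Import all_classical all_reals all_analysis.

Set Implicit Arguments.
Unset Strict Implicit.
Unset Printing Implicit Defensive.

Import Order.TTheory GRing.Theory Num.Theory.
Import numFieldNormedType.Exports.

Local Open Scope classical_set_scope.
Local Open Scope ring_scope.

Section BrownianMotion.
Context (d : measure_display) (T : measurableType d) (R : realType).
Variable P : probability T R.

Definition mutually_independent (I : finType) (X : I -> T -> R) : Prop :=
  forall (J : {set I}) (B : I -> set R),
    (forall i, i \in J -> measurable (B i)) ->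
    P (\bigcap_(i in [set` J]) X i @^-1` B i)
    = (\prod_(i in J) P (X i @^-1` B i))%E.

(* Only the times t >= 0 are constrained; [W t] for t < 0 plays no role.
   [normal_prob m s] is parametrized by the standard deviation s. *)
Record brownian_motion (W : R -> {RV P >-> R}) : Prop := BrownianMotion {
  bm_start : {ae P, forall w, W 0 w = 0};
  bm_continuous :
    {ae P, forall w, {within `[0, +oo[, continuous (fun t => W t w)}};
  bm_gaussian : forall s t : R, 0 <= s -> s < t ->
    forall B : set R, measurable B ->
    P ((fun w => W t w - W s w) @^-1` B) = normal_prob 0 (Num.sqrt (t - s)) B;
  bm_independent : forall (n : nat) (t : nat -> R),
    0 <= t 0%N -> (forall i, t i <= t i.+1) ->
    mutually_independent (fun (i : 'I_n) w => W (t i.+1) w - W (t i) w)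
}.

End BrownianMotion.

Section Drawdown.
Context (T : Type) (R : realType).
Implicit Types (X : R -> T -> R) (a lambda t x : R) (w : T).

Definition drifted (mu sigma : R) (W : R -> T -> R) : R -> T -> R :=
  fun t w => mu * t + sigma * W t w.

Definition running_max X t w : R := sup [set X s w | s in `[0, t]].

(* [ereal_inf set0 = +oo], so a drawdown with recovery that never happens
   occurs at time +oo. *)
Fixpoint drawdown_time X a (n : nat) w : \bar R :=
  if n is n'.+1 then
    if drawdown_time X a n' w is r%:E then
      ereal_inf [set t%:E | t in
        [set t : R | [/\ r < t,
                         a <= running_max X t w - X t w
                       & running_max X r w < running_max X t w]]]
    else +oo%E
  else 0%E.

(* e^(- lambda tau), with e^(- lambda oo) = 0. *)
Definition discount lambda (tau : \bar R) : R :=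
  if tau is t%:E then expR (- (lambda * t)) else 0.

(* The event X_tau > x; since X_oo is undefined it is taken inside
   {tau < oo}, which is immaterial under a discount factor vanishing at oo. *)
Definition stopped_above X (tau : T -> \bar R) x : set T :=
  [set w | exists2 t : R, tau w = t%:E & x < X t w].

End Drawdown.

Section Constants.
Context (R : realType).
Variables (mu sigma a lambda : R).

Definition beta_plus : R :=
  (- mu + Num.sqrt (mu ^+ 2 + 2 * lambda * sigma ^+ 2)) / sigma ^+ 2.

Definition beta_minus : R :=
  (- mu - Num.sqrt (mu ^+ 2 + 2 * lambda * sigma ^+ 2)) / sigma ^+ 2.

Definition b_coef : R :=
  (beta_plus * expR (- (beta_minus * a)) - beta_minus * expR (- (beta_plus * a)))
  / (expR (- (beta_minus * a)) - expR (- (beta_plus * a))).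

Definition c_coef : R :=
  (beta_plus - beta_minus)
  / (expR (- (beta_minus * a)) - expR (- (beta_plus * a))).

End Constants.

(* Main.v *)
(** For x >= -a put m = x + a. As X equals M - a at the drawdown times, the event
    X > x is M > m, and it suffices to compute U_n(m), the discounted probability
    that the n-th drawdown happens while the maximum is at most m.

    Excursion theory is replaced by discretization. Sample the path on a time
    grid of mesh h and split space into bands of width e. While the sampled path
    searches for a drawdown in the band [j e, (j+1) e), or waits to recover a
    level j e, the lambda-harmonic functions e^(bp x) and e^(bm x) give exact
    martingales; matching the boundary values through the exit probabilities of
    (-a, e) gives one potential for all phases. The overshoot at a phase change
    is O(|increment|), and since the rank of the phase drops at each change, the
    fourth moment O(h^2) of the increments makes the total error vanish as
    h -> 0. What remains is a linear recursion in the number of bands, which is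
    an Euler scheme for U_n' = c rho U_(n-1) - b U_n with rho = e^(- bp a), U_0
    being the constant 1/rho; its solution is a Poisson tail.

    Almost every path is continuous, hence the reward of the chain with drawdown
    size a is eventually at most that of the path, and the reward of the chain
    with drawdown size a - 3 e is eventually at least that of the path. Fatou's
    lemma turns both comparisons into bounds on upper integrals. *)

Require Import Defs.
From HB Require Import structures.
From mathcomp Require Import all_boot all_order all_algebra.
From mathcomp Require Import all_classical all_reals all_analysis.
From mathcomp Require Import measurable_realfun ring lra zify.

Set Implicit Arguments.
Unset Strict Implicit.
Unset Printing Implicit Defensive.

Import Order.TTheory GRing.Theory Num.Theory.
Import numFieldNormedType.Exports.

Local Open Scope classical_set_scope.
Local Open Scope ring_scope.

(** * The two-sided exit problem *)

(** Of the Brownian motion only the law and the independence of its increments along a grid enter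
    the expectations: the chain runs up to a deterministic horizon, so no stopping theorem and no
    strong Markov property is invoked. The price is an error summed over all grid steps. With h
    times the number of steps tending to infinity, an error of order h per step would not vanish,
    one of order h^2 can. The mesh tends to 0 while the bands are fixed, because the error constants
    and the number of levels blow up with 1 / e; only then does e tend to 0. A level is skipped
    after a drawdown because the sampled maximum is then below (j+1) e, hence that of the path below
    (j+2) e, so that reaching (j+2) e certifies a new maximum. Conversely, 3 e of the drawdown size
    is lost to sampling at the maximum, to sampling at the drawdown, and to rounding to a band.
    Upper integrals can be added but not subtracted. With D the discount factor and F its part where
    the maximum is at most m, the integrand f = D - F is therefore handled through 1 + f = D + (1 -
    F) and 1 - f = (1 - D) + F. *)

Section exp_estimates.
Context (R : realType).
Implicit Types x y t : R.

Lemma expR_sub1_le x : expR x - 1 <= x * expR x.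
Proof.
have := expR_ge1Dx (- x); rewrite -(ler_pM2r (expR_gt0 x)) -expRD addNr expR0.
by rewrite mulrDl mul1r mulNr => h; lra.
Qed.

Lemma normr_expR_sub1 x : `|expR x - 1| <= expR `|x| - 1.
Proof.
have [x0|x0] := leP 0 x.
  by rewrite [`|x|]ger0_norm// ger0_norm// subr_ge0 -expR0 ler_expR.
rewrite [`|x|]ltr0_norm// ler0_norm; last by rewrite subr_le0 -expR0 ler_expR ltW.
have := expR_ge1Dx x; have := expR_ge1Dx (- x); lra.
Qed.

Lemma expR_taylor2 x : `|expR x - 1 - x| <= x ^+ 2 * expR `|x|.
Proof.
have h0 : 0 <= expR x - 1 - x by have := expR_ge1Dx x; lra.
rewrite ger0_norm//.
have h1 := expR_sub1_le x.
have [x0|x0] := leP 0 x.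
  by rewrite ger0_norm//; have := ler_wpM2l x0 h1; rewrite expr2; lra.
rewrite ltr0_norm//.
have h2 := expR_ge1Dx x.
have h3 : x * expR x - x <= x ^+ 2 by have := ler_wnM2l (ltW x0) h2; lra.
have h4 : 1 <= expR (- x) by rewrite -expR0 ler_expR; lra.
have h5 : x ^+ 2 <= x ^+ 2 * expR (- x) by rewrite ler_peMr// sqr_ge0.
lra.
Qed.

End exp_estimates.

Section exit_problem.
Context (R : realType).
(* e^(bp x) and e^(bm x) span the lambda-harmonic functions. *)
Variables (bp bm e a : R).

(** Determinant of the linear system prescribing boundary values at [e] and [- a]; the coefficients
    below are given by Cramer's rule. *)
Definition exit_den : R := expR (bp * e - bm * a) - expR (bm * e - bp * a).

(* Discounted probabilities of leaving (-a, e) through e, resp. through -a,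
   when starting from 0. *)
Definition exit_up : R := (expR (- (bm * a)) - expR (- (bp * a))) / exit_den.
Definition exit_down : R := (expR (bp * e) - expR (bm * e)) / exit_den.

(* Coefficients of the combination of e^(bp x) and e^(bm x) with value u at e
   and v at -a. *)
Definition exit_cp (u v : R) : R :=
  (u * expR (- (bm * a)) - v * expR (bm * e)) / exit_den.
Definition exit_cm (u v : R) : R :=
  (v * expR (bp * e) - u * expR (- (bp * a))) / exit_den.

Hypotheses (bp_gt0 : 0 < bp) (bm_lt0 : bm < 0) (e_gt0 : 0 < e) (a_gt0 : 0 < a).

Let bpe : 0 < bp * e. Proof. exact: mulr_gt0. Qed.
Let bpa : 0 < bp * a. Proof. exact: mulr_gt0. Qed.
Let bme : bm * e < 0. Proof. by rewrite nmulr_rlt0. Qed.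
Let bma : bm * a < 0. Proof. by rewrite nmulr_rlt0. Qed.

Lemma exit_den_gt0 : 0 < exit_den.
Proof. by rewrite subr_gt0 ltr_expR; have [] := (bpe, bpa); have [] := (bme, bma); lra. Qed.

Let den_neq0 : exit_den != 0. Proof. by rewrite gt_eqF// exit_den_gt0. Qed.

Lemma exit_valE_up u v :
  exit_cp u v * expR (bp * e) + exit_cm u v * expR (bm * e) = u.
Proof.
have := den_neq0; rewrite /exit_cp /exit_cm /exit_den !expRD => h.
by field.
Qed.

Lemma exit_valE_down u v :
  exit_cp u v * expR (- (bp * a)) + exit_cm u v * expR (- (bm * a)) = v.
Proof.
have := den_neq0; rewrite /exit_cp /exit_cm /exit_den !expRD => h.
by field.
Qed.

Lemma exit_valE u v : exit_cp u v + exit_cm u v = exit_up * u + exit_down * v.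
Proof. by rewrite /exit_cp /exit_cm /exit_up /exit_down; field. Qed.

Lemma exit_up_ge0 : 0 <= exit_up.
Proof.
rewrite divr_ge0 ?ltW ?exit_den_gt0// subr_gt0 ltr_expR.
by have [] := (bpe, bpa); have [] := (bme, bma); lra.
Qed.

Lemma exit_down_ge0 : 0 <= exit_down.
Proof.
rewrite divr_ge0 ?ltW ?exit_den_gt0// subr_gt0 ltr_expR.
by have [] := (bpe, bpa); have [] := (bme, bma); lra.
Qed.

(** With X, x the exponentials of [bp * e], [bm * e] and Y, y those of [- (bm * a)], [- (bp * a)],
    the claim reads (1 - x)(1 - y) <= (X - 1)(Y - 1). Applying 1 + t <= e^t to each factor puts the
    same product of the four constants between the two sides. *)
Lemma exit_up_down_le1 : exit_up + exit_down <= 1.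
Proof.
have [pe pa] := (bpe, bpa); have [me ma] := (bme, bma).
rewrite /exit_up /exit_down -mulrDl ler_pdivrMr ?exit_den_gt0// mul1r.
rewrite /exit_den !expRD.
have hX := expR_ge1Dx (bp * e); have hY := expR_ge1Dx (- (bm * a)).
have hx := expR_ge1Dx (bm * e); have hy := expR_ge1Dx (- (bp * a)).
have x1 : expR (bm * e) <= 1 by rewrite -expR0 ler_expR ltW.
have y1 : expR (- (bp * a)) <= 1 by rewrite -expR0 ler_expR; lra.
have h1 : (bp * e) * (- (bm * a)) <= (expR (bp * e) - 1) * (expR (- (bm * a)) - 1).
  by apply: ler_pM; lra.
have h2 : (1 - expR (bm * e)) * (1 - expR (- (bp * a))) <= (- (bm * e)) * (bp * a).
  by apply: ler_pM; lra.
have h3 : (bp * e) * (- (bm * a)) = (- (bm * e)) * (bp * a) by ring.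
lra.
Qed.

Lemma exit_up_le1 : exit_up <= 1.
Proof. have := exit_up_down_le1; have := exit_down_ge0; lra. Qed.

Lemma exit_coef_bound u v : 0 <= u <= 1 -> 0 <= v <= 1 ->
  let C := (expR (bp * e) + expR (- (bm * a))) / exit_den in
  `|exit_cp u v| <= C /\ `|exit_cm u v| <= C.
Proof.
move=> /andP[u0 u1] /andP[v0 v1] C.
have [pe pa] := (bpe, bpa); have [me ma] := (bme, bma).
have x1 : expR (bm * e) <= 1 by rewrite -expR0 ler_expR ltW.
have y1 : expR (- (bp * a)) <= 1 by rewrite -expR0 ler_expR; lra.
have X1 : 1 <= expR (bp * e) by rewrite -expR0 ler_expR ltW.
have Y1 : 1 <= expR (- (bm * a)) by rewrite -expR0 ler_expR; lra.
have bnd (s t p q : R) : 0 <= s <= 1 -> 0 <= t <= 1 -> 0 <= p -> 0 <= q ->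
    `|s * p - t * q| <= p + q.
  move=> /andP[s0 s1] /andP[t0 t1] p0 q0.
  have := ler_piMl p0 s1; have := ler_piMl q0 t1.
  have := mulr_ge0 s0 p0; have := mulr_ge0 t0 q0.
  by move=> *; rewrite ler_norml; apply/andP; split; lra.
have den0 := exit_den_gt0.
rewrite /exit_cp /exit_cm !normrM normfV (gtr0_norm den0).
rewrite !ler_pM2r ?invr_gt0//; split.
  apply: (le_trans (bnd _ _ _ _ _ _ _ _)); rewrite ?u0 ?v0 ?expR_ge0//; lra.
apply: (le_trans (bnd _ _ _ _ _ _ _ _)); rewrite ?u0 ?v0 ?expR_ge0//; lra.
Qed.

End exit_problem.

(** * Chains driven by Brownian increments *)

Section gaussian_mgf.
Context (R : realType).
Notation leb := (@lebesgue_measure R).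

(** The Radon-Nikodym derivative of the normal law and its density have the same integrals over
    measurable sets, hence agree almost everywhere. *)
Lemma ge0_integral_normal_prob (m s : R) (f : R -> \bar R) :
  measurable_fun setT f -> (forall x, 0 <= f x)%E ->
  (\int[normal_prob m s]_x f x = \int[leb]_x (f x * (normal_pdf m s x)%:E))%E.
Proof.
move=> mf f0.
have dom := normal_prob_dominates m s.
rewrite -(Radon_Nikodym_SigmaFinite.change_of_variables dom)//.
have mpdf : measurable_fun setT (fun x => (normal_pdf m s x)%:E).
  by apply/measurable_EFinP; exact: measurable_normal_pdf.
have mRN := measurable_int _ (Radon_Nikodym_SigmaFinite.f_integrable dom).
apply: ae_eq_integral => //.
- exact: emeasurable_funM.
- exact: emeasurable_funM.
- apply: ae_eqe_mul2l.
  apply: integral_ae_eq => //.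
  + exact: Radon_Nikodym_SigmaFinite.f_integrable.
  + by move=> A _ mA; rewrite -Radon_Nikodym_SigmaFinite.f_integral.
Qed.

Lemma normal_prob_mgf (s theta : R) : s != 0 ->
  (\int[normal_prob 0 s]_x (expR (theta * x))%:E
   = (expR (theta ^+ 2 * s ^+ 2 / 2))%:E)%E.
Proof.
move=> s0.
rewrite ge0_integral_normal_prob; last 2 first.
- apply/measurable_EFinP; exact: measurableT_comp.
- by move=> x; rewrite lee_fin expR_ge0.
(* Completing the square: the tilt by e^(theta x) moves the mean of the centred density to theta
   s^2, so the factor 1 is written as the mass of the shifted density. *)
rewrite -[RHS]mule1 -(integral_normal_pdf (theta * s ^+ 2) s).
rewrite -ge0_integralZl //; last 2 first.
- by apply/measurable_EFinP; exact: measurable_normal_pdf.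
- by move=> x _; rewrite lee_fin normal_pdf_ge0.
apply: eq_integral => x _; rewrite -!EFinM !normal_pdfE// /normal_fun.
congr EFin.
rewrite mulrCA [RHS]mulrCA; congr (_ * _).
rewrite -!expRD; congr expR.
field.
by rewrite s0.
Qed.

End gaussian_mgf.

Lemma mfun_exists d d' (T : measurableType d) (E : measurableType d')
  (f : T -> E) : measurable_fun setT f -> exists g : {mfun T >-> E}, g = f :> (T -> E).
Proof.
move=> mf; pose a := isMeasurableFun.Build _ _ _ _ f mf.
by exists (HB.pack_for {mfun T >-> E} f a).
Qed.

Section product_sigma_algebra.
Context d1 d2 (E1 : measurableType d1) (E2 : measurableType d2) (R : realType).

Lemma finite_measure_eq_rect (m1 m2 : {measure set (E1 * E2) -> \bar R}) :
  (m1 setT < +oo)%E ->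
  (forall A B, measurable A -> measurable B -> m1 (A `*` B) = m2 (A `*` B)) ->
  forall C, measurable C -> m1 C = m2 C.
Proof.
move=> fin eqr C mC.
pose G : set (set (E1 * E2)) :=
  [set A `*` B | A in measurable & B in measurable].
apply: (measure_unique G (fun=> setT)) => //.
- exact: measurable_prod_measurableType.
- move=> _ _ [A mA [B mB <-]] [A' mA' [B' mB' <-]].
  rewrite -setXI; exists (A `&` A'); first exact: measurableI.
  by exists (B `&` B') => //; exact: measurableI.
- by move=> _; exists setT => //; exists setT => //; rewrite setXTT.
- by apply/seteqP; split=> // x _; exists 0%N.
- by move=> _ [A mA [B mB <-]]; exact: eqr.
Qed.

End product_sigma_algebra.

(** * Independence of the current state and the future noise *)

Section driven_chain.
Context d dE (T : measurableType d) (E : measurableType dE) (R : realType).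
Variables (P : probability T R) (xi : nat -> T -> R).
Variables (s0 : E) (Phi : nat -> E * R -> E).
Hypothesis mxi : forall i, measurable_fun setT (xi i).
Hypothesis mPhi : forall i, measurable_fun setT (Phi i).

Fixpoint driven (l : nat) (w : T) : E :=
  if l is l'.+1 then Phi l' (driven l' w, xi l' w) else s0.

Lemma measurable_driven l : measurable_fun setT (driven l).
Proof.
elim: l => [|l IH]; first exact: measurable_cst.
by apply: measurableT_comp => //; exact: measurable_fun_pair.
Qed.

Definition box (B : nat -> set R) (l m : nat) : set T :=
  \bigcap_(i in [set i | (l <= i < m)%N]) xi i @^-1` B i.

(** Initial segments suffice to express joint independence, since a coordinate is freed by taking
    [B i] to be the whole space; this form suits an induction on time. *)
Definition independent_noise := forall (B : nat -> set R) (m : nat),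
  (forall i, measurable (B i)) ->
  P (box B 0 m) = (\prod_(0 <= i < m) P (xi i @^-1` B i))%E.

Lemma measurable_box B l m : (forall i, measurable (B i)) -> measurable (box B l m).
Proof.
move=> mB; apply: bigcap_measurableType => i _.
by rewrite -[X in measurable X]setTI; exact: mxi.
Qed.

Lemma boxS B l m : (l < m)%N -> box B l m = xi l @^-1` B l `&` box B l.+1 m.
Proof.
move=> lm; apply/seteqP; split=> w /=.
  move=> H; split; first by apply: H => /=; rewrite leqnn.
  by move=> i /= /andP[li im]; apply: H => /=; rewrite im ltnW.
move=> [Hl H] i /= /andP[]; rewrite leq_eqVlt => /predU1P[<- //|li im].
by apply: H => /=; rewrite li.
Qed.

Hypothesis hxi : independent_noise.

Let mprex l A : measurable A -> measurable (xi l @^-1` A).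
Proof. by move=> mA; rewrite -[X in measurable X]setTI; exact: mxi. Qed.

(** The next state is a function of the current state and the current noise. Carrying a box of all
    later noises, instead of the next one only, lets the induction hypothesis absorb a condition on
    the current noise. *)
Lemma driven_indep_future l : forall A B m, measurable A ->
  (forall i, measurable (B i)) -> (l <= m)%N ->
  P (driven l @^-1` A `&` box B l m) =
  (P (driven l @^-1` A) * \prod_(l <= i < m) P (xi i @^-1` B i))%E.
Proof.
elim: l => [|l IH] A B m mA mB lm.
  have [As0|As0] := pselect (A s0).
    rewrite (_ : driven 0 @^-1` A = setT); last by apply/seteqP; split.
    by rewrite setTI probability_setT mul1e hxi.
  rewrite (_ : driven 0 @^-1` A = set0); last by apply/seteqP; split.
  by rewrite set0I measure0 mul0e.
have mF := @measurable_box B l.+1 m mB.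
have [Z ZE] := mfun_exists (measurable_fun_pair (measurable_driven l) (mxi l)).
set c := (\prod_(l.+1 <= i < m) P (xi i @^-1` B i))%E.
have c0 : (0 <= c)%E by apply: prode_ge0 => i _; exact: measure_ge0.
have cfin : c \is a fin_num.
  by apply: prode_fin_num => i _; apply: fin_num_measure; exact: mprex.
have [r rE] : exists r : {nonneg R}, (r%:num)%:E = c.
  have h : 0 <= fine c by exact: fine_ge0.
  by exists (NngNum h); rewrite /= fineK.
have rect A' B' : measurable A' -> measurable B' ->
    P (Z @^-1` (A' `*` B') `&` box B l.+1 m) =
    (c * P (Z @^-1` (A' `*` B')))%E.
  move=> mA' mB'.
  (* The condition [B'] on the current noise becomes one more side of the box; the induction
     hypothesis is used with the whole box and with this side alone. *)
  pose B1 i := if i == l then B' else B i.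
  have mB1 i : measurable (B1 i) by rewrite /B1; case: ifP.
  have ZAB : Z @^-1` (A' `*` B') = driven l @^-1` A' `&` xi l @^-1` B'.
    by rewrite ZE.
  have e1 : box B l.+1 m = box B1 l.+1 m.
    apply: eq_bigcapr => i /= /andP[li _]; rewrite /B1 ifF//.
    by apply/negbTE; rewrite gtn_eqF.
  have e2 : xi l @^-1` B' `&` box B l.+1 m = box B1 l m.
    by rewrite (boxS B1)// -e1 /B1 eqxx.
  have e3 : xi l @^-1` B' = box B1 l l.+1.
    rewrite boxS// /B1 eqxx (_ : box _ _ _ = setT) ?setIT//.
    by apply/seteqP; split=> // w _ i /= /andP[]; rewrite leqNgt => /negbTE->.
  rewrite ZAB -setIA e2 IH//; last exact: ltnW.
  rewrite e3 IH// big_nat1 (big_ltn lm)// [RHS]muleC -muleA; congr (_ * _)%E.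
  rewrite /B1 eqxx; congr (_ * _)%E; rewrite /c.
  apply: eq_big_nat => i /andP[li _].
  by rewrite ifF//; apply/negbTE; rewrite gtn_eqF.
(* [P] restricted to the future box and [P] scaled by the probability of that box are finite
   measures agreeing on rectangles. *)
have all C : measurable C ->
    P (Z @^-1` C `&` box B l.+1 m) = (c * P (Z @^-1` C))%E.
  move=> mC.
  have := @finite_measure_eq_rect _ _ _ _ _
    (pushforward (mrestr P mF) Z) (mscale r (pushforward P Z)).
  rewrite /pushforward /mrestr /mscale /= -rE; apply => //.
    have h : measurable (Z @^-1` setT `&` box B l.+1 m) by rewrite preimage_setT setTI.
    by apply: (le_lt_trans (probability_le1 P h)); exact: ltry.
  by move=> A' B' mA' mB'; have := rect A' B' mA' mB'; rewrite -rE; apply.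
have mC : measurable (Phi l @^-1` A).
  by rewrite -[X in measurable X]setTI; exact: mPhi.
have dE1 : driven l.+1 @^-1` A = Z @^-1` (Phi l @^-1` A) by rewrite ZE.
by rewrite dE1 all// muleC.
Qed.

Lemma driven_indep_noise l A B : measurable A -> measurable B ->
  P (driven l @^-1` A `&` xi l @^-1` B) =
  (P (driven l @^-1` A) * P (xi l @^-1` B))%E.
Proof.
move=> mA mB.
have := @driven_indep_future l A (fun=> B) l.+1 mA (fun=> mB) (leqnSn l).
rewrite big_nat1 boxS// (_ : box _ l.+1 l.+1 = setT) ?setIT//.
by apply/seteqP; split=> // w _ i /= /andP[]; rewrite leqNgt => /negbTE->.
Qed.

Lemma ge0_expectation_driven l (phi : E -> R) (g : R -> R) :
  measurable_fun setT phi -> measurable_fun setT g ->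
  (forall e, 0 <= phi e) -> (forall x, 0 <= g x) ->
  (\int[P]_w (phi (driven l w) * g (xi l w))%:E =
   \int[P]_w (phi (driven l w))%:E * \int[P]_w (g (xi l w))%:E)%E.
Proof.
move=> mphi mg phi0 g0.
have [S SE] := mfun_exists (measurable_driven l).
have [Y YE] := mfun_exists (mxi l).
have [Z ZE] := mfun_exists (measurable_fun_pair (measurable_driven l) (mxi l)).
pose f (z : E * R) : \bar R := (phi z.1 * g z.2)%:E.
have mf : measurable_fun setT f.
  apply/measurable_EFinP; apply: measurable_funM; exact: measurableT_comp.
have f0 z : (0 <= f z)%E by rewrite lee_fin mulr_ge0.
transitivity (\int[distribution P Z]_z f z)%E.
  by rewrite ge0_integral_distribution// ZE.
transitivity (\int[(distribution P S \x distribution P Y)%E]_z f z)%E.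
  apply: eq_measure_integral => A mA _; apply/esym.
  apply: product_measure_unique => // A' B' mA' mB'.
  have e : pushforward P Z (A' `*` B') = (pushforward P S A' * pushforward P Y B')%E.
    by rewrite /pushforward ZE SE YE -driven_indep_noise.
  exact: e.
rewrite fubini_tonelli1//.
transitivity (\int[distribution P S]_x
    ((phi x)%:E * \int[distribution P Y]_y (g y)%:E))%E.
  apply: eq_integral => x _; rewrite /fubini_F /f /=.
  under eq_integral do rewrite EFinM.
  rewrite ge0_integralZl// ?lee_fin//; first exact/measurable_EFinP.
  by move=> y _; rewrite lee_fin.
rewrite ge0_integralZr//; last 2 first.
- by move=> x _; rewrite lee_fin.
- by apply: integral_ge0 => y _; rewrite lee_fin.
rewrite !ge0_integral_distribution//.
- by rewrite SE YE.
- exact/measurable_EFinP.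
- exact/measurable_EFinP.
- exact/measurable_EFinP.
Qed.

End driven_chain.

Section bounded_functions.
Context d (T : measurableType d) (R : realType) (P : probability T R).

Lemma bounded_RV_integrable (f : T -> R) (B : R) :
  measurable_fun setT f -> (forall w, `|f w| <= B) ->
  P.-integrable setT (EFin \o f).
Proof.
move=> mf fB.
apply: (@le_integrable _ _ _ P setT measurableT _ (EFin \o cst B)) => //.
- exact/measurable_EFinP.
- by move=> w _; rewrite /= lee_fin (le_trans (fB w))// ler_norm.
- apply/integrableP; split; first exact/measurable_EFinP.
  rewrite (_ : (fun _ => _) = cst `|B|%:E)// integral_cst//.
  by rewrite /= probability_setT mule1 ltry.
Qed.

End bounded_functions.

Section driven_expectation.
Context d dE (T : measurableType d) (E : measurableType dE) (R : realType).
Variables (P : probability T R) (xi : nat -> T -> R).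
Variables (s0 : E) (Phi : nat -> E * R -> E).
Hypothesis mxi : forall i, measurable_fun setT (xi i).
Hypothesis mPhi : forall i, measurable_fun setT (Phi i).
Hypothesis hxi : independent_noise P xi.
Local Notation driven := (driven xi s0 Phi).

Lemma expectation_driven l (phi : E -> R) (B : R) (g : R -> R) (G : R) :
  measurable_fun setT phi -> (forall e, `|phi e| <= B) ->
  measurable_fun setT g -> (forall x, 0 <= g x) ->
  (\int[P]_w (g (xi l w))%:E = G%:E)%E ->
  P.-integrable setT (EFin \o (fun w => phi (driven l w) * g (xi l w))) /\
  \int[P]_w (phi (driven l w) * g (xi l w)) = (\int[P]_w phi (driven l w)) * G.
Proof.
move=> mphi phiB mg g0 hG.
have md := measurable_driven s0 mxi mPhi l.
have mgx : measurable_fun setT (fun w => g (xi l w)) by exact: measurableT_comp.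
have mpx : measurable_fun setT (fun w => phi (driven l w)) by exact: measurableT_comp.
have ig : P.-integrable setT (EFin \o (fun w => g (xi l w))).
  apply/integrableP; split; first exact/measurable_EFinP.
  under eq_integral do rewrite /= ger0_norm//.
  by rewrite hG ltry.
have igB : P.-integrable setT (EFin \o (fun w => B * g (xi l w))).
  by have := integrableZl measurableT B ig; apply: eq_integrable.
have ipg : P.-integrable setT (EFin \o (fun w => phi (driven l w) * g (xi l w))).
  apply: (le_integrable measurableT _ _ igB).
  - by apply/measurable_EFinP; exact: measurable_funM.
  - move=> w _; rewrite /= lee_fin !normrM ler_wpM2r//.
    by rewrite (le_trans (phiB _))// ler_norm.
have ip : P.-integrable setT (EFin \o (fun w => phi (driven l w))).
  by apply: (@bounded_RV_integrable _ _ _ _ _ (B)).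
have iB : P.-integrable setT (EFin \o (fun=> B)).
  by apply: (@bounded_RV_integrable _ _ _ _ _ (`|B|)).
split=> //.
(* Adding [B] reduces the signed case to the nonnegative one; linearity removes the constant at the
   end. *)
have pB0 e : 0 <= phi e + B.
  by have := phiB e; rewrite ler_norml => /andP[+ _]; rewrite -subr_ge0 opprK.
have mpB : measurable_fun setT (fun e => phi e + B) by exact: measurable_funD.
have := ge0_expectation_driven s0 mxi mPhi hxi l mpB mg pB0 g0.
rewrite hG => /(congr1 fine) e1.
have {}e1 : \int[P]_w ((phi (driven l w) + B) * g (xi l w)) =
    (\int[P]_w (phi (driven l w) + B)) * G.
  rewrite /Rintegral e1 fineM//.
  apply: integrable_fin_num => //.
  apply: (@bounded_RV_integrable _ _ _ _ _ (B + `|B|)).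
    exact: measurable_funD.
  by move=> w; rewrite (le_trans (ler_normD _ _))// lerD.
have e2 : \int[P]_w (g (xi l w)) = G by rewrite /Rintegral hG.
move: e1.
under [LHS]eq_Rintegral do rewrite mulrDl.
rewrite RintegralD// [X in X = _]RintegralD// RintegralZl// e2 Rintegral_cst// mulrDl.
have -> : fine (P setT) = 1 by rewrite probability_setT.
by rewrite mulr1 => /addIr.
Qed.

End driven_expectation.

(** * Brownian increments on a time grid *)

Section brownian_increments.
Context d (T : measurableType d) (R : realType).
Variables (P : probability T R) (W : R -> {RV P >-> R}).
Hypothesis hW : brownian_motion W.

Lemma bm_increment_mgf (s t theta : R) : 0 <= s -> s < t ->
  (\int[P]_w (expR (theta * (W t w - W s w)))%:E
   = (expR (theta ^+ 2 * (t - s) / 2))%:E)%E.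
Proof.
move=> s0 st.
have mI : measurable_fun setT (fun w => W t w - W s w).
  by apply: measurable_funB.
have [Y YE] := mfun_exists mI.
have ts : 0 < t - s by rewrite subr_gt0.
transitivity (\int[distribution P Y]_x (expR (theta * x))%:E)%E.
  rewrite ge0_integral_distribution ?YE//.
  by apply/measurable_EFinP; exact: measurableT_comp.
(* The identity connects two measurable structures on the real line; the normal law is pushed
   forward along it. *)
have mid : @measurable_fun _ _ (measurableTypeR R) R setT (@id R).
  by move=> _ A mA; rewrite setTI; exact: mA.
have [J JE] := mfun_exists mid.
transitivity (\int[pushforward (normal_prob 0 (Num.sqrt (t - s))) J]_x
    (expR (theta * x))%:E)%E.
  apply: eq_measure_integral => A mA _.
  have e : pushforward P Y A = pushforward (normal_prob 0 (Num.sqrt (t - s))) J A.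
    by rewrite /pushforward YE JE (bm_gaussian hW).
  exact: e.
rewrite ge0_integral_pushforward//; last first.
  by apply/measurable_EFinP; exact: measurableT_comp.
rewrite preimage_setT JE.
rewrite normal_prob_mgf; last by rewrite gt_eqF// sqrtr_gt0.
by rewrite sqr_sqrtr// ltW.
Qed.

Variables (mu sigma h : R).
Hypothesis h_gt0 : 0 < h.

Definition grid_increment (i : nat) (w : T) : R :=
  drifted mu sigma (fun t w => W t w) (h * i.+1%:R) w
  - drifted mu sigma (fun t w => W t w) (h * i%:R) w.

Let grid_incrementE i w : grid_increment i w =
  mu * h + sigma * (W (h * i.+1%:R) w - W (h * i%:R) w).
Proof. by rewrite /grid_increment /drifted -natr1; ring. Qed.

Lemma measurable_grid_increment i : measurable_fun setT (grid_increment i).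
Proof.
rewrite (funext (grid_incrementE i)); apply: measurable_funD => //.
by apply: measurable_funM => //; exact: measurable_funB.
Qed.

Lemma grid_increment_mgf i theta :
  (\int[P]_w (expR (theta * grid_increment i w))%:E
   = (expR (h * (theta * mu + theta ^+ 2 * sigma ^+ 2 / 2)))%:E)%E.
Proof.
under eq_integral do rewrite grid_incrementE mulrDr expRD EFinM [theta * (sigma * _)]mulrA.
rewrite ge0_integralZl//; last first.
  apply/measurable_EFinP; apply: measurableT_comp => //.
  by apply: measurable_funM => //; exact: measurable_funB.
rewrite bm_increment_mgf; last 2 first.
- by rewrite mulr_ge0// ltW.
- by rewrite ltr_pM2l// ltr_nat.
rewrite -EFinM -expRD; congr (expR _)%:E.
by rewrite -natr1; field.
Qed.

Lemma grid_increment_independent : independent_noise P grid_increment.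
Proof.
move=> B m mB.
pose B' (i : 'I_m) : set R := (fun y => mu * h + sigma * y) @^-1` B i.
have mB' i : measurable (B' i).
  rewrite -[X in measurable X]setTI.
  have : measurable_fun setT (fun y : R => mu * h + sigma * y).
    by apply: measurable_funD => //; exact: measurable_funM.
  by apply.
have t0 : 0 <= h * 0%:R :> R by rewrite mulr0.
have tle i : h * i%:R <= h * i.+1%:R by rewrite ler_pM2l// ler_nat.
have H := bm_independent hW (n := m) (t := fun i => h * i%:R) t0 tle.
have := H [set: 'I_m]%SET B' (fun i _ => mB' i).
have pre (i : nat) (C : set R) : grid_increment i @^-1` C =
    (fun w => W (h * i.+1%:R) w - W (h * i%:R) w) @^-1`
      ((fun y => mu * h + sigma * y) @^-1` C).
  by apply/seteqP; split => w /=; rewrite grid_incrementE.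
rewrite big_mkord => e.
transitivity (\prod_(i in [set: 'I_m]%SET) P ((fun w : T =>
    (W (h * i.+1%:R)%R w - W (h * i%:R)%R w)%R) @^-1` B' i))%E.
  rewrite -e; congr (P _); apply/seteqP; split => w Hw i /=.
    by move=> _; have /= := Hw i; rewrite ltn_ord => /(_ isT); rewrite grid_incrementE.
  move=> im; have /= := Hw (Ordinal im); rewrite inE => /(_ isT).
  by rewrite /B' /= -grid_incrementE.
apply: eq_big => [i|i _]; first by rewrite inE.
by rewrite pre.
Qed.

End brownian_increments.

(** * The phases of the grid chain *)

(* [k.+1] drawdowns remain to be counted in [Search k j] and [Recover k j]. In
   [Search k j] the path has climbed to level [j] since the last of them and not
   yet to level [j.+1]; in [Recover k j] it has yet to climb to level [j]. *)
Inductive phase := Search of nat & nat | Recover of nat & nat | Done of nat | Fail.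

Lemma rank_up (J j : nat) : (j.+1 < J)%N -> ((J - j.+1).*2.+1 < (J - j).*2.+1)%N.
Proof. lia. Qed.

Lemma rank_down (J j : nat) : (j.+2 < J)%N -> ((J - j.+2).*2.+2 < (J - j).*2.+1)%N.
Proof. lia. Qed.

Lemma pred_last (J j : nat) : (J <= j.+1)%N -> (J - j).-1 = 0%N.
Proof. lia. Qed.

Lemma pred2_last (J j : nat) : (J <= j.+2)%N -> (J - j).-2 = 0%N.
Proof. lia. Qed.

Section grid_chain.
Context (R : realType).
Variables (bp bm e a : R) (J : nat).

(** A jump of size at least [e] fails, so that a step crosses at most one boundary of a band.
    Reaching level [J] fails too: the maximum has become too large. [Done] records the time of the
    last drawdown, from which the discount is computed. *)
Definition next (l : nat) (p : phase) (x y : R) : phase :=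
  match p with
  | Search k j =>
      if e <= `|y - x| then Fail
      else if j.+1%:R * e <= y then (if (j.+1 < J)%N then Search k j.+1 else Fail)
      else if y <= j%:R * e - a then
        (if k is k'.+1 then (if (j.+2 < J)%N then Recover k' j.+2 else Fail)
         else Done l.+1)
      else Search k j
  | Recover k j =>
      if e <= `|y - x| then Fail
      else if j%:R * e <= y then Search k j else Recover k j
  | _ => p
  end.

Definition in_phase (p : phase) (x : R) : bool :=
  match p with
  | Search k j => [&& (j < J)%N, j%:R * e - a < x & x < j.+1%:R * e]
  | Recover k j => (j < J)%N && (x < j%:R * e)
  | _ => true
  end.

(** Recovering a level comes before searching it, and every other change of phase raises the level
    or ends the run. *)
Definition rank (p : phase) : nat :=
  match p with
  | Search k j => (J - j).*2.+1
  | Recover k j => (J - j).*2.+2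
  | _ => 0%N
  end.

(* Discounted value of [k.+1] further drawdowns when [i] levels remain. After a
   drawdown the next level is skipped. *)
Fixpoint level_value (k i : nat) {struct i} : R :=
  if i is i'.+1 then
    exit_up bp bm e a * level_value k i' +
    exit_down bp bm e a *
      (if k is k'.+1 then expR (- (bp * (a + 2 * e))) * level_value k' i'.-1 else 1)
  else 0.

Definition base (p : phase) : R :=
  match p with
  | Search _ j | Recover _ j => j%:R * e
  | _ => 0
  end.

(** Value at the lower boundary j e - a: climbing from there to level j + 2, a distance [a + 2 * e],
    has discounted probability e^(- bp (a + 2 e)). *)
Definition down_value k j : R :=
  if k is k'.+1 then expR (- (bp * (a + 2 * e))) * level_value k' (J - j).-2 else 1.

Definition coef_p (p : phase) : R :=
  match p with
  | Search k j => exit_cp bp bm e a (level_value k (J - j).-1) (down_value k j)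
  | Recover k j => level_value k (J - j)
  | _ => 0
  end.

Definition coef_m (p : phase) : R :=
  if p is Search k j then
    exit_cm bp bm e a (level_value k (J - j).-1) (down_value k j)
  else 0.

Definition value (p : phase) (x : R) : R :=
  coef_p p * expR (bp * (x - base p)) + coef_m p * expR (bm * (x - base p)).

(** Pays the unit reward at the moment of completion. Afterwards the reward is carried separately,
    and [value] vanishes in [Done]. *)
Definition terminal_value (p : phase) (x : R) : R :=
  if p is Done _ then 1 else value p x.

(** A shift of the argument changes the two exponentials by different factors, so the parts are
    measured without cancellation. *)
Definition value_size (p : phase) (x : R) : R :=
  `|coef_p p| * expR (bp * (x - base p)) + `|coef_m p| * expR (bm * (x - base p)).

Hypotheses (bp_gt0 : 0 < bp) (bm_lt0 : bm < 0) (e_gt0 : 0 < e) (a_gt0 : 0 < a).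

(** The weights satisfy [exit_up + exit_down <= 1]. Strong induction is required because a drawdown
    skips a level. *)
Lemma level_value_ge0_le1 k i : 0 <= level_value k i <= 1.
Proof.
suff H m : forall k i, (i <= m)%N -> 0 <= level_value k i <= 1 by apply: (H i).
elim: m => [|m IH] {}k {}i.
  by rewrite leqn0 => /eqP ->; rewrite /= lexx ler01.
case: i => [|i] im; first by rewrite /= lexx ler01.
have p0 := exit_up_ge0 bp_gt0 bm_lt0 e_gt0 a_gt0.
have q0 := exit_down_ge0 bp_gt0 bm_lt0 e_gt0 a_gt0.
have pq := exit_up_down_le1 bp_gt0 bm_lt0 e_gt0 a_gt0.
have /andP[u0 u1] := IH k i im.
rewrite /=; set v := (if k is _.+1 then _ else 1).
have /andP[v0 v1] : 0 <= v <= 1.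
  rewrite /v; case: (k) => [|k']; first by rewrite ler01 lexx.
  have /andP[w0 w1] : 0 <= level_value k' i.-1 <= 1.
    by apply: IH; rewrite (leq_trans (leq_pred _)).
  rewrite mulr_ge0 ?expR_ge0//= mulr_ile1 ?expR_ge0//.
  by rewrite -expR0 ler_expR oppr_le0 mulr_ge0 ?ltW// addr_gt0// mulr_gt0.
apply/andP; split; first by rewrite addr_ge0// mulr_ge0.
have := ler_wpM2l p0 u1; have := ler_wpM2l q0 v1; lra.
Qed.

Lemma down_value_ge0_le1 k j : 0 <= down_value k j <= 1.
Proof.
case: k => [|k]; first by rewrite /= ler01 lexx.
have /andP[w0 w1] := level_value_ge0_le1 k (J - j).-2.
rewrite /= mulr_ge0 ?expR_ge0//= mulr_ile1 ?expR_ge0//.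
by rewrite -expR0 ler_expR oppr_le0 mulr_ge0 ?ltW// addr_gt0// mulr_gt0.
Qed.

Lemma value_search_top k j : value (Search k j) (j.+1%:R * e) = level_value k (J - j).-1.
Proof.
rewrite /value /= -natr1 mulrDl mul1r addrAC subrr add0r.
exact: exit_valE_up.
Qed.

Lemma value_search_bottom k j : value (Search k j) (j%:R * e - a) = down_value k j.
Proof.
rewrite /value /= addrAC subrr add0r !mulrN.
exact: exit_valE_down.
Qed.

(** The recursion defining [level_value] is exactly this matching condition between adjacent
    bands. *)
Lemma value_search_base k j : (j < J)%N ->
  value (Search k j) (j%:R * e) = level_value k (J - j).
Proof.
move=> jJ; rewrite /value /= subrr !mulr0 expR0 !mulr1 exit_valE//.
rewrite /down_value; case: (J - j)%N (subn_gt0 j J) => [|i _].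
  by rewrite jJ.
by case: k.
Qed.

(** A common bound for the absolute values of [bp] and [bm]. *)
Definition exit_rate : R := bp - bm.
Definition overshoot (d : R) : R := expR (exit_rate * `|d|) - 1.

(** The first factor bounds both coefficients in every phase, the second one the sum of the two
    exponentials on [- a, e]. *)
Definition size_bound : R :=
  (1 + (expR (bp * e) + expR (- (bm * a))) / exit_den bp bm e a)
  * (2 * expR (exit_rate * (e + a))).

Let den_gt0 := exit_den_gt0 bp_gt0 bm_lt0 e_gt0 a_gt0.

Let CC := (expR (bp * e) + expR (- (bm * a))) / exit_den bp bm e a.
Let CC_ge0 : 0 <= CC.
Proof. by apply: divr_ge0; [rewrite addr_ge0 ?expR_ge0|exact: ltW den_gt0]. Qed.

Let rate_ge0 : 0 <= exit_rate.
Proof. by rewrite /exit_rate; have := bm_lt0; have := bp_gt0; lra. Qed.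

Lemma size_bound_ge1 : 1 <= size_bound.
Proof.
rewrite /size_bound -/CC; move: (CC) CC_ge0 => C0 C0_ge0.
have E1 : 1 <= expR (exit_rate * (e + a)).
  rewrite -expR0 ler_expR; apply: mulr_ge0 => //.
  by have := e_gt0; have := a_gt0; lra.
by have := mulr_ge0 C0_ge0 (expR_ge0 (exit_rate * (e + a))); lra.
Qed.

Lemma coef_bound p : `|coef_p p| <= 1 + CC /\ `|coef_m p| <= 1 + CC.
Proof.
have C1 : 0 <= 1 + CC by rewrite addr_ge0.
case: p => [k j|k j|l|] /=; rewrite ?normr0//.
  have [h1 h2] := exit_coef_bound bp_gt0 bm_lt0 e_gt0 a_gt0
    (level_value_ge0_le1 k (J - j).-1) (down_value_ge0_le1 k j).
  by split; rewrite ler_wpDl// -/CC.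
split=> //; have /andP[w0 w1] := level_value_ge0_le1 k (J - j).
by rewrite ger0_norm// ler_wpDr.
Qed.

Lemma value_size_search k j x : - a <= x - j%:R * e <= e ->
  value_size (Search k j) x <= size_bound.
Proof.
move=> /andP[xa xe]; have [hp hm] := coef_bound (Search k j).
have e0 := e_gt0; have a0 := a_gt0; have b0 := bp_gt0; have m0 := bm_lt0.
have x1 : `|x - j%:R * e| <= e + a by rewrite ler_norml; apply/andP; split; lra.
have E1 : expR (bp * (x - j%:R * e)) <= expR (exit_rate * (e + a)).
  rewrite ler_expR (le_trans (ler_norm _))// normrM gtr0_norm// ler_pM// ?ltW//.
  by rewrite /exit_rate; have := bm_lt0; lra.
have E2 : expR (bm * (x - j%:R * e)) <= expR (exit_rate * (e + a)).
  rewrite ler_expR (le_trans (ler_norm _))// normrM ltr0_norm// ler_pM// ?ltW//.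
    by rewrite oppr_gt0.
  by rewrite /exit_rate; have := bp_gt0; lra.
rewrite /value_size /size_bound -/CC.
have := ler_pM (normr_ge0 _) (expR_ge0 _) hp E1.
have := ler_pM (normr_ge0 _) (expR_ge0 _) hm E2.
rewrite /=; lra.
Qed.

Lemma value_size_recover k j x : x <= j%:R * e ->
  value_size (Recover k j) x <= size_bound.
Proof.
move=> xj; rewrite /value_size /= normr0 mul0r addr0.
have /andP[w0 w1] := level_value_ge0_le1 k (J - j).
apply: (le_trans _ size_bound_ge1); rewrite ger0_norm// mulr_ile1 ?expR_ge0//.
by rewrite -[leRHS]expR0 ler_expR pmulr_rle0// subr_le0.
Qed.

Lemma value_size_in_phase p x : in_phase p x -> value_size p x <= size_bound.
Proof.
case: p => [k j /and3P[_ x1 x2]|k j /andP[_ x1]|l _|_].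
- apply: value_size_search; apply/andP; split; first lra.
  by move: x2; rewrite -natr1; lra.
- by apply: value_size_recover; exact: ltW.
- by rewrite /value_size /= normr0 !mul0r addr0 (le_trans _ size_bound_ge1).
- by rewrite /value_size /= normr0 !mul0r addr0 (le_trans _ size_bound_ge1).
Qed.

Lemma value_le_size p x : `|value p x| <= value_size p x.
Proof.
rewrite /value /value_size (le_trans (ler_normD _ _))// !normrM.
by rewrite !(ger0_norm (expR_ge0 _)).
Qed.

Let exp_shift (b c y L : R) : `|b| <= exit_rate ->
  `|expR (b * (y - L)) - expR (b * (c - L))| <= expR (b * (c - L)) * overshoot (y - c).
Proof.
move=> bE.
have -> : b * (y - L) = b * (c - L) + b * (y - c) by ring.
rewrite expRD -{2}[expR (b * (c - L))]mulr1 -mulrBr normrM ger0_norm ?expR_ge0//.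
rewrite ler_wpM2l ?expR_ge0// (le_trans (normr_expR_sub1 _))// lerD2r ler_expR.
by rewrite normrM ler_wpM2r.
Qed.

Let bpE : `|bp| <= exit_rate.
Proof. by rewrite gtr0_norm// /exit_rate; have := bm_lt0; lra. Qed.
Let bmE : `|bm| <= exit_rate.
Proof. by rewrite ltr0_norm// /exit_rate; have := bp_gt0; lra. Qed.

Lemma overshoot_ge0 d : 0 <= overshoot d.
Proof.
by rewrite /overshoot subr_ge0 -expR0 ler_expR mulr_ge0.
Qed.

Lemma le_overshoot d d' : `|d| <= `|d'| -> overshoot d <= overshoot d'.
Proof.
move=> dd; rewrite /overshoot lerD2r ler_expR ler_wpM2l//.
Qed.

Lemma value_shift p c y : `|value p y - value p c| <= value_size p c * overshoot (y - c).
Proof.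
rewrite /value /value_size.
have -> : forall s t u v s' t' : R, s * u + t * v - (s * s' + t * t') =
    s * (u - s') + t * (v - t') by move=> *; ring.
rewrite (le_trans (ler_normD _ _))// !normrM mulrDl -!mulrA.
by rewrite lerD// ler_wpM2l// exp_shift.
Qed.

(* Both values agree at a point [c] between [x] and [y]. *)
Let crossing p q c x y : value p c = terminal_value q c ->
  value_size p c <= size_bound -> value_size q c <= size_bound ->
  `|y - c| <= `|y - x| ->
  `|terminal_value q y - terminal_value p y| <= 2 * size_bound * overshoot (y - x) \/
  exists l, p = Done l.
Proof.
move=> vpq sp sq yc.
have [[l ->]|pD] := pselect (exists l, p = Done l); first by right; exists l.
left.
have -> : terminal_value p y = value p y.
  by case: p pD {vpq sp} => // l []; exists l.
have oo := le_overshoot yc.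
have B0 : 0 <= size_bound by rewrite (le_trans _ size_bound_ge1).
have hp : `|value p y - value p c| <= size_bound * overshoot (y - x).
  by rewrite (le_trans (value_shift _ _ _))// ler_pM// ?overshoot_ge0//
    (le_trans _ (value_le_size _ _)).
have hq : `|terminal_value q y - terminal_value q c| <= size_bound * overshoot (y - x).
  have : `|value q y - value q c| <= size_bound * overshoot (y - x).
    by rewrite (le_trans (value_shift _ _ _))// ler_pM// ?overshoot_ge0//
      (le_trans _ (value_le_size _ _)).
  case: q vpq sq => //= l _ _ _.
  by rewrite subrr normr0 mulr_ge0// overshoot_ge0.
have -> : terminal_value q y - value p y =
   (terminal_value q y - terminal_value q c) - (value p y - value p c).
  by rewrite vpq; ring.
rewrite (le_trans (ler_normB _ _))//; lra.
Qed.

(** The 2 pays for a boundary crossing, where the old and the new value are both shifted. The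
    inverse pays, together with one shift, for a failing jump of size at least [e], whose overshoot
    is at least e^(exit_rate e) - 1. *)
Definition jump_const : R := size_bound * (2 + (expR (exit_rate * e) - 1)^-1).

Lemma step_in_phase l p x y : in_phase p x -> in_phase (next l p x y) y.
Proof.
case: p => [k j|k j|m|] //=.
- move=> /and3P[jJ x1 x2]; case: leP => // exy.
  case: leP => [y1|y1].
    case: ltnP => // jJ1 /=; rewrite jJ1 /=.
    move: exy; rewrite ltr_norml => /andP[exy1 exy2].
    move: x2 y1; rewrite -![_.+2%:R]natr1 -![_.+1%:R]natr1 => x2 y1.
    have := a_gt0 => ?; apply/andP; split; lra.
  case: leP => [y2|y2]; last by rewrite /= jJ y1 y2.
  case: k => [//|k]; case: ltnP => // jJ2 /=; rewrite jJ2 /=.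
  by rewrite -![_.+2%:R]natr1 -![_.+1%:R]natr1; have := a_gt0; have := e_gt0; lra.
- move=> /andP[jJ x1]; case: leP => // exy.
  case: leP => [y1|y1]; rewrite /= jJ ?y1//=.
  move: exy; rewrite ltr_norml => /andP[exy1 exy2].
  by rewrite -natr1; have := a_gt0 => ?; apply/andP; split; lra.
Qed.

(** At the boundary point crossed by the step both phases have the same value, so at [y] they differ
    by two shifts of size [overshoot]. When the levels run out, matching with [Fail] holds because
    zero levels have value 0. *)
Lemma step_mismatch l p x y : in_phase p x ->
  next l p x y = p \/
  ((rank (next l p x y) < rank p)%N /\
   `|terminal_value (next l p x y) y - terminal_value p y|
   <= jump_const * overshoot (y - x)).
Proof.
move=> inp.
have B1 := size_bound_ge1; have B0 : 0 <= size_bound by rewrite (le_trans _ B1).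
have E0 : 0 < expR (exit_rate * e) - 1.
  rewrite subr_gt0 -expR0 ltr_expR mulr_gt0// /exit_rate.
  by have := bm_lt0; have := bp_gt0; lra.
have le2 q p' z : `|terminal_value q y - terminal_value p' y| <= 2 * size_bound * overshoot z ->
   `|terminal_value q y - terminal_value p' y| <= jump_const * overshoot z.
  move=> /le_trans; apply; rewrite ler_wpM2r ?overshoot_ge0// /jump_const.
  rewrite mulrC ler_wpM2l// lerDl invr_ge0 ltW//.
have failure : (forall m, p <> Done m) -> e <= `|y - x| ->
    `|terminal_value Fail y - terminal_value p y| <= jump_const * overshoot (y - x).
  move=> pD exy; have -> : terminal_value p y = value p y.
    by case: p pD {inp} => // m /(_ m).
  rewrite /= /value /= !mul0r addr0 sub0r normrN.
  have vs := value_size_in_phase inp.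
  have h1 := value_shift p x y; have h2 := value_le_size p x.
  have h3 : `|value p y| <= `|value p x| + `|value p y - value p x|.
    by rewrite -{1}[value p y](subrKC (value p x)) ler_normD.
  have h4 : value_size p x * overshoot (y - x) <= size_bound * overshoot (y - x).
    by rewrite ler_wpM2r// overshoot_ge0.
  have h5 : 1 <= (expR (exit_rate * e) - 1)^-1 * overshoot (y - x).
    by rewrite mulrC ler_pdivlMr// mul1r /overshoot lerD2r ler_expR ler_wpM2l//.
  have h6 := ler_wpM2l B0 h5; have h7 := mulr_ge0 B0 (overshoot_ge0 (y - x)).
  rewrite /jump_const; lra.
case: p inp failure => [k j|k j|m|] inp failure; rewrite /next; [| |by left|by left].
- have /and3P[jJ x1 x2] := inp.
  case: (leP e `|y - x|) => exy; first by right; split=> //; exact: failure.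
  have e0 := e_gt0; have a0 := a_gt0.
  have top_size : value_size (Search k j) (j.+1%:R * e) <= size_bound.
    by apply: value_size_search; rewrite -natr1; apply/andP; split; lra.
  have bot_size : value_size (Search k j) (j%:R * e - a) <= size_bound.
    by apply: value_size_search; apply/andP; split; lra.
  have zero_size q z : (coef_p q = 0 /\ coef_m q = 0) ->
      value_size q z <= size_bound.
    by move=> [h1 h2]; rewrite /value_size h1 h2 normr0 !mul0r addr0.
  have close c : x <= c <= y \/ y <= c <= x -> `|y - c| <= `|y - x|.
    case=> /andP[c1 c2].
      by rewrite !ger0_norm; lra.
    by rewrite !ler0_norm; lra.
  case: (leP (j.+1%:R * e) y) => [y1|y1].
    right; case: (ltnP j.+1 J) => jJ1.
      split; first exact: (rank_up jJ1).
      have [||||h|[m]//] := @crossing (Search k j) (Search k j.+1) (j.+1%:R * e) x y.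
      - by rewrite value_search_top /= value_search_base// subnS.
      - exact: top_size.
      - by apply: value_size_search; apply/andP; split; lra.
      - by apply: close; left; apply/andP; split; [exact: ltW|].
      - exact: le2.
    split=> //.
    have [||||h|[m]//] := @crossing (Search k j) Fail (j.+1%:R * e) x y.
    - rewrite value_search_top /= /value /= !mul0r addr0.
      by rewrite (pred_last jJ1).
    - exact: top_size.
    - exact: zero_size.
    - by apply: close; left; apply/andP; split; [exact: ltW|].
    - exact: le2.
  case: (leP y (j%:R * e - a)) => [y2|y2]; last by left.
  right; case: k {inp failure} top_size bot_size => [|k] top_size bot_size.
    split=> //.
    have [||||h|[m]//] := @crossing (Search 0 j) (Done l.+1) (j%:R * e - a) x y.
    - by rewrite value_search_bottom.
    - exact: bot_size.
    - exact: zero_size.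
    - by apply: close; right; apply/andP; split; [|exact: ltW].
    - exact: le2.
  case: (ltnP j.+2 J) => jJ2.
    split; first exact: (rank_down jJ2).
    have [||||h|[m]//] := @crossing (Search k.+1 j) (Recover k j.+2) (j%:R * e - a) x y.
    - rewrite value_search_bottom /= /value /= mul0r addr0 mulrC !subnS.
      by congr (_ * expR _); rewrite -[j.+2%:R]natr1 -[j.+1%:R]natr1; ring.
    - exact: bot_size.
    - apply: value_size_recover.
      by rewrite -[j.+2%:R]natr1 -[j.+1%:R]natr1; lra.
    - by apply: close; right; apply/andP; split; [|exact: ltW].
    - exact: le2.
  split=> //.
  have [||||h|[m]//] := @crossing (Search k.+1 j) Fail (j%:R * e - a) x y.
  - rewrite value_search_bottom /= /value /= !mul0r addr0.
    by rewrite (pred2_last jJ2) mulr0.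
  - exact: bot_size.
  - exact: zero_size.
  - by apply: close; right; apply/andP; split; [|exact: ltW].
  - exact: le2.
- have /andP[jJ x1] := inp.
  case: (leP e `|y - x|) => exy; first by right; split=> //; exact: failure.
  case: (leP (j%:R * e) y) => [y1|y1]; last by left.
  right; split=> //.
  have [||||h|[m]//] := @crossing (Recover k j) (Search k j) (j%:R * e) x y.
  - by rewrite /= value_search_base// /value /= subrr mulr0 expR0 mul0r addr0 mulr1.
  - exact: value_size_recover.
  - apply: value_size_search; have := e_gt0; have := a_gt0.
    by move=> *; apply/andP; split; lra.
  - by rewrite !ger0_norm; lra.
  - exact: le2.
Qed.

End grid_chain.

(** * Expected reward of the grid chain *)

HB.instance Definition _ := gen_eqMixin phase.
HB.instance Definition _ := gen_choiceMixin phase.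
HB.instance Definition _ := isPointed.Build phase Fail.
HB.instance Definition _ := @isMeasurable.Build default_measure_display
  phase discrete_measurable discrete_measurable0
  discrete_measurableC discrete_measurableU.

Definition phase_code (p : phase) : nat :=
  match p with
  | Search k j => pickle (0%N, k, j)
  | Recover k j => pickle (1%N, k, j)
  | Done l => pickle (2%N, l, 0%N)
  | Fail => pickle (3%N, 0%N, 0%N)
  end.

Lemma phase_code_inj : injective phase_code.
Proof.
by move=> [k j|k j|l|] [k' j'|k' j'|l'|] /(pcan_inj (@pickleK _)) // [] // -> // ->.
Qed.

Section measurable_phase.
Context d1 d2 (X : measurableType d1) (Y : measurableType d2).

(** There are countably many phases, all measurable as singletons, so a preimage is a countable
    union of rectangles. *)
Lemma measurable_fun_phase (f : phase * X -> Y) :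
  (forall p, measurable_fun setT (fun x => f (p, x))) -> measurable_fun setT f.
Proof.
move=> mf _ B mB; rewrite setTI.
have -> : f @^-1` B = \bigcup_n
    ([set p | phase_code p = n] `*`
     [set x | exists2 p, phase_code p = n & B (f (p, x))]).
  apply/seteqP; split=> [[p x] /= Bf|[p x] [n _ [/= pn [q qn Bf]]]].
    by exists (phase_code p) => //=; split=> //; exists p.
  by rewrite (phase_code_inj (etrans pn (esym qn))).
apply: bigcupT_measurable => n; apply: measurableX; first by [].
have [[p pn]|np] := pselect (exists p, phase_code p = n); last first.
  rewrite (_ : [set x | _] = set0)//; apply/seteqP; split=> // x [p pn _].
  by apply: np; exists p.
rewrite (_ : [set x | _] = (fun x => f (p, x)) @^-1` B).
  by rewrite -[X in measurable X]setTI; exact: mf.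
apply/seteqP; split=> [x [q qn]|x Bx]; last by exists p.
by rewrite -(phase_code_inj (etrans pn (esym qn))).
Qed.

End measurable_phase.

Lemma next_done (R : realType) (e a : R) J l p x y m :
  next e a J l p x y = Done m -> m = l.+1 \/ p = Done m.
Proof.
case: p => [[|k] j|k j|m'|] /=; last by [].
- by case: ifP => _ //; case: ifP => _; [case: ifP|case: ifP => _ // []; left].
- by case: ifP => _ //; case: ifP => _; [case: ifP|case: ifP => _ //; case: ifP].
- by case: ifP => _ //; case: ifP.
- by right.
Qed.

Section measurable_grid_chain.
Context (R : realType).
Variables (bp bm e a : R) (J : nat).

Definition grid_step (l : nat) (s : (phase * R) * R) : phase * R :=
  (next e a J l s.1.1 s.1.2 (s.1.2 + s.2), s.1.2 + s.2).

Let mcst (p : phase) D : measurable_fun D (fun _ : R * R => p).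
Proof. exact: measurable_cst. Qed.

Lemma measurable_next l p :
  measurable_fun setT (fun z : R * R => next e a J l p z.1 (z.1 + z.2)).
Proof.
have mD : measurable_fun setT (fun z : R * R => z.1 + z.2) by exact: measurable_funD.
have mN : measurable_fun setT (fun z : R * R => `|z.1 + z.2 - z.1|).
  by apply: measurableT_comp => //; exact: measurable_funB.
case: p => [k j|k j|m|]; rewrite /next; [| |exact: mcst|exact: mcst].
- apply: measurable_fun_ifT => //; first exact: measurable_fun_ler.
  apply: measurable_fun_ifT => //; first exact: measurable_fun_ler.
  apply: measurable_fun_ifT => //; first exact: measurable_fun_ler.
- apply: measurable_fun_ifT => //; first exact: measurable_fun_ler.
  apply: measurable_fun_ifT => //; first exact: measurable_fun_ler.
Qed.

Lemma measurable_grid_step l : measurable_fun setT (grid_step l).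
Proof.
pose f (z : phase * (R * R)) : phase * R :=
  (next e a J l z.1 z.2.1 (z.2.1 + z.2.2), z.2.1 + z.2.2).
have -> : grid_step l = f \o (fun s => (s.1.1, (s.1.2, s.2))) by [].
apply: measurableT_comp.
  apply: measurable_fun_phase => p /=; apply: measurable_fun_pair.
    exact: measurable_next.
  by rewrite /=; apply: measurable_funD.
apply: measurable_fun_pair; first by apply: measurableT_comp.
by apply: measurable_fun_pair => //; apply: measurableT_comp.
Qed.

Hypotheses (bp_gt0 : 0 < bp) (bm_lt0 : bm < 0) (e_gt0 : 0 < e) (a_gt0 : 0 < a).

(* Truncation makes these bounded; the chain never leaves [in_phase]. *)
Definition part_p (s : phase * R) : R :=
  if in_phase e a J s.1 s.2 then
    coef_p bp bm e a J s.1 * expR (bp * (s.2 - base e s.1)) else 0.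
Definition part_m (s : phase * R) : R :=
  if in_phase e a J s.1 s.2 then
    coef_m bp bm e a J s.1 * expR (bm * (s.2 - base e s.1)) else 0.

Let B := size_bound bp bm e a.

Lemma part_bound s : `|part_p s| + `|part_m s| <= B.
Proof.
have B1 := size_bound_ge1 bp_gt0 bm_lt0 e_gt0 a_gt0.
rewrite /part_p /part_m; case: ifPn => [inp|_]; last first.
  by rewrite !normr0 addr0 (le_trans _ B1).
have := value_size_in_phase bp_gt0 bm_lt0 e_gt0 a_gt0 inp.
by rewrite !normrM !(ger0_norm (expR_ge0 _)).
Qed.

Lemma part_p_bound s : `|part_p s| <= B.
Proof. by have := part_bound s; apply: le_trans; rewrite lerDl. Qed.

Lemma part_m_bound s : `|part_m s| <= B.
Proof. by have := part_bound s; apply: le_trans; rewrite lerDr. Qed.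

Lemma measurable_in_phase p : measurable_fun setT (fun x : R => in_phase e a J p x).
Proof.
case: p => [k j|k j|m|]; rewrite /in_phase.
- apply: measurable_and => //; apply: measurable_and => //; exact: measurable_fun_ltr.
- by apply: measurable_and => //; exact: measurable_fun_ltr.
- exact: measurable_cst.
- exact: measurable_cst.
Qed.

Let measurable_part (c b : R) p :
  measurable_fun setT (fun x : R =>
    if in_phase e a J p x then c * expR (b * (x - base e p)) else 0).
Proof.
apply: measurable_fun_ifT => //; first exact: measurable_in_phase.
apply: measurable_funM => //; apply: measurableT_comp => //.
by apply: measurable_funM => //; exact: measurable_funB.
Qed.

Lemma measurable_part_p : measurable_fun setT part_p.
Proof. by apply: measurable_fun_phase => p; exact: measurable_part. Qed.

Lemma measurable_part_m : measurable_fun setT part_m.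
Proof. by apply: measurable_fun_phase => p; exact: measurable_part. Qed.

Definition reward (c : R) (s : phase * R) : R :=
  if s.1 is Done l then expR (- (c * l%:R)) else 0.

Lemma measurable_reward c : measurable_fun setT (reward c).
Proof. by apply: measurable_fun_phase => -[k j|k j|m|]; exact: measurable_cst. Qed.

Lemma reward_ge0_le1 c s : 0 <= c -> 0 <= reward c s <= 1.
Proof.
move=> c0; case: s => -[k j|k j|m|] x; rewrite /reward /= ?lexx ?ler01//.
by rewrite expR_ge0 -[leRHS]expR0 ler_expR oppr_le0 mulr_ge0.
Qed.

Lemma measurable_rank : measurable_fun setT (fun s : phase * R => (rank J s.1)%:R : R).
Proof. by apply: measurable_fun_phase => p; exact: measurable_cst. Qed.

End measurable_grid_chain.

(** * The approximate martingale and its error *)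

Section grid_chain_expectation.
Context d (T : measurableType d) (R : realType).
Variables (P : probability T R) (W : R -> {RV P >-> R}).
Hypothesis hW : brownian_motion W.
Variables (mu sigma lambda bp bm e a : R) (J k0 : nat).
Hypotheses (bp_gt0 : 0 < bp) (bm_lt0 : bm < 0) (e_gt0 : 0 < e) (a_gt0 : 0 < a).
Hypothesis lambda_gt0 : 0 < lambda.
Hypothesis bp_root : bp * mu + bp ^+ 2 * sigma ^+ 2 / 2 = lambda.
Hypothesis bm_root : bm * mu + bm ^+ 2 * sigma ^+ 2 / 2 = lambda.
Hypothesis J_gt1 : (1 < J)%N.

Section fixed_mesh.
Variable h : R.
Hypothesis h_gt0 : 0 < h.

Local Notation xi := (grid_increment W mu sigma h).
Local Notation c := (lambda * h).

(** Starting in [Recover k0 1] reflects that the first drawdown, like the later ones, requires the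
    maximum to exceed its previous value, here 0. *)
Definition grid_state := @driven _ _ T (phase * R)%type R xi (Recover k0 1, 0) (grid_step e a J).

Let mxi := measurable_grid_increment W mu sigma h.
Let mPhi := measurable_grid_step e a J.
Let hxi := grid_increment_independent hW mu sigma h_gt0.

Lemma measurable_grid_state l : measurable_fun setT (grid_state l).
Proof. exact: measurable_driven mxi mPhi l. Qed.

Lemma grid_state_in_phase l w :
  in_phase e a J (grid_state l w).1 (grid_state l w).2.
Proof.
elim: l => [|l IH] /=; first by rewrite J_gt1 mul1r.
exact: step_in_phase.
Qed.

(* A martingale, up to the overshoot at the changes of phase. *)
Definition potential (l : nat) (w : T) : R :=
  reward c (grid_state l w)
  + expR (- (c * l%:R)) * (part_p bp bm e a J (grid_state l w)
                          + part_m bp bm e a J (grid_state l w)).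

Let B := size_bound bp bm e a.
Let c_ge0 : 0 <= c. Proof. by rewrite mulr_ge0 ?ltW. Qed.

Let discount_le1 l : expR (- (c * l%:R)) <= 1.
Proof. by rewrite -[leRHS]expR0 ler_expR oppr_le0 mulr_ge0. Qed.

Lemma potential_reward_le l w :
  `|potential l w - reward c (grid_state l w)| <= expR (- (c * l%:R)) * B.
Proof.
rewrite /potential addrAC subrr add0r normrM ger0_norm ?expR_ge0//.
by rewrite ler_wpM2l ?expR_ge0// (le_trans (ler_normD _ _))// part_bound.
Qed.

Let mcomp (f : phase * R -> R) l :
  measurable_fun setT f -> measurable_fun setT (fun w => f (grid_state l w)).
Proof. by move=> mf; apply: measurableT_comp => //; exact: measurable_grid_state. Qed.

Lemma integrable_reward l :
  P.-integrable setT (EFin \o (fun w => reward c (grid_state l w))).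
Proof.
apply: (@bounded_RV_integrable _ _ _ _ _ 1) => [|w].
  exact: mcomp (measurable_reward _).
by have /andP[r0 r1] := reward_ge0_le1 (grid_state l w) c_ge0; rewrite ger0_norm.
Qed.

Lemma integrable_potential l : P.-integrable setT (EFin \o potential l).
Proof.
apply: (@bounded_RV_integrable _ _ _ _ _ (1 + B)) => [|w].
  apply: measurable_funD; first exact: mcomp (measurable_reward _).
  apply: measurable_funM => //; apply: measurable_funD; apply: mcomp.
    exact: measurable_part_p.
  exact: measurable_part_m.
rewrite /potential (le_trans (ler_normD _ _))// lerD//.
  by have /andP[r0 r1] := reward_ge0_le1 (grid_state l w) c_ge0; rewrite ger0_norm.
have := potential_reward_le l w; rewrite /potential addrAC subrr add0r.
move=> /le_trans; apply; rewrite ler_piMl//.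
by rewrite (le_trans _ (size_bound_ge1 bp_gt0 bm_lt0 e_gt0 a_gt0)).
Qed.

Lemma integrable_rank l :
  P.-integrable setT (EFin \o (fun w => (rank J (grid_state l w).1)%:R)).
Proof.
apply: (@bounded_RV_integrable _ _ _ _ _ (J.*2.+2)%:R) => [|w].
  by apply: (mcomp (f := fun s => (rank J s.1)%:R)); exact: measurable_rank.
rewrite ger0_norm// ler_nat /rank; case: (grid_state l w).1 => // *; lia.
Qed.

Lemma parts_value p x : in_phase e a J p x ->
  part_p bp bm e a J (p, x) + part_m bp bm e a J (p, x) = value bp bm e a J p x.
Proof. by move=> inp; rewrite /part_p /part_m /= inp. Qed.

Let drift l w : R :=
  part_p bp bm e a J (grid_state l w) * (expR (bp * xi l w) * expR (- c) - 1)
  + part_m bp bm e a J (grid_state l w) * (expR (bm * xi l w) * expR (- c) - 1).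

(** If the phase were kept, the potential would change by the discounted [drift]; what remains is
    the difference of the two value functions at the new point. *)
Lemma potential_step l w :
  potential l.+1 w - potential l w - expR (- (c * l%:R)) * drift l w
  = expR (- (c * l.+1%:R)) *
    (terminal_value bp bm e a J (grid_state l.+1 w).1 (grid_state l.+1 w).2
     - terminal_value bp bm e a J (grid_state l w).1 (grid_state l.+1 w).2).
Proof.
have in0 := grid_state_in_phase l w; have in1 := grid_state_in_phase l.+1 w.
rewrite /potential /drift.
case E0 : (grid_state l w) in0 => [p x] in0.
set y := x + xi l w; set q := next e a J l p x y.
have E1 : grid_state l.+1 w = (q, y).
  by rewrite -[LHS]/(grid_step e a J l (grid_state l w, xi l w)) E0.
rewrite E1 [(p, x).1]/= [(p, x).2]/= in in0 in1 *; rewrite [(q, y).1]/= [(q, y).2]/= in in1 *.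
rewrite !parts_value//.
have hc : expR (- (c * l.+1%:R)) = expR (- (c * l%:R)) * expR (- c).
  by rewrite -expRD -natr1; congr expR; ring.
have vy : value bp bm e a J p y =
    part_p bp bm e a J (p, x) * expR (bp * xi l w) +
    part_m bp bm e a J (p, x) * expR (bm * xi l w).
  rewrite /value /part_p /part_m /= in0 -!mulrA -!expRD.
  by congr (_ * expR _ + _ * expR _); rewrite /y; ring.
have vx := parts_value in0.
have shift : value bp bm e a J p y * expR (- c) - value bp bm e a J p x =
   part_p bp bm e a J (p, x) * (expR (bp * xi l w) * expR (- c) - 1)
   + part_m bp bm e a J (p, x) * (expR (bm * xi l w) * expR (- c) - 1).
  by rewrite vy -vx; ring.
rewrite -shift.
(* The recorded completion time is [l.+1], so the reward gained equals the discount factor in front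
   of the terminal value. *)
have rw : reward c (q, y) - reward c (p, x) =
   expR (- (c * l.+1%:R)) * ((terminal_value bp bm e a J q y - value bp bm e a J q y)
     - (terminal_value bp bm e a J p y - value bp bm e a J p y)).
  have [[m pm]|pD] := pselect (exists m, p = Done m).
    by rewrite /q pm /reward /= !subrr mulr0.
  have rp : reward c (p, x) = 0 by case: (p) pD => // m []; exists m.
  have tp : terminal_value bp bm e a J p y = value bp bm e a J p y.
    by case: (p) pD => // m []; exists m.
  rewrite rp tp subrr !subr0.
  case Eq : q => [k j|k j|m|]; rewrite /reward /= ?subrr ?mulr0//.
  have [->|pm] := next_done Eq; last by case: pD; exists m.
  by rewrite /value /= !mul0r addr0 subr0 mulr1.
have -> : reward c (q, y) = reward c (p, x) + (reward c (q, y) - reward c (p, x)).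
  by ring.
rewrite rw hc; ring.
Qed.

Let Xp (theta : R) l := fun w => expR (theta * xi l w).

Let measurable_Xp theta l : measurable_fun setT (Xp theta l).
Proof. by apply: measurableT_comp => //; apply: measurable_funM. Qed.

Let cumulant (theta : R) := theta * mu + theta ^+ 2 * sigma ^+ 2 / 2.

Let integrable_Xp theta l : P.-integrable setT (EFin \o Xp theta l).
Proof.
apply/integrableP; split; first exact/measurable_EFinP.
under eq_integral do rewrite /= ger0_norm ?expR_ge0//.
by rewrite (grid_increment_mgf hW)// ltry.
Qed.

Let Rintegral_Xp theta l : \int[P]_w Xp theta l w = expR (h * cumulant theta).
Proof. by rewrite /Rintegral (grid_increment_mgf hW). Qed.

Let integrable_D (f g : T -> R) : P.-integrable setT (EFin \o f) ->
  P.-integrable setT (EFin \o g) -> P.-integrable setT (EFin \o (fun w => f w + g w)).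
Proof. by move=> fi gi; have := integrableD measurableT fi gi; apply: eq_integrable. Qed.

Let integrable_Z (r : R) (f : T -> R) : P.-integrable setT (EFin \o f) ->
  P.-integrable setT (EFin \o (fun w => r * f w)).
Proof. by move=> fi; have := integrableZl measurableT r fi; apply: eq_integrable. Qed.

Let integrable_B (f g : T -> R) : P.-integrable setT (EFin \o f) ->
  P.-integrable setT (EFin \o g) -> P.-integrable setT (EFin \o (fun w => f w - g w)).
Proof. by move=> fi gi; have := integrableB measurableT fi gi; apply: eq_integrable. Qed.

(** The increment is independent of the state, and cumulant [lambda] means that its exponential has
    mean e^(lambda h), which the discount cancels. *)
Let drift_part (phi : phase * R -> R) theta l : measurable_fun setT phi ->
  (forall s, `|phi s| <= B) -> cumulant theta = lambda ->
  P.-integrable setT (EFin \o (fun w =>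
    phi (grid_state l w) * (expR (theta * xi l w) * expR (- c) - 1))) /\
  \int[P]_w (phi (grid_state l w) * (expR (theta * xi l w) * expR (- c) - 1)) = 0.
Proof.
move=> mphi phiB th.
have mg : measurable_fun setT (fun x : R => expR (theta * x)).
  exact: measurableT_comp.
have [i1 e1] := @expectation_driven _ _ T (phase * R)%type R P xi (Recover k0 1, 0)
  (grid_step e a J) mxi mPhi hxi l phi B (fun x => expR (theta * x)) _ mphi phiB
  mg (fun x => expR_ge0 _) (grid_increment_mgf hW mu sigma h_gt0 l theta).
have i2 : P.-integrable setT (EFin \o (fun w => phi (grid_state l w))).
  by apply: (@bounded_RV_integrable _ _ _ _ _ B) => //; exact: mcomp.
have eqf : (fun w => phi (grid_state l w) * (expR (theta * xi l w) * expR (- c) - 1))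
  = (fun w => expR (- c) * (phi (grid_state l w) * expR (theta * xi l w))
             - phi (grid_state l w)).
  by apply/funext => w; ring.
rewrite eqf; split; first by apply: integrable_B => //; exact: integrable_Z.
rewrite RintegralB//; last exact: integrable_Z.
rewrite RintegralZl// [X in _ * X - _]e1 -/(cumulant theta) th.
by rewrite mulrCA -expRD [h * lambda]mulrC addNr expR0 mulr1 subrr.
Qed.

Let drift_integral l : P.-integrable setT (EFin \o drift l) /\ \int[P]_w drift l w = 0.
Proof.
have [i1 e1] := drift_part l (measurable_part_p bp bm e a J)
  (part_p_bound J bp_gt0 bm_lt0 e_gt0 a_gt0) bp_root.
have [i2 e2] := drift_part l (measurable_part_m bp bm e a J)
  (part_m_bound J bp_gt0 bm_lt0 e_gt0 a_gt0) bm_root.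
by split; [exact: integrable_D|rewrite RintegralD// e1 e2 addr0].
Qed.

(** The fourth power of an exponential overshoot, rather than of the increment: it expands into
    exponentials with explicit means. *)
Definition fourth (theta x : R) : R := (expR (theta * x) - 1) ^+ 4.

Let fourthE theta l w : fourth theta (xi l w) =
  Xp (4 * theta) l w - 4 * Xp (3 * theta) l w + 6 * Xp (2 * theta) l w
  - 4 * Xp theta l w + 1.
Proof.
by rewrite /fourth /Xp -!mulrA !expRM_natl; ring.
Qed.

(** Second order Taylor remainders of exp(h * cumulant) for h <= 1, weighted by the binomial
    coefficients of the expansion. *)
Definition fourth_const (theta : R) : R :=
  let k (j : R) := cumulant (j * theta) ^+ 2 * expR `|cumulant (j * theta)| in
  k 4 + 4 * k 3 + 6 * k 2 + 4 * k 1.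

Lemma fourth_moment theta l : h <= 1 ->
  P.-integrable setT (EFin \o (fun w => fourth theta (xi l w))) /\
  \int[P]_w fourth theta (xi l w) <= fourth_const theta * h ^+ 2.
Proof.
move=> h1; rewrite (funext (fourthE theta l)).
have i1 : P.-integrable setT (EFin \o (fun=> 1 : R)).
  by apply: (@bounded_RV_integrable _ _ _ _ _ 1) => // w; rewrite normr1.
have iX t := integrable_Xp t l.
have j1 := integrable_B (iX (4 * theta)) (integrable_Z 4 (iX (3 * theta))).
have j2 := integrable_D j1 (integrable_Z 6 (iX (2 * theta))).
have j3 := integrable_B j2 (integrable_Z 4 (iX theta)).
split; first exact: integrable_D.
rewrite RintegralD// RintegralB//; last exact: integrable_Z.
rewrite RintegralD//; last exact: integrable_Z.
rewrite RintegralB//; last exact: integrable_Z.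
rewrite !RintegralZl// !Rintegral_Xp Rintegral_cst//.
have -> : fine (P setT) = 1 by rewrite probability_setT.
have gen (C : R) : `|expR (h * C) - 1 - h * C| <= C ^+ 2 * expR `|C| * h ^+ 2.
  apply: (le_trans (expR_taylor2 _)).
  have -> : C ^+ 2 * expR `|C| * h ^+ 2 = (h * C) ^+ 2 * expR `|C| by ring.
  rewrite ler_wpM2l ?sqr_ge0// ler_expR normrM ler_piMl//.
  by rewrite gtr0_norm.
have tay j := gen (cumulant (j * theta)).
have -> : cumulant theta = cumulant (1 * theta) by rewrite mul1r.
rewrite /fourth_const.
move: (tay 1) (tay 2) (tay 3) (tay 4); rewrite !ler_norml.
move=> /andP[a1 b1] /andP[a2 b2] /andP[a3 b3] /andP[a4 b4].
(* The cumulant is quadratic without constant term, so its fourth difference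
   vanishes and only the second order terms in [h] survive. *)
have sum0 : cumulant (4 * theta) - 4 * cumulant (3 * theta) + 6 * cumulant (2 * theta)
  - 4 * cumulant (1 * theta) = 0 by rewrite /cumulant; field.
have {}sum0 : h * cumulant (4 * theta) - 4 * (h * cumulant (3 * theta))
   + 6 * (h * cumulant (2 * theta)) - 4 * (h * cumulant (1 * theta)) = 0.
  by rewrite -[RHS](mulr0 h) -sum0; ring.
move: (cumulant (1 * theta)) (cumulant (2 * theta)) (cumulant (3 * theta))
  (cumulant (4 * theta)) a1 b1 a2 b2 a3 b3 a4 b4 sum0.
move=> c1 c2 c3 c4 a1 b1 a2 b2 a3 b3 a4 b4 sum0; lra.
Qed.

Let kappa := exit_rate bp bm.
Let C := jump_const bp bm e a.
Let C_ge0 : 0 <= C.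
Proof.
have B1 := size_bound_ge1 bp_gt0 bm_lt0 e_gt0 a_gt0.
rewrite /C /jump_const; apply: mulr_ge0; first by rewrite (le_trans _ B1).
apply: addr_ge0 => //; rewrite invr_ge0.
have := overshoot_ge0 bp_gt0 bm_lt0 e.
by rewrite /overshoot gtr0_norm.
Qed.

Definition error_const : R :=
  jump_const bp bm e a ^+ 4
  * (fourth_const (exit_rate bp bm) + fourth_const (- exit_rate bp bm)).

(** The sign of [x] decides which term is the overshoot; the other one, an even power, is
    nonnegative. *)
Let overshoot4 x : overshoot bp bm x ^+ 4 <= fourth kappa x + fourth (- kappa) x.
Proof.
have f0 t y : 0 <= fourth t y by rewrite /fourth exprn_even_ge0.
rewrite /overshoot -/kappa; have [x0|x0] := leP 0 x.
  by rewrite ger0_norm// lerDl.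
by rewrite ltr0_norm// mulrN -mulNr lerDr.
Qed.

Let young (t delta : R) : 0 <= t -> 0 < delta -> t <= delta + t ^+ 4 / delta ^+ 3.
Proof.
move=> t0 d0; have [td|dt] := leP t delta.
  by rewrite ler_wpDr// divr_ge0// exprn_ge0// ltW.
rewrite ler_wpDl ?(ltW d0)// ler_pdivlMr ?exprn_gt0//.
have -> : t ^+ 4 = t * t ^+ 3 by rewrite exprS.
by rewrite ler_wpM2l// lerXn2r// ?nnegrE// ltW.
Qed.

Let mis l w := potential l.+1 w - potential l w - expR (- (c * l%:R)) * drift l w.
Let rk l w : R := (rank J (grid_state l w).1)%:R.

(* Trading [delta] against the drop of the rank bounds the number of changes of
   phase, so that no bound on their expected number is needed. *)
Let mis_bound l w (delta : R) : 0 < delta ->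
  `|mis l w| <= delta * (rk l w - rk l.+1 w)
    + C ^+ 4 / delta ^+ 3 * (fourth kappa (xi l w) + fourth (- kappa) (xi l w)).
Proof.
move=> d0; rewrite /mis potential_step normrM ger0_norm ?expR_ge0//.
have C0 := C_ge0.
have f0 t y : 0 <= fourth t y by rewrite /fourth exprn_even_ge0.
have err0 : 0 <= C ^+ 4 / delta ^+ 3 * (fourth kappa (xi l w) + fourth (- kappa) (xi l w)).
  by rewrite mulr_ge0 ?addr_ge0// divr_ge0// exprn_ge0// ltW.
have in0 := grid_state_in_phase l w.
have E1 : grid_state l.+1 w = grid_step e a J l (grid_state l w, xi l w) by [].
rewrite /rk E1; case: (grid_state l w) in0 => p x; rewrite /grid_step /= => in0.
have dxy : x + xi l w - x = xi l w by ring.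
have [->|[rlt]] := step_mismatch bp_gt0 bm_lt0 e_gt0 a_gt0 l (x + xi l w) in0.
  by rewrite subrr normr0 mulr0 subrr mulr0 add0r.
rewrite dxy -/C; set D := `|_| => DC.
have D0 : 0 <= D by exact: normr_ge0.
have h1 : expR (- (c * l.+1%:R)) * D <= C * overshoot bp bm (xi l w).
  by apply: le_trans DC; rewrite ler_piMl.
have o0 := overshoot_ge0 bp_gt0 bm_lt0 (xi l w).
have := young (mulr_ge0 C0 o0) d0; rewrite exprMn => h2.
have h3 : C ^+ 4 * overshoot bp bm (xi l w) ^+ 4 / delta ^+ 3 <=
    C ^+ 4 / delta ^+ 3 * (fourth kappa (xi l w) + fourth (- kappa) (xi l w)).
  by rewrite mulrAC ler_wpM2l ?overshoot4// divr_ge0// exprn_ge0// ltW.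
have h4 : delta <= delta * ((rank J p)%:R - (rank J (next e a J l p x (x + xi l w)))%:R).
  rewrite ler_peMr ?(ltW d0)// lerBrDr addrC natr1 ler_nat.
  exact: rlt.
by apply: (le_trans h1); apply: (le_trans h2); apply: lerD.
Qed.

Lemma potential_increment l (delta : R) : 0 < delta -> h <= 1 ->
  `|\int[P]_w potential l.+1 w - \int[P]_w potential l w| <=
  delta * (\int[P]_w (rank J (grid_state l w).1)%:R
           - \int[P]_w (rank J (grid_state l.+1 w).1)%:R)
  + error_const / delta ^+ 3 * h ^+ 2.
Proof.
move=> d0 h1.
have [di d00] := drift_integral l.
have ip := integrable_potential l; have ip1 := integrable_potential l.+1.
have ir := integrable_rank l; have ir1 := integrable_rank l.+1.
have [if1 ef1] := fourth_moment kappa l h1.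
have [if2 ef2] := fourth_moment (- kappa) l h1.
have imis : P.-integrable setT (EFin \o mis l).
  by apply: integrable_B; [exact: integrable_B|exact: integrable_Z].
have <- : \int[P]_w mis l w = \int[P]_w potential l.+1 w - \int[P]_w potential l w.
  rewrite RintegralB//; [|exact: integrable_B|exact: integrable_Z].
  by rewrite RintegralB// RintegralZl// d00 mulr0 subr0.
have iabs : P.-integrable setT (EFin \o (fun w => `|mis l w|)).
  by have := integrable_norm imis.
have ib1 : P.-integrable setT (EFin \o (fun w => delta * (rk l w - rk l.+1 w))).
  by apply: integrable_Z; exact: integrable_B.
have ib2 : P.-integrable setT (EFin \o (fun w => C ^+ 4 / delta ^+ 3 *
    (fourth kappa (xi l w) + fourth (- kappa) (xi l w)))).
  by apply: integrable_Z; exact: integrable_D.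
apply: (le_trans (le_normr_Rintegral measurableT imis)).
apply: (@le_trans _ _ (\int[P]_w (delta * (rk l w - rk l.+1 w)
   + C ^+ 4 / delta ^+ 3 * (fourth kappa (xi l w) + fourth (- kappa) (xi l w))))).
  apply: le_Rintegral => //; first exact: integrable_D.
  by move=> w _; exact: mis_bound.
rewrite RintegralD// RintegralZl//; last exact: integrable_B.
rewrite RintegralB// RintegralZl//; last exact: integrable_D.
rewrite RintegralD// lerD2l.
rewrite /error_const -/C -/kappa.
have -> : C ^+ 4 * (fourth_const kappa + fourth_const (- kappa)) / delta ^+ 3 * h ^+ 2
  = C ^+ 4 / delta ^+ 3 * (fourth_const kappa * h ^+ 2 + fourth_const (- kappa) * h ^+ 2).
  by ring.
by rewrite ler_wpM2l ?lerD// divr_ge0// exprn_ge0// ?C_ge0// ltW.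
Qed.

(** The expected drops of the rank telescope to at most the initial rank, however many steps are
    taken. *)
Lemma potential_error N (delta : R) : 0 < delta -> h <= 1 ->
  `|\int[P]_w potential N w - \int[P]_w potential 0 w| <=
  delta * (J.*2.+2)%:R + N%:R * (error_const / delta ^+ 3 * h ^+ 2).
Proof.
move=> d0 h1.
have R0 l : 0 <= \int[P]_w (rank J (grid_state l w).1)%:R by exact: Rintegral_ge0.
have RJ : \int[P]_w (rank J (grid_state 0 w).1)%:R <= (J.*2.+2)%:R :> R.
  rewrite /grid_state /= Rintegral_cst//.
  have -> : fine (P setT) = 1 by rewrite probability_setT.
  by rewrite mulr1 ler_nat; lia.
suff : `|\int[P]_w potential N w - \int[P]_w potential 0 w| <=
    delta * (\int[P]_w (rank J (grid_state 0 w).1)%:R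
             - \int[P]_w (rank J (grid_state N w).1)%:R)
    + N%:R * (error_const / delta ^+ 3 * h ^+ 2).
  move=> /le_trans; apply; rewrite lerD2r ler_wpM2l ?(ltW d0)//.
  by rewrite lerBlDr ler_wpDr.
elim: N => [|N IH]; first by rewrite !subrr normr0 mulr0 mul0r addr0.
have := potential_increment N d0 h1.
rewrite -[N.+1%:R]natr1 mulrDl mul1r.
move: IH; move: (_ / _ * _) (N%:R * _) => K NK.
move: (\int[P]_w (rank J (grid_state 0 w).1)%:R) => r0.
move: (\int[P]_w (rank J (grid_state N w).1)%:R) => rN.
move: (\int[P]_w (rank J (grid_state N.+1 w).1)%:R) => rN1 H1 H2.
have -> : \int[P]_w potential N.+1 w - \int[P]_w potential 0 w =
  (\int[P]_w potential N.+1 w - \int[P]_w potential N w)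
  + (\int[P]_w potential N w - \int[P]_w potential 0 w) by ring.
by apply: (le_trans (ler_normD _ _)); lra.
Qed.

(** The three errors come from cutting off at the horizon, from changes of phase within the rank
    budget, and from large increments. The initial value is that of [Recover k0 1] at distance [e]
    below its level, with [J.-1] levels left. *)
Lemma grid_reward_error N (delta : R) : 0 < delta -> h <= 1 ->
  `|\int[P]_w reward c (grid_state N w)
    - level_value bp bm e a k0 J.-1 * expR (- (bp * e))| <=
  expR (- (c * N%:R)) * B + delta * (J.*2.+2)%:R
  + N%:R * (error_const / delta ^+ 3 * h ^+ 2).
Proof.
move=> d0 h1.
have e0 : \int[P]_w potential 0 w = level_value bp bm e a k0 J.-1 * expR (- (bp * e)).
  have p0 w : potential 0 w = level_value bp bm e a k0 J.-1 * expR (- (bp * e)).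
    rewrite /potential /grid_state /= /reward /part_p /part_m /= J_gt1 mul1r e_gt0 /=.
    by rewrite mulr0 oppr0 expR0 mul1r add0r mul0r addr0 sub0r mulrN subn1.
  have -> : \int[P]_w potential 0 w =
      \int[P]_w cst (level_value bp bm e a k0 J.-1 * expR (- (bp * e))) w.
    by apply: eq_Rintegral => w _; exact: p0.
  rewrite Rintegral_cst//.
  have -> : fine (P setT) = 1 by rewrite probability_setT.
  by rewrite mulr1.
rewrite -e0.
have ip := integrable_potential N; have ir := integrable_reward N.
have hN : `|\int[P]_w reward c (grid_state N w) - \int[P]_w potential N w| <=
    expR (- (c * N%:R)) * B.
  rewrite -RintegralB//.
  have iB : P.-integrable setT (EFin \o (fun w =>
      reward c (grid_state N w) - potential N w)) by exact: integrable_B.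
  apply: (le_trans (le_normr_Rintegral measurableT iB)).
  apply: (@le_trans _ _ (\int[P]_w (cst (expR (- (c * N%:R)) * B) w))).
    apply: le_Rintegral => //.
    - by have := integrable_norm iB.
    - by apply: (@bounded_RV_integrable _ _ _ _ _ `|expR (- (c * N%:R)) * B|).
    - by move=> w _; rewrite distrC; exact: potential_reward_le.
  rewrite Rintegral_cst//.
  have -> : fine (P setT) = 1 by rewrite probability_setT.
  by rewrite mulr1.
have := potential_error N d0 h1.
have -> : \int[P]_w reward c (grid_state N w) - \int[P]_w potential 0 w =
  (\int[P]_w reward c (grid_state N w) - \int[P]_w potential N w)
  + (\int[P]_w potential N w - \int[P]_w potential 0 w) by ring.
move=> H; apply: (le_trans (ler_normD _ _)).
by rewrite -addrA lerD.
Qed.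

End fixed_mesh.

(* Chosen such that [mesh * horizon] tends to infinity and [mesh ^ 2 * horizon]
   to 0. *)
Definition mesh (i : nat) : R := (i.+1%:R ^+ 2)^-1.
Definition horizon (i : nat) : nat := (i.+1 ^ 3)%N.

Lemma mesh_gt0 i : 0 < mesh i.
Proof. by rewrite invr_gt0 exprn_gt0. Qed.

Lemma mesh_horizon i : mesh i * (horizon i)%:R = i.+1%:R.
Proof.
by rewrite /mesh /horizon natrX [_ ^+ 3]exprS mulrCA mulVf ?mulr1//.
Qed.

Lemma grid_reward_cvg :
  (\int[P]_w reward (lambda * mesh i) (grid_state (mesh i) (horizon i) w)) @[i --> \oo]
  --> level_value bp bm e a k0 J.-1 * expR (- (bp * e)).
Proof.
apply/cvgrPdist_le => eps eps0.
set B := size_bound bp bm e a.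
have B1 : 1 <= B by exact: size_bound_ge1.
(* Fixed before the mesh, so that the rank term is exactly [eps / 3]. The constant divided by
   [delta ^+ 3] is then beaten by mesh^2 * horizon = 1 / (i+1). *)
pose delta := eps / 3 / (J.*2.+2)%:R.
have d0 : 0 < delta by rewrite !divr_gt0.
pose K := `|error_const / delta ^+ 3|.
have c1 : \forall i \near \oo, expR (- (lambda * i.+1%:R)) * B <= eps / 3.
  near=> i.
  have h1 : expR (- (lambda * i.+1%:R)) * (lambda * i.+1%:R) <= 1.
    rewrite -[leRHS](expR0) -(addNr (lambda * i.+1%:R)) expRD ler_wpM2l ?expR_ge0//.
    by have := expR_ge1Dx (lambda * i.+1%:R); lra.
  have h2 : B / (eps / 3) <= lambda * i.+1%:R.
    rewrite -ler_pdivrMl// (le_trans _ (_ : i%:R <= _)) ?ler_nat//.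
    by near: i; exact: nbhs_infty_ger.
  have li0 : 0 < lambda * i.+1%:R by rewrite mulr_gt0.
  rewrite -ler_pdivlMr ?(lt_le_trans _ B1)//.
  have h3 : expR (- (lambda * i.+1%:R)) <= (lambda * i.+1%:R)^-1.
    by rewrite -[leRHS]mul1r ler_pdivlMr.
  apply: (le_trans h3); rewrite -[leRHS]invf_div lef_pV2 ?posrE//.
  by rewrite divr_gt0 ?(lt_le_trans _ B1)// divr_gt0.
have c2 : \forall i \near \oo, K / i.+1%:R <= eps / 3.
  near=> i.
  rewrite ler_pdivrMr// -ler_pdivrMl ?divr_gt0// (le_trans _ (_ : i%:R <= _)) ?ler_nat//.
  by near: i; exact: nbhs_infty_ger.
near=> i.
rewrite distrC.
have h0 := mesh_gt0 i.
have h1 : mesh i <= 1.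
  by rewrite /mesh invf_le1 ?exprn_gt0// exprn_ege1// ler1n.
apply: (le_trans (grid_reward_error h0 (horizon i) d0 h1)).
rewrite -mulrA mesh_horizon -/B.
have e1 : expR (- (lambda * i.+1%:R)) * B <= eps / 3 by near: i.
have e2 : delta * (J.*2.+2)%:R = eps / 3 by rewrite /delta divfK// pnatr_eq0.
have e3 : (horizon i)%:R * (error_const / delta ^+ 3 * mesh i ^+ 2) <= eps / 3.
  apply: (@le_trans _ _ (K / i.+1%:R)); last by near: i.
  have -> : (horizon i)%:R * (error_const / delta ^+ 3 * mesh i ^+ 2)
    = (error_const / delta ^+ 3) / i.+1%:R.
    move: (error_const / _) => E.
    have -> : (horizon i)%:R * (E * mesh i ^+ 2) = E * mesh i * (mesh i * (horizon i)%:R).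
      by ring.
    rewrite mesh_horizon /mesh.
    have x0 : i.+1%:R != 0 :> R by rewrite pnatr_eq0.
    by move: (i.+1%:R) x0 => z z0; field.
  by rewrite ler_wpM2r ?invr_ge0// ler_norm.
lra.
Unshelve. all: by end_near.
Qed.

End grid_chain_expectation.

(** * The Euler scheme of narrow bands *)

Section gamma_density.
Context (R : realType).
Implicit Types z t : R.

(** The Poisson weight at [k] with mean [z], also the density at [z] of the Gamma law of shape k +
    1; [gtail k] is the tail of that law. *)
Definition gam (k : nat) z : R := z ^+ k / k`!%:R * expR (- z).
Definition gtail (k : nat) z : R := \sum_(0 <= m < k.+1) gam m z.

Let is_derive_expRN z : is_derive z 1 (expR \o -%R) (- expR (- z)).
Proof.
have h := @is_derive1_comp R expR -%R z (expR (- z)) (-1) (is_derive_expR _) _.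
by apply: is_derive_eq; rewrite mulrN1.
Qed.

Let is_derive_gam0 z : is_derive z 1 (gam 0) (- gam 0 z).
Proof.
have e : gam 0 = expR \o -%R.
  by apply/funext => t; rewrite /gam /= expr0 fact0 divr1 mul1r.
by rewrite e.
Qed.

Let is_derive_gamS k z : is_derive z 1 (gam k.+1) (gam k z - gam k.+1 z).
Proof.
have e : gam k.+1 = ((k.+1)`!%:R^-1 : R) \*: (id ^+ k.+1 * (expR \o -%R)).
  apply/funext => t; rewrite /gam /= mulrAC mulrC.
  by rewrite -[RHS]/(_ * ((id ^+ k.+1) t * expR (- t))) exprfctE.
rewrite [X in is_derive _ _ X _]e.
have h1 := @is_deriveX R R^o id k.+1 z 1 1 (is_derive_id z 1).
have h2 := @is_deriveM R R^o _ _ z 1 _ _ h1 (is_derive_expRN z).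
have h3 := @is_deriveZ R R^o R^o _ ((k.+1)`!%:R^-1) z 1 _ h2.
apply: (is_derive_eq h3).
rewrite /gam /= exprfctE /GRing.scale /= mulr1 factS natrM.
have f0 : k`!%:R != 0 :> R by rewrite pnatr_eq0 -lt0n fact_gt0.
have k0 : k.+1%:R != 0 :> R by rewrite pnatr_eq0.
rewrite exprS; move: (k.+1%:R) k0 => K K0; move: (k`!%:R) f0 => F F0.
by field; rewrite F0 K0.
Qed.

(** The derivative of [gam k.+1] is [gam k - gam k.+1], so the sum telescopes. *)
Lemma is_derive_gtail k z : is_derive z 1 (gtail k) (- gam k z).
Proof.
elim: k => [|k IH].
  have -> : gtail 0 = gam 0 by apply/funext => t; rewrite /gtail big_nat1.
  exact: is_derive_gam0.
have -> : gtail k.+1 = gtail k + gam k.+1.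
  by apply/funext => t; rewrite /gtail big_nat_recr.
apply: is_derive_eq; [exact: is_deriveD|].
by rewrite addrA addNr add0r.
Qed.

Let mvt (f df : R -> R) (x y : R) : x <= y -> (forall z, is_derive z 1 f (df z)) ->
  exists2 z, x <= z <= y & f y - f x = df z * (y - x).
Proof.
move=> xy fdf; have [|z] := @MVT_segment R f df x y xy (fun z _ => fdf z).
  by apply: derivable_within_continuous => z _; exact: ex_derive.
by rewrite in_itv /= => h e; exists z.
Qed.

Lemma gam_ge0 k z : 0 <= z -> 0 <= gam k z.
Proof. by move=> z0; rewrite mulr_ge0 ?expR_ge0// divr_ge0// exprn_ge0. Qed.

Lemma gam_bound k z Z : 0 <= z <= Z -> gam k z <= Z ^+ k.
Proof.
move=> /andP[z0 zZ]; rewrite /gam -[leRHS]mulr1.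
have zk : 0 <= z ^+ k by rewrite exprn_ge0.
apply: ler_pM; rewrite ?expR_ge0//.
- by rewrite divr_ge0.
- apply: (@le_trans _ _ (z ^+ k)); last by rewrite lerXn2r// nnegrE// (le_trans z0).
  by rewrite ler_pdivrMr ?ltr0n ?fact_gt0// ler_peMr// ler1n fact_gt0.
- by rewrite -[leRHS]expR0 ler_expR oppr_le0.
Qed.

Section taylor.
Variables (k : nat) (Z z t : R).
Hypotheses (z0 : 0 <= z) (t0 : 0 <= t) (zt : z + t <= Z) (Z1 : 1 <= Z).

Let bnd x m : z <= x <= z + t -> 0 <= gam m x <= Z ^+ m.
Proof.
move=> /andP[zx xt]; have x0 : 0 <= x by rewrite (le_trans z0).
by rewrite gam_ge0//= gam_bound// x0 (le_trans xt).
Qed.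

Lemma gtail_lip : `|gtail k (z + t) - gtail k z| <= t * Z ^+ k.
Proof.
have zzt : z <= z + t by rewrite lerDl.
have [x xz ->] := mvt zzt (is_derive_gtail k).
have /andP[g0 g1] := bnd k xz.
have -> : z + t - z = t by ring.
by rewrite normrM normrN (ger0_norm g0) (ger0_norm t0) mulrC ler_wpM2l.
Qed.

(** The mean value theorem is applied to [gtail] and then to [gam]. As Z >= 1, the lower power of
    [Z] is absorbed by the higher one. *)
Lemma gtail_taylor : `|gtail k (z + t) - gtail k z + t * gam k z| <= 2 * Z ^+ k * t ^+ 2.
Proof.
have zzt : z <= z + t by rewrite lerDl.
have [x xz ->] := mvt zzt (is_derive_gtail k).
have -> : z + t - z = t by ring.
have -> : - gam k x * t + t * gam k z = - (t * (gam k x - gam k z)) by ring.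
rewrite normrN normrM (ger0_norm t0).
have /andP[zx xt] := xz.
suff H : `|gam k x - gam k z| <= 2 * Z ^+ k * t.
  by have := ler_wpM2l t0 H; rewrite expr2; lra.
have xzt : x - z <= t by rewrite lerBlDl.
have xz0 : 0 <= x - z by rewrite subr_ge0.
have Zk : 0 <= Z ^+ k by rewrite exprn_ge0// (le_trans _ Z1).
move: Zk; case: (k) => [|k'] Zk.
  have [y /andP[zy yx] ->] := mvt zx is_derive_gam0.
  have /andP[g0 g1] : 0 <= gam 0 y <= Z ^+ 0 by apply: bnd; rewrite zy (le_trans yx).
  rewrite normrM normrN (ger0_norm g0) (ger0_norm xz0).
  have := ler_pM g0 xz0 g1 xzt; rewrite expr0; lra.
have [y /andP[zy yx] ->] := mvt zx (is_derive_gamS k').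
have /andP[g0 g1] : 0 <= gam k' y <= Z ^+ k' by apply: bnd; rewrite zy (le_trans yx).
have /andP[h0 h1] : 0 <= gam k'.+1 y <= Z ^+ k'.+1 by apply: bnd; rewrite zy (le_trans yx).
have ZZ : Z ^+ k' <= Z ^+ k'.+1 by rewrite exprS ler_peMl// exprn_ge0// (le_trans _ Z1).
rewrite normrM (ger0_norm xz0) ler_pM// ler_norml; apply/andP; split; lra.
Qed.

End taylor.

Lemma gtail0 k : gtail k (0 : R) = 1.
Proof.
rewrite /gtail big_ltn// {1}/gam expr0 fact0 divr1 oppr0 expR0 mulr1.
rewrite big_nat_cond big1 ?addr0// => i /andP[/andP[i0 _] _].
by rewrite /gam expr0n (gtn_eqF i0) !mul0r.
Qed.

Lemma gtail_ge0 k z : 0 <= z -> 0 <= gtail k z.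
Proof. by move=> z0; apply: sumr_ge0 => m _; exact: gam_ge0. Qed.

(** [gtail k] decreases from 1 at the origin and has [gam k] among its nonnegative summands. *)
Lemma gam_le1 k z : 0 <= z -> gam k z <= 1.
Proof.
move=> z0; have [y /andP[y0 _] e] := mvt z0 (is_derive_gtail k).
have : gtail k z <= 1.
  rewrite -(gtail0 k) -subr_le0 e mulNr oppr_le0 mulr_ge0 ?gam_ge0//.
  by rewrite subr0.
apply: le_trans; rewrite /gtail big_nat_recr//= lerDr.
by apply: sumr_ge0 => m _; exact: gam_ge0.
Qed.

(** The next weight, [gam k z * z / k.+1], is at most 1. This crude decay suffices to let the height
    tend to infinity. *)
Lemma gam_decay k z : 0 < z -> gam k z <= k.+1%:R / z.
Proof.
move=> z0; have := gam_le1 k.+1 (ltW z0).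
have -> : gam k.+1 z = gam k z * z / k.+1%:R.
  have f0 : k`!%:R != 0 :> R by rewrite pnatr_eq0 -lt0n fact_gt0.
  rewrite /gam exprS factS natrM.
  move: (k`!%:R) f0 (z ^+ k) (expR _) => F F0 Y Z.
  have : k.+1%:R != 0 :> R by rewrite pnatr_eq0.
  by move: (k.+1%:R) => K K0; field; rewrite F0 K0.
by rewrite ler_pdivrMr// mul1r ler_pdivlMr.
Qed.

Lemma gtail_decay k z : 0 < z -> gtail k z <= (k.+1 * k.+1)%:R / z.
Proof.
move=> z0; apply: (@le_trans _ _ (\sum_(0 <= m < k.+1) (k.+1%:R / z))).
  apply: ler_sum_nat => m /andP[_ mk]; apply: (le_trans (gam_decay m z0)).
  by rewrite ler_pM2r ?invr_gt0// ler_nat.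
by rewrite sumr_const_nat subn0 -[leLHS]mulr_natl mulrA natrM.
Qed.

Lemma continuous_gtail k : continuous (gtail k : R -> R).
Proof.
move=> z; apply: differentiable_continuous; apply/derivable1_diffP.
by have [] := is_derive_gtail k z.
Qed.

End gamma_density.

(** * Convergence of the recursion over levels, for drawdown size a - kappa e *)

Section small_band_limit.
Context (R : realType).
Variables (bp bm a kappa : R).
Hypotheses (bp_gt0 : 0 < bp) (bm_lt0 : bm < 0) (a_gt0 : 0 < a).

Let den0 := expR (- (bm * a)) - expR (- (bp * a)).
(** Per unit of height, [rate_b] is the rate at which the discounted climb is lost and [rate_c] the
    rate at which discounted drawdowns occur. *)
Definition rate_b : R :=
  (bp * expR (- (bm * a)) - bm * expR (- (bp * a)))
  / (expR (- (bm * a)) - expR (- (bp * a))).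
Definition rate_c : R :=
  (bp - bm) / (expR (- (bm * a)) - expR (- (bp * a))).
Local Notation rho := (expR (- (bp * a))).

(** The last factor is the probability that a Poisson variable of mean [rate_b * y] is at least k +
    1; the factor before it is the limit for large heights. *)
Definition limit_value (k : nat) (y : R) : R :=
  (rate_c / rate_b) ^+ k.+1 * rho ^+ k * (1 - gtail k (rate_b * y)).

Let den0_gt0 : 0 < den0.
Proof.
rewrite subr_gt0 ltr_expR ltrN2 ltr_pM2r//.
exact: lt_trans bp_gt0.
Qed.

Lemma rate_b_gt0 : 0 < rate_b.
Proof.
rewrite /rate_b divr_gt0 ?den0_gt0//.
have h1 : 0 < bp * expR (- (bm * a)) by rewrite mulr_gt0 ?expR_gt0.
have h2 : bm * expR (- (bp * a)) < 0 by rewrite nmulr_rlt0 ?expR_gt0.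
lra.
Qed.

Lemma rate_c_gt0 : 0 < rate_c.
Proof. by rewrite /rate_c divr_gt0 ?den0_gt0// subr_gt0 (lt_trans bm_lt0). Qed.

Variable e : nat -> R.
Hypotheses (e_gt0 : forall q, 0 < e q) (e_cvg : e q @[q --> \oo] --> 0).

Let A q := a - kappa * e q.

Let A_cvg : A q @[q --> \oo] --> a.
Proof.
rewrite -[X in _ --> X]subr0 -(mulr0 kappa).
by apply: cvgB; [exact: cvg_cst|apply: cvgMl_tmp].
Qed.

Let expR_cvg (f : nat -> R) (l : R) : f q @[q --> \oo] --> l ->
  expR (f q) @[q --> \oo] --> expR l.
Proof. by move=> fl; apply: continuous_cvg => //; exact: continuous_expR. Qed.

Let slope theta : (expR (theta * e q) - 1) / e q @[q --> \oo] --> theta.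
Proof.
apply/cvgrPdist_le => eps eps0.
have : \forall q \near \oo, `|e q| <= Num.min 1 (eps / (theta ^+ 2 * expR `|theta| + 1)).
  have /cvgr0Pnorm_le := e_cvg; apply.
  by rewrite lt_min ltr01 divr_gt0// ltr_wpDl// mulr_ge0 ?sqr_ge0 ?expR_ge0.
apply: filterS => q; rewrite gtr0_norm// le_min => /andP[e1 e2].
have := expR_taylor2 (theta * e q).
have -> : expR (theta * e q) - 1 - theta * e q =
  - (theta - (expR (theta * e q) - 1) / e q) * e q.
  by field; rewrite gt_eqF.
rewrite normrM normrN (gtr0_norm (e_gt0 q)) exprMn [e q ^+ 2]expr2.
have E : expR `|theta * e q| <= expR `|theta|.
  by rewrite ler_expR normrM (gtr0_norm (e_gt0 q)) ler_piMr.
move=> H; rewrite -(ler_pM2r (e_gt0 q)); apply: (le_trans H).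
have -> : theta ^+ 2 * (e q * e q) * expR `|theta * e q| =
  theta ^+ 2 * e q * expR `|theta * e q| * e q by ring.
rewrite ler_pM2r//.
apply: (@le_trans _ _ (theta ^+ 2 * e q * expR `|theta|)).
  by rewrite ler_wpM2l// mulr_ge0 ?sqr_ge0// ltW.
have d0 : 0 < theta ^+ 2 * expR `|theta| + 1.
  by rewrite ltr_wpDl// mulr_ge0 ?sqr_ge0 ?expR_ge0.
move: e2; rewrite ler_pdivlMr// mulrDr mulr1 mulrC => e2.
by have := e_gt0 q; lra.
Qed.

Let den_cvg : exit_den bp bm (e q) (A q) @[q --> \oo] --> den0.
Proof.
have -> : den0 = expR (bp * 0 - bm * a) - expR (bm * 0 - bp * a).
  by rewrite !mulr0 !add0r.
by apply: cvgB; apply: expR_cvg; apply: cvgB; exact: cvgMl_tmp.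
Qed.

Let den_neq0 : \forall q \near \oo, exit_den bp bm (e q) (A q) != 0.
Proof.
have : \forall q \near \oo, 0 < exit_den bp bm (e q) (A q) by exact: cvgr_gt den_cvg _ den0_gt0.
by apply: filterS => q; rewrite lt0r => /andP[].
Qed.

Let inv_den_cvg : (exit_den bp bm (e q) (A q))^-1 @[q --> \oo] --> den0^-1.
Proof. by apply: cvgV den_cvg; rewrite gt_eqF. Qed.

Let up_cvg : (1 - exit_up bp bm (e q) (A q)) / e q @[q --> \oo] --> rate_b.
Proof.
(* The numerator of 1 - [exit_up] regrouped into difference quotients of the two exponentials at
   0. *)
have H : ((expR (bp * e q) - 1) / e q * expR (- (bm * A q))
    - (expR (bm * e q) - 1) / e q * expR (- (bp * A q)))
   * (exit_den bp bm (e q) (A q))^-1 @[q --> \oo] --> rate_b.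
  apply: cvgM => //; apply: cvgB; apply: cvgM => //;
    by apply: expR_cvg; apply: cvgN; exact: cvgMl_tmp.
apply: cvg_trans H; apply: near_eq_cvg.
have := den_neq0; apply: filterS => q d0.
rewrite /exit_up; move: d0; rewrite /exit_den !expRD => d0.
by field; rewrite d0 gt_eqF.
Qed.

Let down_cvg : exit_down bp bm (e q) (A q) / e q @[q --> \oo] --> rate_c.
Proof.
have H : ((expR (bp * e q) - 1) / e q - (expR (bm * e q) - 1) / e q)
   * (exit_den bp bm (e q) (A q))^-1 @[q --> \oo] --> rate_c.
  by apply: cvgM => //; apply: cvgB.
apply: cvg_trans H; apply: near_eq_cvg.
have := den_neq0; apply: filterS => q d0.
rewrite /exit_down; move: d0; rewrite /exit_den !expRD => d0.
by field; rewrite d0 gt_eqF.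
Qed.

Let recover_cvg : expR (- (bp * (A q + 2 * e q))) @[q --> \oo] --> rho.
Proof.
apply: expR_cvg; apply: cvgN; apply: cvgMl_tmp.
rewrite -[X in _ --> X]addr0 -[X in _ --> _ + X](mulr0 2).
by apply: cvgD => //; exact: cvgMl_tmp.
Qed.

Let amp k := (rate_c / rate_b) ^+ k.+1 * rho ^+ k.
Let source k y := if k is k'.+1 then rho * limit_value k' y else 1.

Let amp_ge0 k : 0 <= amp k.
Proof.
rewrite /amp mulr_ge0// exprn_ge0// ?expR_ge0//.
by rewrite ltW// divr_gt0 ?rate_c_gt0 ?rate_b_gt0.
Qed.

(** The right-hand side is the derivative of [limit_value k]. The identity itself is algebraic:
    consecutive Gamma tails differ by one Poisson weight. *)
Let ode k y : rate_c * source k y - rate_b * limit_value k y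
  = rate_b * amp k * gam k (rate_b * y).
Proof.
have b0 : rate_b != 0 by rewrite gt_eqF// rate_b_gt0.
rewrite /source /limit_value /amp; case: k => [|k].
  by rewrite /gtail big_nat1 expr1 expr0; field.
have -> : gtail k.+1 (rate_b * y) = gtail k (rate_b * y) + gam k.+1 (rate_b * y).
  by rewrite /gtail big_nat_recr.
move: (gtail _ _) (gam _ _) => G g.
by rewrite !exprS; field.
Qed.

Variable Y : R.
Hypothesis Y0 : 0 <= Y.
(** Bounds all arguments of [gtail] up to height Y + 1, which leaves room for one step beyond [Y];
    the summand 1 makes powers of [Z] increase with the exponent. *)
Let Z := 1 + rate_b * (Y + 1).
Let Z1 : 1 <= Z.
Proof. by rewrite lerDl mulr_ge0 ?addr_ge0// ltW// rate_b_gt0. Qed.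

Section one_level.
Variables (y t : R) (k : nat).
Hypotheses (y0 : 0 <= y) (t0 : 0 <= t) (yt : y + t <= Y + 1).

Let by0 : 0 <= rate_b * y. Proof. by rewrite mulr_ge0// ltW// rate_b_gt0. Qed.
Let bt0 : 0 <= rate_b * t. Proof. by rewrite mulr_ge0// ltW// rate_b_gt0. Qed.
Let bZ : rate_b * y + rate_b * t <= Z.
Proof.
rewrite -mulrDr; have := ler_wpM2l (ltW rate_b_gt0) yt.
by rewrite /Z; lra.
Qed.

Lemma limit_value_lip :
  `|limit_value k (y + t) - limit_value k y| <= amp k * rate_b * Z ^+ k * t.
Proof.
have := gtail_lip k by0 bt0 bZ; rewrite -mulrDr => H.
rewrite /limit_value -/(amp k); move: H.
move: (gtail k (_ * (y + t))) (gtail k (rate_b * y)) => u v H.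
have -> : amp k * (1 - u) - amp k * (1 - v) = amp k * - (u - v) by ring.
have -> : amp k * rate_b * Z ^+ k * t = amp k * (rate_b * t * Z ^+ k) by ring.
by rewrite normrM (ger0_norm (amp_ge0 k)) normrN ler_wpM2l ?amp_ge0.
Qed.

Lemma limit_value_taylor :
  `|limit_value k (y + t) - limit_value k y
    - t * (rate_c * source k y - rate_b * limit_value k y)|
  <= amp k * (2 * Z ^+ k * rate_b ^+ 2) * t ^+ 2.
Proof.
have := gtail_taylor k by0 bt0 bZ Z1.
rewrite -mulrDr ode /limit_value -/(amp k).
move: (gtail k (_ * (y + t))) (gtail k (rate_b * y)) (gam k _) => u v g H.
have -> : amp k * (1 - u) - amp k * (1 - v) - t * (rate_b * amp k * g)
  = - (amp k * (u - v + rate_b * t * g)) by ring.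
have -> : amp k * (2 * Z ^+ k * rate_b ^+ 2) * t ^+ 2 =
  amp k * (2 * Z ^+ k * (rate_b * t) ^+ 2) by ring.
by rewrite normrN normrM (ger0_norm (amp_ge0 k)) ler_wpM2l ?amp_ge0.
Qed.

End one_level.

Lemma limit_value0 k : limit_value k 0 = 0.
Proof.
rewrite /limit_value mulr0.
by rewrite gtail0 subrr mulr0.
Qed.

Let lip_ge0 k : 0 <= amp k * rate_b * Z ^+ k.
Proof.
have Zk : 0 <= Z ^+ k by rewrite exprn_ge0// (le_trans _ Z1).
by apply: mulr_ge0 => //; apply: mulr_ge0; [exact: amp_ge0|exact: ltW rate_b_gt0].
Qed.

Let taylor_ge0 k : 0 <= amp k * (2 * Z ^+ k * rate_b ^+ 2).
Proof.
have Zk : 0 <= Z ^+ k by rewrite exprn_ge0// (le_trans _ Z1).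
apply: mulr_ge0; first exact: amp_ge0.
by apply: mulr_ge0; [exact: mulr_ge0|exact: sqr_ge0].
Qed.

Let limit_value_bound k y : 0 <= y <= Y ->
  `|limit_value k y| <= amp k * rate_b * Z ^+ k * Y.
Proof.
move=> /andP[y0 yY]; have := @limit_value_lip 0 y k (lexx 0) y0.
rewrite add0r limit_value0 subr0 => /(_ (le_trans yY _)) H.
apply: (le_trans (H _)); first by rewrite lerDl.
by rewrite ler_wpM2l.
Qed.

Let e_small (t : R) : 0 < t -> \forall q \near \oo, e q <= t.
Proof.
move=> t0; have /cvgr0Pnorm_le/(_ _ t0) := e_cvg.
by apply: filterS => q; rewrite gtr0_norm.
Qed.

Let source_bound k : exists2 BV, 0 <= BV & forall y, 0 <= y <= Y -> `|source k y| <= BV.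
Proof.
case: k => [|k]; first by exists 1 => // y _; rewrite normr1.
exists (amp k * rate_b * Z ^+ k * Y).
  exact: mulr_ge0.
move=> y yY; rewrite /source normrM ger0_norm ?expR_ge0//.
apply: (le_trans _ (limit_value_bound k yY)).
by rewrite ler_piMl// -[leRHS]expR0 ler_expR oppr_le0 mulr_ge0// ltW.
Qed.

(* One step of the recursion for [level_value] is an Euler step of the equation
   U' = rate_c * source - rate_b * U solved by [limit_value]. *)
Let euler k (dest : nat -> nat -> R) (eta : R) : 0 < eta ->
  (forall q i, level_value bp bm (e q) (A q) k i.+1 =
     exit_up bp bm (e q) (A q) * level_value bp bm (e q) (A q) k i
     + exit_down bp bm (e q) (A q) * dest q i) ->
  (forall t, 0 < t -> \forall q \near \oo, forall i, i%:R * e q <= Y ->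
     `|dest q i - source k (i%:R * e q)| <= t) ->
  \forall q \near \oo, forall i, i%:R * e q <= Y ->
  `|level_value bp bm (e q) (A q) k i - limit_value k (i%:R * e q)| <= eta.
Proof.
move=> eta0 recE dest_cvg.
have c0 := rate_c_gt0; have b0 := rate_b_gt0.
have [BV BV0 hBV] := source_bound k.
pose BU := amp k * rate_b * Z ^+ k * Y.
pose K := amp k * (2 * Z ^+ k * rate_b ^+ 2).
have BU0 : 0 <= BU by exact: mulr_ge0.
have K0 : 0 <= K by exact: taylor_ge0.
(* One summand per error of a step: loss rate, drawdown rate, Taylor remainder, value after a
   drawdown. A step costs [t * G * e q], and at most [Y / e q] steps are made. *)
pose G := BU + BV + K + (rate_c + 1) + 1.
have G0 : 0 < G by rewrite /G; have := ltW c0; lra.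
pose t := Num.min 1 (eta / ((Y + 1) * G)).
have Y1 : 0 < Y + 1 by have := Y0; lra.
have t0 : 0 < t by rewrite lt_min ltr01 divr_gt0// mulr_gt0.
have t1 : t <= 1 by rewrite ge_min lexx.
have tG : t * G * Y <= eta.
  have : t <= eta / ((Y + 1) * G) by rewrite ge_min lexx orbT.
  rewrite ler_pdivlMr ?mulr_gt0// => h.
  have := mulr_ge0 (ltW t0) (ltW G0); lra.
have h1 : \forall q \near \oo,
    `|rate_b - (1 - exit_up bp bm (e q) (A q)) / e q| <= t.
  by have /cvgrPdist_le/(_ _ t0) := up_cvg.
have h2 : \forall q \near \oo, `|rate_c - exit_down bp bm (e q) (A q) / e q| <= t.
  by have /cvgrPdist_le/(_ _ t0) := down_cvg.
have h3 := dest_cvg _ t0.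
have h4 := e_small t0.
have hA : \forall q \near \oo, 0 < A q.
  by exact: (@cvgr_gt _ _ _ _ _ _ A_cvg 0 a_gt0).
near=> q.
have eq0 := e_gt0 q; have Aq0 : 0 < A q by near: q.
set p := exit_up bp bm (e q) (A q); set d := exit_down bp bm (e q) (A q).
have p0 : 0 <= p by exact: exit_up_ge0.
have p1 : p <= 1 by exact: exit_up_le1.
have d0 : 0 <= d by exact: exit_down_ge0.
have bp' : `|rate_b - (1 - p) / e q| <= t by rewrite /p; near: q.
have cd' : `|rate_c - d / e q| <= t by rewrite /d; near: q.
have dst : forall i, i%:R * e q <= Y -> `|dest q i - source k (i%:R * e q)| <= t.
  by near: q.
have et : e q <= t by near: q.
have bpE : `|p - 1 + rate_b * e q| <= t * e q.
  have -> : p - 1 + rate_b * e q = (rate_b - (1 - p) / e q) * e q.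
    by field; rewrite gt_eqF.
  by rewrite normrM (gtr0_norm eq0) ler_wpM2r// ltW.
have cdE : `|d - rate_c * e q| <= t * e q.
  have -> : d - rate_c * e q = - ((rate_c - d / e q) * e q).
    by field; rewrite gt_eqF.
  by rewrite normrN normrM (gtr0_norm eq0) ler_wpM2r// ltW.
have de : d <= (rate_c + 1) * e q.
  have : d - rate_c * e q <= e q.
    rewrite (le_trans (ler_norm _))// (le_trans cdE)//.
    by rewrite ler_piMl// ltW.
  lra.
suff H i : i%:R * e q <= Y ->
    `|level_value bp bm (e q) (A q) k i - limit_value k (i%:R * e q)| <=
    i%:R * (t * G * e q).
  move=> i iY; apply: (le_trans (H i iY)); apply: le_trans tG.
  have -> : i%:R * (t * G * e q) = t * G * (i%:R * e q) by ring.
  by rewrite ler_wpM2l// mulr_ge0// ltW.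
elim: i => [|i IH] iY.
  by rewrite !mul0r /= limit_value0 subrr normr0.
have iY' : i%:R * e q <= Y.
  by apply: le_trans iY; rewrite ler_wpM2r ?(ltW eq0)// ler_nat.
set y := i%:R * e q.
have y0 : 0 <= y by rewrite mulr_ge0// ltW.
have yY : 0 <= y <= Y by rewrite y0.
have yS : i.+1%:R * e q = y + e q by rewrite -natr1 mulrDl mul1r.
have ye : y + e q <= Y + 1 by rewrite lerD// (le_trans et).
have tay := limit_value_taylor k y0 (ltW eq0) ye.
have bU := limit_value_bound k yY; have bV := hBV _ yY.
have := IH iY'; have := dst _ iY'.
rewrite recE yS -/y -/p -/d -/BU -/K in bU tay *.
move: (limit_value k (y + e q)) (limit_value k y) (source k y) (dest q i)
  (level_value _ _ _ _ _ _) tay bU bV => U' U V D w tay bU bV Db wb.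
(* The propagated error is damped by p <= 1; the other terms are the error of [dest], those of the
   two exit probabilities, and the Taylor remainder. *)
have -> : p * w + d * D - U' = p * (w - U) + d * (D - V) + (p - 1 + rate_b * e q) * U
   + (d - rate_c * e q) * V - (U' - U - e q * (rate_c * V - rate_b * U)) by ring.
have n1 : `|p * (w - U)| <= i%:R * (t * G * e q).
  by rewrite normrM ger0_norm// (le_trans _ wb)// ler_piMl.
have n2 : `|d * (D - V)| <= (rate_c + 1) * e q * t.
  by rewrite normrM ger0_norm// ler_pM.
have n3 : `|(p - 1 + rate_b * e q) * U| <= t * e q * BU.
  by rewrite normrM ler_pM.
have n4 : `|(d - rate_c * e q) * V| <= t * e q * BV.
  by rewrite normrM ler_pM.
have n5 : K * e q ^+ 2 <= K * (e q * t).
  by rewrite ler_wpM2l// expr2 ler_pM2l.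
have n6 : 0 <= t * e q by rewrite mulr_ge0// ltW.
have -> : i.+1%:R * (t * G * e q) = i%:R * (t * G * e q) + t * G * e q.
  by rewrite -[i.+1%:R]natr1 mulrDl mul1r.
apply: (le_trans (ler_normB _ _)).
apply: (le_trans (lerD (le_trans (ler_normD _ _) (lerD (le_trans (ler_normD _ _)
  (lerD (le_trans (ler_normD _ _) (lerD n1 n2)) n3)) n4)) (le_trans tay n5))).
rewrite /G; lra.
Unshelve. all: by end_near.
Qed.

(** By induction on [k], the value after a drawdown converges to [source]: the thirds of [t] go to
    the induction hypothesis, to the skipped level through a Lipschitz bound, and to the recovery
    factor. *)
Lemma level_value_cvg k (eta : R) : 0 < eta -> \forall q \near \oo,
  forall i, i%:R * e q <= Y ->
  `|level_value bp bm (e q) (A q) k i - limit_value k (i%:R * e q)| <= eta.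
Proof.
elim: k eta => [|k IH] eta eta0.
  apply: (@euler 0 (fun _ _ => 1)) => // t t0.
  by apply: nearW => q i _; rewrite subrr normr0 ltW.
apply: (@euler k.+1 (fun q i => expR (- (bp * (A q + 2 * e q)))
   * level_value bp bm (e q) (A q) k i.-1)) => // t t0.
pose L := amp k * rate_b * Z ^+ k.
have L0 : 0 <= L by exact: lip_ge0.
pose B := L * Y.
have B0 : 0 <= B by rewrite mulr_ge0.
have t3 : 0 < t / 3 by rewrite divr_gt0.
have tL : 0 < t / 3 / (L + 1) by rewrite divr_gt0// ltr_wpDl.
have tB : 0 < t / 3 / (B + 1) by rewrite divr_gt0// ltr_wpDl.
have h1 := IH _ t3.
have h2 := e_small tL.
have h3 := e_small (@ltr01 R).
have h4 : \forall q \near \oo, `|rho - expR (- (bp * (A q + 2 * e q)))| <= t / 3 / (B + 1).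
  by have /cvgrPdist_le/(_ _ tB) := recover_cvg.
have h5 : \forall q \near \oo, 0 < A q.
  by exact: (@cvgr_gt _ _ _ _ _ _ A_cvg 0 a_gt0).
near=> q => i iY.
have eq0 := e_gt0 q.
have w_lim : forall i, i%:R * e q <= Y ->
    `|level_value bp bm (e q) (A q) k i - limit_value k (i%:R * e q)| <= t / 3.
  by near: q.
have eL : e q <= t / 3 / (L + 1) by near: q.
have e1 : e q <= 1 by near: q.
have rB : `|rho - expR (- (bp * (A q + 2 * e q)))| <= t / 3 / (B + 1) by near: q.
have Aq0 : 0 < A q by near: q.
set r := expR (- (bp * (A q + _))) in rB *.
have r01 : 0 <= r <= 1.
  have h : 0 <= bp * (A q + 2 * e q).
    apply: mulr_ge0; first exact: ltW bp_gt0.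
    by apply: addr_ge0; [exact: ltW|exact: mulr_ge0 _ (ltW eq0)].
  by rewrite /r expR_ge0 /= -[leRHS]expR0 ler_expR oppr_le0.
have /andP[r0 r1] := r01.
have iY' : i.-1%:R * e q <= Y.
  by apply: le_trans iY; rewrite ler_wpM2r ?(ltW eq0)// ler_nat leq_pred.
have b1 := w_lim _ iY'.
have y0 : 0 <= i.-1%:R * e q by rewrite mulr_ge0// ltW.
have lip : `|limit_value k (i%:R * e q) - limit_value k (i.-1%:R * e q)| <= L * e q.
  case: (i) y0 iY' => [|j] /= y0 jY; first by rewrite subrr normr0 mulr_ge0// ltW.
  have -> : j.+1%:R * e q = j%:R * e q + e q by rewrite -natr1 mulrDl mul1r.
  by apply: limit_value_lip => //; [exact: ltW|exact: lerD].
have bU : `|limit_value k (i%:R * e q)| <= B.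
  by apply: limit_value_bound; rewrite iY mulr_ge0// ltW.
rewrite /source.
move: (limit_value k _) (limit_value k _) (level_value _ _ _ _ _ _) b1 lip bU
  => U U1 w b1 lip bU.
have -> : r * w - rho * U = r * (w - U1) - r * (U - U1) - (rho - r) * U by ring.
have n1 : `|r * (w - U1)| <= t / 3 by rewrite normrM ger0_norm// (le_trans _ b1)// ler_piMl.
have n2 : `|r * (U - U1)| <= t / 3.
  rewrite normrM ger0_norm//; apply: (@le_trans _ _ (L * e q)).
    by rewrite (le_trans _ lip)// ler_piMl.
  by move: eL; rewrite ler_pdivlMr ?ltr_wpDl// mulrDr mulr1 mulrC; lra.
have n3 : `|(rho - r) * U| <= t / 3.
  rewrite normrM; have := ler_pM (normr_ge0 _) (normr_ge0 _) rB bU.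
  move=> /le_trans; apply; rewrite mulrAC ler_pdivrMr ?ltr_wpDl//.
  by rewrite ler_wpM2l ?(ltW t3)//; lra.
apply: (le_trans (ler_normB _ _)).
apply: (le_trans (lerD (le_trans (ler_normB _ _) (lerD n1 n2)) n3)); lra.
Unshelve. all: by end_near.
Qed.

End small_band_limit.

(** * Drawdown times of a continuous path *)

Section continuous_path.
Context (T : Type) (R : realType).
Variables (X : R -> T -> R) (w : T).
Hypothesis X0 : X 0 w = 0.
Hypothesis Xcont : {within `[0, +oo[, continuous (fun t => X t w)}.

Local Notation x t := (X t w).
Local Notation M t := (running_max X t w).

Lemma path_near (t eps : R) : 0 <= t -> 0 < eps ->
  exists2 d, 0 < d & forall s, 0 <= s -> `|s - t| < d -> `|x s - x t| < eps.
Proof.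
move=> t0 eps0; move/subspace_continuousP : Xcont => /(_ t).
rewrite /= in_itv /= andbT => /(_ t0) /cvgrPdist_lt /(_ eps eps0).
rewrite /within /= => /nbhs_ballP [d /= d0 H]; exists d => // s s0 st.
rewrite distrC; apply: H; last by rewrite in_itv /= s0.
by rewrite /ball /= distrC.
Qed.

(** By compactness of [0, b]. Only [t] is confined to it: the neighbouring time [s] may exceed
    [b]. *)
Lemma path_uniform (b eps : R) : 0 < eps -> exists2 d, 0 < d &
  forall s t, 0 <= s -> 0 <= t <= b -> `|s - t| < d -> `|x s - x t| < eps.
Proof.
move=> eps0.
have /compact_near_coveringP cov := @segment_compact R 0 b.
pose Q (h t : R) := 0 <= t -> forall s, 0 <= s -> `|s - t| < h -> `|x s - x t| < eps.
have : \forall h \near 0^'+, `[0, b] `<=` Q h.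
  apply: cov => t /=; rewrite in_itv /= => /andP[t0 tb].
  have [d d0 Hd] := path_near t0 (divr_gt0 eps0 (ltr0n _ 2)).
  exists (ball t (d / 2), [set h | h < d / 2]).
    split; first by apply: nbhsx_ballx; rewrite divr_gt0.
    by apply: nbhs_right_lt; rewrite divr_gt0.
  move=> [t' h] /= [tt' hd] t'0 s s0 sh.
  move: tt'; rewrite /ball /= => tt'.
  have h1 : `|x s - x t| < eps / 2.
    apply: Hd => //; rewrite -(subrKA t') (le_lt_trans (ler_normD _ _))//.
    by rewrite [`|t' - t|]distrC; lra.
  have h2 : `|x t' - x t| < eps / 2.
    by apply: Hd => //; rewrite distrC; lra.
  by rewrite -(subrKA (x t)) (le_lt_trans (ler_normD _ _))// [`|x t - _|]distrC; lra.
move=> H.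
have [h [h0 Qh]] := filter_ex (filterI (nbhs_right_gt (0 : R)) H).
exists h => // s t s0 /andP[t0 tb] st.
by apply: Qh => //; rewrite /= in_itv /= t0.
Qed.

Lemma running_max_attained t : 0 <= t -> exists2 s, 0 <= s <= t & x s = M t.
Proof.
move=> t0.
have ct : {within `[0, t], continuous (fun s => x s)}.
  apply: continuous_subspaceW Xcont => s /=.
  by rewrite !in_itv /= => /andP[-> _].
have [s] := EVT_max t0 ct; rewrite in_itv /= => st H.
exists s => //; apply/eqP; rewrite eq_le; apply/andP; split.
  apply: ub_le_sup; last by exists s => //=; rewrite in_itv.
  by exists (x s) => _ [u /= ut <-]; exact: H.
apply: ge_sup; first by exists (x s); exists s => //=; rewrite in_itv.
by move=> _ [u /= ut <-]; exact: H.
Qed.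

Lemma running_max_ge s t : 0 <= s <= t -> x s <= M t.
Proof.
move=> /andP[s0 st]; have t0 : 0 <= t by rewrite (le_trans s0).
have ct : {within `[0, t], continuous (fun s => x s)}.
  apply: continuous_subspaceW Xcont => u /=.
  by rewrite !in_itv /= => /andP[-> _].
have [c] := EVT_max t0 ct; rewrite in_itv /= => _ H.
apply: ub_le_sup; last by exists s => //=; rewrite in_itv /= s0.
by exists (x c) => _ [u /= ut <-]; exact: H.
Qed.

Lemma running_max_le t c : 0 <= t -> (forall s, 0 <= s <= t -> x s <= c) -> M t <= c.
Proof. by move=> t0 H; have [s st <-] := running_max_attained t0; exact: H. Qed.

Lemma running_max_mono s t : 0 <= s <= t -> M s <= M t.
Proof.
move=> /andP[s0 st]; apply: running_max_le => // u /andP[u0 us].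
by apply: running_max_ge; rewrite u0 (le_trans us).
Qed.

Lemma running_max0 : M 0 = 0.
Proof.
have [s] := running_max_attained (lexx 0).
by rewrite -eq_le => /eqP <- <-.
Qed.

Lemma running_max_split s t c : 0 <= s <= t -> M s <= c ->
  (forall u, s <= u <= t -> x u <= c) -> M t <= c.
Proof.
move=> /andP[s0 st] Ms H; apply: running_max_le; first exact: le_trans st.
move=> u /andP[u0 ut]; have [us|su] := leP u s.
  by apply: le_trans Ms; apply: running_max_ge; rewrite u0.
by apply: H; rewrite (ltW su).
Qed.

Section drawdown.
Variable a : R.
Hypothesis a_gt0 : 0 < a.
Local Notation tau n := (drawdown_time X a n w).

Lemma drawdown_time_le n r s : tau n = r%:E -> r < s ->
  a <= M s - x s -> M r < M s ->
  exists2 t, tau n.+1 = t%:E & r <= t <= s.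
Proof.
move=> taun rs Ds Ms; rewrite /= taun.
set E := [set _ | _ in _].
have lb : (r%:E <= ereal_inf E)%E.
  by apply: le_ereal_inf_tmp => _ [u [/= ru _ _] <-]; rewrite lee_fin ltW.
have ub : (ereal_inf E <= s%:E)%E by apply: ereal_inf_lbound; exists s.
case: (ereal_inf E) lb ub => [t| |] //; rewrite !lee_fin => rt ts.
by exists t => //; rewrite rt.
Qed.

Lemma drawdown_time_ge0 n r : tau n = r%:E -> 0 <= r.
Proof.
elim: n r => [|n IH] r; first by move=> [<-].
rewrite /=; case E : (tau n) => [u| |] //.
move=> H; apply: (le_trans (IH u E)).
rewrite -lee_fin -H; apply: le_ereal_inf_tmp => _ [v [/= ru _ _] <-].
by rewrite lee_fin ltW.
Qed.

Lemma drawdown_time_prev n t : tau n.+1 = t%:E -> exists r, tau n = r%:E.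
Proof. by rewrite /=; case: (tau n) => [u| |] // _; exists u. Qed.

Section attained.
Variables (n : nat) (r t : R).
Hypotheses (taun : tau n = r%:E) (tauS : tau n.+1 = t%:E).

Let D u := [/\ r < u, a <= M u - x u & M r < M u].

Let infD : ereal_inf [set u%:E | u in D] = t%:E.
Proof. by rewrite -tauS /= taun. Qed.

Let lbD u : D u -> t <= u.
Proof. by move=> Du; rewrite -lee_fin -infD; apply: ereal_inf_lbound; exists u. Qed.

Let approxD eps : 0 < eps -> exists2 u, D u & t <= u < t + eps.
Proof.
move=> eps0; apply: contrapT => H.
have : ((t + eps)%:E <= t%:E)%E.
  rewrite -infD; apply: le_ereal_inf_tmp => _ [u Du <-].
  rewrite lee_fin leNgt; apply/negP => ut; apply: H; exists u => //.
  by rewrite lbD.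
by rewrite lee_fin; lra.
Qed.

Let r0 : 0 <= r. Proof. exact: drawdown_time_ge0 taun. Qed.
Let rt : r <= t.
Proof.
rewrite leNgt; apply/negP => tr.
have rt0 : 0 < r - t by rewrite subr_gt0.
have [u [ru _ _] /andP[_ ur]] := approxD rt0; lra.
Qed.
Let t0 : 0 <= t. Proof. exact: le_trans rt. Qed.

(** The condition is closed: shortly after [t] neither the path nor its maximum has moved much. *)
Let drawdown_ge : a <= M t - x t.
Proof.
rewrite leNgt; apply/negP => lt_a.
pose g := (a - (M t - x t)) / 3.
have g0 : 0 < g by rewrite /g; lra.
have [d d0 Hd] := path_near t0 g0.
have [u [ru Du Mu] /andP[tu ud]] := approxD d0.
have u0 : 0 <= u by exact: le_trans tu.
have close v : t <= v <= u -> `|x v - x t| < g.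
  move=> /andP[tv vu]; apply: Hd; first exact: le_trans tv.
  by rewrite ger0_norm ?subr_ge0//; lra.
have Mu' : M u <= M t + g.
  apply: (@running_max_split t) => //; first by rewrite t0.
    by rewrite lerDl ltW.
  move=> v tv; have := close v tv; rewrite ltr_norml => /andP[_ h].
  have := @running_max_ge t t; rewrite t0 lexx => /(_ isT); lra.
have := close u; rewrite tu lexx => /(_ isT); rewrite ltr_norml => /andP[h _].
by move: Du Mu' h lt_a; rewrite /g; lra.
Qed.

(** A strict inequality need not survive an infimum. It does here because at [t] the path is at
    least [a > 0] below its maximum, so the maximum is constant just after [t]. *)
Let max_lt : M r < M t.
Proof.
rewrite ltNge; apply/negP => MM.
have Xt : x t < M t by have := drawdown_ge; have := a_gt0; lra.
have g0 : 0 < M t - x t by rewrite subr_gt0.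
have [d d0 Hd] := path_near t0 g0.
have [u [ru Du Mu] /andP[tu ud]] := approxD d0.
have : M u <= M t.
  apply: (@running_max_split t) => //; first by rewrite t0.
  move=> v /andP[tv vu].
  have : `|x v - x t| < M t - x t.
    apply: Hd; first exact: le_trans tv.
    by rewrite ger0_norm ?subr_ge0//; lra.
  by rewrite ltr_norml => /andP[_]; lra.
by lra.
Qed.

(** If the drawdown exceeded [a] at [t], it would do so slightly earlier with the same maximum,
    since near [t] the path stays away from it. *)
Lemma drawdown_attained : [/\ r < t, M t - x t = a & M r < M t].
Proof.
have rlt : r < t.
  by rewrite lt_neqAle rt andbT; apply/eqP => E; have := max_lt; rewrite E ltxx.
split=> //; apply/eqP; rewrite eq_le drawdown_ge andbT leNgt; apply/negP => gt_a.
pose g := M t - x t - a.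
have g0 : 0 < g by rewrite subr_gt0.
have [d d0 Hd] := path_near t0 g0.
(* Close enough to [t] for the continuity bound, and still after [r]. *)
pose u := t - Num.min d (t - r) / 2.
have m0 : 0 < Num.min d (t - r) by rewrite lt_min d0 subr_gt0.
have m1 : Num.min d (t - r) <= d by rewrite ge_min lexx.
have m2 : Num.min d (t - r) <= t - r by rewrite ge_min lexx orbT.
have ru : r < u by rewrite /u; lra.
have ut : u < t by rewrite /u; lra.
have u0 : 0 <= u by rewrite ltW// (le_lt_trans r0).
have close v : u <= v <= t -> `|x v - x t| < g.
  move=> /andP[uv vt]; apply: Hd; first exact: le_trans uv.
  rewrite distrC ger0_norm ?subr_ge0//.
  by move: uv; rewrite /u; lra.
have Mut : M u = M t.
  have [s /andP[s0 st] sM] := running_max_attained t0.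
  have u_t : M u <= M t by apply: running_max_mono; rewrite u0 ltW.
  apply: le_anti; rewrite u_t -sM /=.
  have [su|us] := leP s u; first by apply: running_max_ge; rewrite s0.
  have : `|x s - x t| < g by apply: close; rewrite (ltW us) st.
  by rewrite ltr_norml /g sM => /andP[_]; have := a_gt0; lra.
have : t <= u.
  apply: lbD; split=> //; last by rewrite Mut max_lt.
  rewrite Mut; have := close u; rewrite lexx (ltW ut) => /(_ isT).
  by rewrite ltr_norml /g => /andP[_]; lra.
by rewrite leNgt ut.
Qed.

End attained.
End drawdown.
End continuous_path.

(** * Comparison of the chain with a path *)

Section grid_and_path.
Context (T : Type) (R : realType).
Variables (X : R -> T -> R) (w : T).
Hypothesis X0 : X 0 w = 0.
Hypothesis Xcont : {within `[0, +oo[, continuous (fun t => X t w)}.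

Variables (e h a : R) (J k0 : nat).
Hypotheses (e_gt0 : 0 < e) (h_gt0 : 0 < h) (a_gt0 : 0 < a) (J_gt1 : (1 < J)%N).

Local Notation x t := (X t w).
Local Notation M t := (running_max X t w).
Local Notation y l := (X (h * l%:R) w).

Fixpoint grid_phase (b : R) (l : nat) : phase :=
  if l is l'.+1 then next e b J l' (grid_phase b l') (y l') (y l'.+1)
  else Recover k0 1.

Lemma grid_phase_in_phase b l : 0 < b -> in_phase e b J (grid_phase b l) (y l).
Proof.
move=> b0; elim: l => [|l IH]; first by rewrite /= J_gt1 mulr0 X0 mul1r.
exact: step_in_phase.
Qed.

Lemma grid_phase_done b l l' m : (l <= l')%N -> grid_phase b l = Done m ->
  grid_phase b l' = Done m.
Proof.
by elim: l' => [|l' IH]; rewrite leq_eqVlt => /predU1P[-> //|]//= /IH H /H ->.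
Qed.

Let grid_ge0 (l : nat) : 0 <= h * l%:R. Proof. by rewrite mulr_ge0// ltW. Qed.

Let grid_le l l' : (l <= l')%N -> h * l%:R <= h * l'%:R.
Proof. by move=> ll; rewrite ler_pM2l// ler_nat. Qed.

Let gridS l : h * l.+1%:R = h * l%:R + h.
Proof. by rewrite -natr1 mulrDr mulr1. Qed.

Lemma grid_floor (s : R) : 0 <= s ->
  exists l, h * l%:R <= s < h * l%:R + h.
Proof.
move=> s0; have sh : 0 <= s / h by rewrite divr_ge0// ltW.
have := truncn_itv sh; set l := Num.truncn _ => /andP[l1 l2].
exists l; rewrite -gridS mulrC -ler_pdivlMr// l1 /=.
by rewrite mulrC -ltr_pdivrMr.
Qed.

Variable b : R.
Hypothesis osc : forall s t, 0 <= s -> 0 <= t <= b -> `|s - t| <= h -> `|x s - x t| < e.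

Let grid_below s l : 0 <= s <= h * l%:R -> h * l%:R <= b ->
  exists2 l', (l' <= l)%N & `|x s - y l'| < e.
Proof.
move=> /andP[s0 sl] lb; have [l' /andP[l1 l2]] := grid_floor s0.
have l'l : (l' <= l)%N by rewrite -(ler_nat R) -(ler_pM2l h_gt0) (le_trans l1).
exists l' => //; apply: osc => //.
  by rewrite grid_ge0 (le_trans _ lb)// grid_le.
by rewrite ger0_norm ?subr_ge0//; lra.
Qed.

Let max_below l c : h * l%:R <= b -> (forall l', (l' <= l)%N -> y l' < c) ->
  M (h * l%:R) < c + e.
Proof.
move=> lb H; have [s sl <-] := running_max_attained Xcont (grid_ge0 l).
have [l' ll] := grid_below sl lb; have := H _ ll.
by rewrite ltr_norml => h1 /andP[_ h2]; lra.
Qed.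

Let step_lt l : h * l.+1%:R <= b -> `|y l.+1 - y l| < e.
Proof.
move=> lb; apply: osc; first exact: grid_ge0.
  by rewrite grid_ge0 (le_trans _ lb)// grid_le.
by rewrite gridS addrAC subrr add0r gtr0_norm.
Qed.

(** * The path is not later than the chain *)

Section lower.
Local Notation tau n := (drawdown_time X a n w).

(** The path has already made the k0 - k drawdowns counted by the chain, and its maximum at the last
    of them lies below the current level; a sample at that level thus certifies recovery. [Fail]
    carries no reward, so nothing is claimed. *)
Definition lower_inv (p : phase) (l : nat) : Prop :=
  match p with
  | Search k j => [/\ (k <= k0)%N, (j < J)%N,
      exists2 t, tau (k0 - k)%N = t%:E & t <= h * l%:R /\ M t < j%:R * e,
      exists2 l', (l' <= l)%N & j%:R * e <= y l' &
      forall l', (l' <= l)%N -> y l' < j.+1%:R * e]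
  | Recover k j => [/\ (k <= k0)%N, (j < J)%N,
      exists2 t, tau (k0 - k)%N = t%:E & t <= h * l%:R /\ M t < j%:R * e &
      forall l', (l' <= l)%N -> y l' < j%:R * e]
  | Done m => (m <= l)%N /\
      exists2 t, tau k0.+1 = t%:E & t <= h * m%:R /\ M t < J.+1%:R * e
  | Fail => True
  end.

Lemma lower_invP l : h * l%:R <= b -> lower_inv (grid_phase a l) l.
Proof.
elim: l => [_|l IH lb].
  split=> //; first by exists 0; rewrite ?subnn// mulr0 mul1r (running_max0 X0 Xcont).
  by move=> l'; rewrite leqn0 => /eqP ->; rewrite mulr0 X0 mul1r.
have lb' : h * l%:R <= b by rewrite (le_trans _ lb)// grid_le.
have ltS : h * l%:R < h * l.+1%:R by rewrite gridS ltrDl.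
have yl1 := step_lt lb.
have S2 (j : nat) : j.+1%:R * e = j%:R * e + e by rewrite -natr1 mulrDl mul1r.
rewrite /=; case: (grid_phase a l) (IH lb') => [k j|k j|m|] //=.
- move=> [kk jJ [t taut [tl Mt]] [l' l'l yl'] ub].
  rewrite leNgt yl1 /=.
  move: yl1; rewrite ltr_norml => /andP[yl1 yl2].
  have ub' l'' : (l'' <= l.+1)%N -> y l'' < j.+2%:R * e.
    rewrite leq_eqVlt ltnS => /predU1P[->|/ub h1]; last by rewrite S2; lra.
    by have := ub l (leqnn l); rewrite [j.+2%:R * e]S2; lra.
  case: (leP (j.+1%:R * e) (y l.+1)) => [y1|y1].
    case: (ltnP j.+1 J) => // jJ1; split=> //.
    - exists t => //; split; first exact: le_trans (ltW ltS).
      by rewrite S2; lra.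
    - by exists l.+1.
  have ub1 l'' : (l'' <= l.+1)%N -> y l'' < j.+1%:R * e.
    by rewrite leq_eqVlt ltnS => /predU1P[->//|/ub].
  case: (leP (y l.+1) (j%:R * e - a)) => [y2|y2]; last first.
    split=> //.
    - by exists t => //; split=> //; exact: le_trans (ltW ltS).
    - by exists l' => //; rewrite leqW.
  have Ms : j%:R * e <= M (h * l.+1%:R).
    apply: (le_trans yl'); apply: (running_max_ge Xcont).
    by rewrite grid_ge0 grid_le// leqW.
  have ts : t < h * l.+1%:R by exact: le_lt_trans ltS.
  have [||t' taut' /andP[tt' t's]] := drawdown_time_le taut ts.
  - lra.
  - lra.
  have t'0 := drawdown_time_ge0 taut'.
  (* The samples are below level j + 1, so the path is below level j + 2; this is the reason for
     recovering to j + 2. *)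
  have Mt' : M t' < j.+2%:R * e.
    have : M t' <= M (h * l.+1%:R) by apply: (running_max_mono Xcont); rewrite t'0.
    by have := max_below lb ub1; rewrite [j.+2%:R * e]S2; lra.
  case: k kk taut taut' => [|k] kk taut taut'.
    split=> //; exists t'; first by rewrite subn0 in taut'.
    split=> //; apply: (lt_le_trans Mt').
    by rewrite ler_pM2r// ler_nat.
  case: (ltnP j.+2 J) => // jJ2; split=> //; first exact: ltnW.
  by exists t' => //; rewrite -taut' -subSn// subSS.
- move=> [kk jJ [t taut [tl Mt]] ub].
  rewrite leNgt yl1 /=.
  move: yl1; rewrite ltr_norml => /andP[yl1 yl2].
  have tl' : t <= h * l.+1%:R by exact: le_trans (ltW ltS).
  case: (leP (j%:R * e) (y l.+1)) => [y1|y1]; split=> //.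
  + by exists t.
  + by exists l.+1.
  + move=> l''; rewrite leq_eqVlt ltnS => /predU1P[->|/ub h1]; last by rewrite S2; lra.
    by have := ub l (leqnn l); rewrite S2; lra.
  + by exists t.
  + by move=> l''; rewrite leq_eqVlt ltnS => /predU1P[->//|/ub].
- by move=> [ml H]; split=> //; rewrite leqW.
Qed.

End lower.

(** * The chain with smaller drawdown size is not later than the path, up to one mesh *)

Section upper.
Local Notation tau n := (drawdown_time X a n w).
Variable s : nat -> R.
Hypothesis tau_s : forall i, (i <= k0.+1)%N -> tau i = (s i)%:E.
Hypothesis b_large : s k0.+1 + h <= b.
Hypothesis gap : forall i, (i <= k0)%N -> M (s i) + 5 * e <= M (s i.+1).
Hypothesis J_large : M (s k0.+1) + 5 * e <= J%:R * e.
Hypothesis a_large : 3 * e < a.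

Let att i : (i <= k0)%N -> [/\ s i < s i.+1, M (s i.+1) - x (s i.+1) = a
  & M (s i) < M (s i.+1)].
Proof.
move=> ik; have h1 := tau_s (leqW ik); have h2 := tau_s (ik : (i.+1 <= k0.+1)%N).
by have := drawdown_attained Xcont a_gt0 h1 h2.
Qed.

Let s_ge0 i : (i <= k0.+1)%N -> 0 <= s i.
Proof. by move=> ik; exact: drawdown_time_ge0 (tau_s ik). Qed.

Let s_le i j : (i <= j)%N -> (j <= k0.+1)%N -> s i <= s j.
Proof.
elim: j => [|j IH]; first by rewrite leqn0 => /eqP ->.
rewrite leq_eqVlt => /predU1P[->//|ij jk].
by have [sj _ _] := att jk; rewrite (le_trans (IH ij (ltnW jk)))// ltW.
Qed.

Let Ms_le i j : (i <= j)%N -> (j <= k0.+1)%N -> M (s i) <= M (s j).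
Proof.
move=> ij jk; apply: (running_max_mono Xcont).
by rewrite s_ge0 ?s_le// (leq_trans ij).
Qed.

(* Between two drawdowns the path climbs by [a > e] at least. *)
Let s_gap i : (1 <= i)%N -> (i <= k0)%N -> s i + h < s i.+1.
Proof.
case: i => // i _ ik; rewrite ltNge; apply/negP => ss.
have [s1 _ M1] := att ik; have [_ D0 _] := att (ltnW ik).
have si0 := s_ge0 (ltnW (ik : (i.+2 <= k0.+1)%N)).
have si1 := s_ge0 (ik : (i.+2 <= k0.+1)%N).
have [u /andP[u0 us] uM] := running_max_attained Xcont si1.
have su : s i.+1 < u.
  rewrite ltNge; apply/negP => us'.
  by have := running_max_ge Xcont (s := u) (t := s i.+1); rewrite u0 us' => /(_ isT); lra.
have : `|x u - x (s i.+1)| < e.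
  apply: osc => //; last by rewrite ger0_norm ?subr_ge0//; lra.
  rewrite si0 /=; apply: le_trans b_large.
  by have := s_le (leqW ik) (leqnn _); have := h_gt0; lra.
have := gap ik; have := e_gt0; have := a_large.
by rewrite ltr_norml => ? ? ? /andP[_]; lra.
Qed.

(** While the chain still waits for a drawdown, the path has not made that drawdown either. Small
    oscillation and a large [J] exclude [Fail]. *)
Definition upper_inv (p : phase) (l : nat) : Prop :=
  match p with
  | Search k j => [/\ (k <= k0)%N,
      h * l%:R < s (k0 - k).+1,
      exists2 l', (l' <= l)%N & j%:R * e <= y l' &
      forall l', (l' <= l)%N -> y l' < j.+1%:R * e]
  | Recover k j => [/\ (k <= k0)%N,
      h * l%:R < s (k0 - k).+1, j%:R * e < M (s (k0 - k)%N) + 4 * e &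
      forall l', (l' <= l)%N -> y l' < j%:R * e]
  | Done m => (m <= l)%N
  | Fail => False
  end.

Let hit l i : (i <= k0)%N -> s i.+1 <= h * l%:R -> h * l%:R < s i.+1 + h ->
  exists2 l', (l' <= l)%N & M (s i.+1) - e < y l'.
Proof.
move=> ik sl ls; have si0 := s_ge0 (ik : (i.+1 <= k0.+1)%N).
have [u /andP[u0 us] <-] := running_max_attained Xcont si0.
have lb : h * l%:R <= b.
  by apply: le_trans b_large; have := s_le (ik : (i.+1 <= k0.+1)%N) (leqnn _); lra.
have [|l' ll] := grid_below (s := u) (l := l) _ lb.
  by rewrite u0 (le_trans us).
by rewrite ltr_norml => /andP[_ h1]; exists l' => //; lra.
Qed.

Let drop l i : (i <= k0)%N -> s i.+1 <= h * l%:R -> h * l%:R < s i.+1 + h ->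
  y l < M (s i.+1) - a + e.
Proof.
move=> ik sl ls; have [_ D _] := att ik.
have si0 := s_ge0 (ik : (i.+1 <= k0.+1)%N).
have : `|y l - x (s i.+1)| < e.
  apply: osc; first exact: grid_ge0.
    rewrite si0 /=; apply: le_trans b_large.
    by have := s_le (ik : (i.+1 <= k0.+1)%N) (leqnn _); have := h_gt0; lra.
  by rewrite ger0_norm ?subr_ge0//; lra.
by rewrite ltr_norml => /andP[_]; lra.
Qed.

(** Origin of the 3 e: once the path has its drawdown, a sample above M - e lies below (j+1) e, and
    the current sample is below M - a + e, hence below j e - (a - 3 e), where the search would have
    ended. *)
Let late_search l i j : (i <= k0)%N -> h * l%:R < s i.+1 + h ->
  (forall l', (l' <= l)%N -> y l' < j.+1%:R * e) ->
  j%:R * e - (a - 3 * e) < y l -> h * l%:R < s i.+1.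
Proof.
move=> ik ls ub inp; rewrite ltNge; apply/negP => sl.
have [l' /ub l'l yl'] := hit ik sl ls; have := drop ik sl ls.
by move: l'l; rewrite -natr1 mulrDl mul1r; lra.
Qed.

(** Before the next drawdown the samples come within [e] of a maximum that is [5 * e] higher, which
    is above the level to be recovered; the [4 * e] of the invariant and this [e] make up the
    gap. *)
Let late_recover l i j : (i <= k0)%N -> h * l%:R < s i.+1 + h ->
  (forall l', (l' <= l)%N -> y l' < j%:R * e) ->
  j%:R * e < M (s i) + 4 * e -> h * l%:R < s i.+1.
Proof.
move=> ik ls ub jM; rewrite ltNge; apply/negP => sl.
have [l' /ub l'l yl'] := hit ik sl ls; have := gap ik; lra.
Qed.

Lemma upper_invP l : h * l%:R <= s k0.+1 + h ->
  upper_inv (grid_phase (a - 3 * e) l) l.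
Proof.
have a'0 : 0 < a - 3 * e by rewrite subr_gt0.
have s00 : s 0%N = 0.
  by have := tau_s (leq0n k0.+1); rewrite /= => -[].
elim: l => [_|l IH lb].
  split=> //.
  - rewrite subnn mulr0; have [+ _ _] := att (leq0n k0).
    by rewrite s00.
  - by rewrite subnn s00 mul1r (running_max0 X0 Xcont); have := e_gt0; lra.
  - by move=> l'; rewrite leqn0 => /eqP ->; rewrite mulr0 X0 mul1r.
have ltS : h * l%:R < h * l.+1%:R by rewrite gridS ltrDl.
have yl1 := step_lt (le_trans lb b_large).
have S2 (j : nat) : j.+1%:R * e = j%:R * e + e by rewrite -natr1 mulrDl mul1r.
have := @grid_phase_in_phase (a - 3 * e) l.+1 a'0.
have {}IH := IH (le_trans (ltW ltS) lb).
have Jlt (j : nat) : j%:R * e < J%:R * e -> (j < J)%N by rewrite ltr_pM2r// ltr_nat.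
have e0 := e_gt0.
have late k : (k <= k0)%N -> h * l%:R < s (k0 - k).+1 ->
    h * l.+1%:R < s (k0 - k).+1 + h /\
    (forall l', (l' <= l)%N -> y l' <= M (s (k0 - k).+1)) /\
    M (s (k0 - k).+1) <= M (s k0.+1).
  move=> kk hs; split; first by rewrite gridS ltrD2r.
  have ik : ((k0 - k).+1 <= k0.+1)%N by rewrite ltnS leq_subr.
  split; last exact: Ms_le.
  move=> l' l'l; apply: (running_max_ge Xcont).
  by rewrite grid_ge0 (le_trans _ (ltW hs))// grid_le.
rewrite /=; case: (grid_phase (a - 3 * e) l) IH => [k j|k j|m|] //=.
- move=> [kk hs [l' l'l yl'] ub].
  have [hs1 [yM MM]] := late k kk hs.
  rewrite leNgt yl1 /=.
  move: yl1; rewrite ltr_norml => /andP[yl1 yl2].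
  have yM1 := yM _ (leqnn l); have yM' := yM _ l'l.
  have ub' l'' : (l'' <= l.+1)%N -> y l'' < j.+2%:R * e.
    rewrite leq_eqVlt ltnS => /predU1P[->|/ub h1]; last by rewrite S2; lra.
    by have := ub l (leqnn l); rewrite [j.+2%:R * e]S2; lra.
  have Jl := J_large.
  case: (leP (j.+1%:R * e) (y l.+1)) => [y1|y1].
    have -> : (j.+1 < J)%N by apply: Jlt; lra.
    move=> /and3P[_ inp _]; split=> //; last by exists l.+1.
    by apply: (@late_search l.+1 _ j.+1) => //; rewrite leq_subr.
  have ub1 l'' : (l'' <= l.+1)%N -> y l'' < j.+1%:R * e.
    by rewrite leq_eqVlt ltnS => /predU1P[->//|/ub].
  case: (leP (y l.+1) (j%:R * e - (a - 3 * e))) => [y2|y2]; last first.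
    move=> /and3P[_ inp _]; split=> //; last by exists l' => //; rewrite leqW.
    by apply: (@late_search l.+1 _ j) => //; rewrite leq_subr.
  case: k kk hs hs1 yM MM yM1 yM' => [|k] kk hs hs1 yM MM yM1 yM'; first by rewrite /=.
  have jJ2 : (j.+2 < J)%N by apply: Jlt; rewrite !S2; lra.
  rewrite jJ2 => _.
  have kE : (k0 - k)%N = (k0 - k.+1).+1 by rewrite -subSn// subSS.
  split; first exact: ltnW.
  (* The chain may overrun a drawdown time of the path by less than one mesh, which is too little to
     reach the next one. *)
  - apply: (lt_trans hs1); rewrite -kE; apply: s_gap; last exact: leq_subr.
    by rewrite kE.
  - by rewrite kE !S2; lra.
  - by move=> l'' /ub1; rewrite [j.+2%:R * e]S2; lra.
- move=> [kk hs jM ub].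
  have [hs1 [yM MM]] := late k kk hs.
  rewrite leNgt yl1 /=.
  move: yl1; rewrite ltr_norml => /andP[yl1 yl2].
  case: (leP (j%:R * e) (y l.+1)) => [y1|y1].
    move=> /and3P[_ inp _].
    have ub' l'' : (l'' <= l.+1)%N -> y l'' < j.+1%:R * e.
      rewrite leq_eqVlt ltnS => /predU1P[->|/ub h1]; last by rewrite S2; lra.
      by have := ub l (leqnn l); rewrite S2; lra.
    split=> //; last by exists l.+1.
    by apply: (@late_search l.+1 _ j) => //; rewrite leq_subr.
  move=> _.
  have ub' l'' : (l'' <= l.+1)%N -> y l'' < j%:R * e.
    by rewrite leq_eqVlt ltnS => /predU1P[->//|/ub].
  split=> //.
  by apply: (@late_recover l.+1 _ j) => //; rewrite leq_subr.
- by move=> ml _; rewrite leqW.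
Qed.

(** At the last grid point before s + h the drawdown time of the path has passed, so the invariant
    leaves only [Done]. *)
Lemma upper_done N : s k0.+1 + h <= h * N%:R ->
  exists2 m, grid_phase (a - 3 * e) N = Done m & h * m%:R <= s k0.+1 + h.
Proof.
move=> sN; have sn0 := s_ge0 (leqnn k0.+1).
have [l /andP[l1 l2]] := grid_floor (addr_ge0 sn0 (ltW h_gt0)).
have sl : s k0.+1 < h * l%:R by lra.
have lN : (l <= N)%N by rewrite -(ler_nat R) -(ler_pM2l h_gt0) (le_trans l1).
have := upper_invP l1; case E : (grid_phase _ l) => [k j|k j|m|] //=.
- move=> [kk hs _ _]; exfalso.
  by have := @s_le (k0 - k).+1 k0.+1 (leq_subr _ _) (leqnn _); lra.
- move=> [kk hs _ _]; exfalso.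
  by have := @s_le (k0 - k).+1 k0.+1 (leq_subr _ _) (leqnn _); lra.
- move=> ml; exists m; first exact: grid_phase_done E.
  by rewrite (le_trans _ l1)// grid_le.
Qed.

End upper.
End grid_and_path.

(** * Rewards along one path as the mesh tends to zero *)

Section path_limits.
Context (T : Type) (R : realType).
Variables (X : R -> T -> R) (w : T).
Hypothesis X0 : X 0 w = 0.
Hypothesis Xcont : {within `[0, +oo[, continuous (fun t => X t w)}.
Variables (lambda a : R) (k0 : nat).
Hypotheses (lambda_gt0 : 0 < lambda) (a_gt0 : 0 < a).

Definition stopped_below (m : R) : R :=
  if drawdown_time X a k0.+1 w is t%:E then
    (if running_max X t w <= m then expR (- (lambda * t)) else 0) else 0.

Lemma stopped_below_ge0 m : 0 <= stopped_below m.
Proof.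
rewrite /stopped_below; case: (drawdown_time _ _ _ _) => [t| |] //.
by case: ifP; rewrite ?expR_ge0.
Qed.

Definition grid_reward (e b : R) (J : nat) (h : R) (N : nat) : R :=
  if grid_phase X w e h J k0 b N is Done l then expR (- (lambda * h * l%:R)) else 0.

Lemma grid_reward_ge0 e b J h N : 0 <= grid_reward e b J h N.
Proof. by rewrite /grid_reward; case: (grid_phase _ _ _ _ _ _ _ _) => *; rewrite ?expR_ge0. Qed.

(** Allows the invariant to be used at the recorded time, where the oscillation is controlled, and
    not at the horizon. *)
Lemma grid_phase_done_at e h J b N l : grid_phase X w e h J k0 b N = Done l ->
  grid_phase X w e h J k0 b l = Done l.
Proof.
elim: N => [//|N IH] E.
have [lE|/IH //] := next_done (E : next _ _ _ _ _ _ _ = _).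
by rewrite {1}lE.
Qed.

Let mesh_near (d : R) : 0 < d -> \forall i \near \oo, mesh R i < d.
Proof.
move=> d0; near=> i.
have i1 : d^-1 < i.+1%:R.
  apply: (@le_lt_trans _ _ i%:R); last by rewrite ltr_nat.
  by near: i; exact: nbhs_infty_ger.
rewrite /mesh invf_plt ?posrE ?exprn_gt0//.
by apply: (lt_le_trans i1); rewrite expr2 ler_peMr// ler1n.
Unshelve. all: by end_near.
Qed.

Lemma grid_reward_lower e J m (eta : R) : 0 < e -> (1 < J)%N -> J.+1%:R * e <= m ->
  0 < eta -> \forall i \near \oo,
  grid_reward e a J (mesh R i) (horizon i) <= stopped_below m + eta.
Proof.
move=> e0 J1 Jm eta0.
(* Rewards later than [b] are at most e^(- 1 / eta) <= eta, so uniform continuity is needed only up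
   to [b]. *)
pose b := (lambda * eta)^-1.
have b0 : 0 <= b by rewrite invr_ge0 mulr_ge0// ltW.
have b_eta : expR (- (lambda * b)) <= eta.
  have lb : lambda * b = eta^-1 by rewrite /b invfM mulrA divff ?mul1r// gt_eqF.
  rewrite lb expRN invf_ple ?posrE ?expR_gt0//.
  by have := expR_ge1Dx eta^-1; lra.
have [d d0 osc] := path_uniform Xcont b e0.
have := mesh_near d0; apply: filterS => i id.
have h0 := mesh_gt0 R i.
have osc' s t : 0 <= s -> 0 <= t <= b -> `|s - t| <= mesh R i -> `|X s w - X t w| < e.
  by move=> s0 tb st; apply: osc => //; exact: le_lt_trans id.
have F0 := stopped_below_ge0 m.
rewrite /grid_reward; case E : (grid_phase _ _ _ _ _ _ _ _) => [k j|k j|l|];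
  [lra|lra| |lra].
have [lb|bl] := leP (mesh R i * l%:R) b; last first.
  rewrite ler_wpDl// (le_trans _ b_eta)// ler_expR lerN2 -mulrA ler_wpM2l// ltW//.
have := lower_invP X0 Xcont a k0 e0 h0 J1 osc' lb.
rewrite (grid_phase_done_at E) => -[_ [t taut [tl Mt]]].
rewrite /stopped_below taut ifT; last by rewrite ltW// (lt_le_trans Mt).
rewrite ler_wpDr ?(ltW eta0)// ler_expR lerN2 -mulrA ler_wpM2l//; exact: ltW.
Qed.

Lemma grid_reward_upper m : exists2 e0, 0 < e0 &
  forall e, 0 < e -> e < e0 -> forall J, (1 < J)%N -> m + 5 * e <= J%:R * e ->
  forall eta, 0 < eta -> \forall i \near \oo,
  stopped_below m <= grid_reward e (a - 3 * e) J (mesh R i) (horizon i) + eta.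
Proof.
have [S0|/eqP S0] := eqVneq (stopped_below m) 0.
  exists 1 => // e _ _ J _ _ eta eta0; apply: nearW => i.
  by rewrite S0 addr_ge0 ?grid_reward_ge0// ltW.
have [t E [Mm SE]] : exists2 t, drawdown_time X a k0.+1 w = t%:E &
    running_max X t w <= m /\ stopped_below m = expR (- (lambda * t)).
  move: S0; rewrite /stopped_below.
  case: (drawdown_time X a k0.+1 w) => [t| |] //.
  by case: ifP => // Mm _; exists t.
pose s i := fine (drawdown_time X a i w).
have fin i : (i <= k0.+1)%N -> drawdown_time X a i w = (s i)%:E.
  rewrite /s; have : exists r, drawdown_time X a k0.+1 w = r%:E by exists t.
  elim: k0.+1 => [[r Er]|n IH [r Er]].
    by rewrite leqn0 => /eqP ->.
  rewrite leq_eqVlt => /predU1P[->|]; first by rewrite Er.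
  by rewrite ltnS; apply: IH; exact: drawdown_time_prev Er.
have st : s k0.+1 = t by rewrite /s E.
have [g g0 gapg] : exists2 g, 0 < g & forall i, (i <= k0)%N ->
    running_max X (s i) w + g <= running_max X (s i.+1) w.
  have att i : (i <= k0)%N -> running_max X (s i) w < running_max X (s i.+1) w.
    move=> ik.
    by have [] := drawdown_attained Xcont a_gt0 (fin _ (leqW ik)) (fin i.+1 ik).
  elim: (k0) att => [|n IH] att.
    exists (running_max X (s 1%N) w - running_max X (s 0%N) w).
      by rewrite subr_gt0 att.
    by move=> i; rewrite leqn0 => /eqP ->; rewrite subrKC.
  have [g g0 Hg] := IH (fun i ik => att i (leqW ik)).
  exists (Num.min g (running_max X (s n.+2) w - running_max X (s n.+1) w)).
    by rewrite lt_min g0 subr_gt0 att.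
  move=> i; rewrite leq_eqVlt => /predU1P[->|].
    by rewrite -lerBrDl ge_min lexx orbT.
  by rewrite ltnS => /Hg; apply: le_trans; rewrite lerD2l ge_min lexx.
(* [a / 3] keeps the drawdown size a - 3 e positive; [g / 5] gives the gap of 5 e. *)
exists (Num.min (a / 3) (g / 5)); first by rewrite lt_min !divr_gt0.
move=> e e0; rewrite lt_min => /andP[ea eg] J J1 Jm eta eta0.
pose b := t + 1.
have [d d0 osc] := path_uniform Xcont b e0.
have etal : 0 < eta / lambda by rewrite divr_gt0.
have h1 := mesh_near d0; have h2 := mesh_near (@ltr01 R); have h3 := mesh_near etal.
near=> i.
have hd : mesh R i < d by near: i.
have hone : mesh R i < 1 by near: i.
have heta : mesh R i < eta / lambda by near: i.
have it : t + 1 <= i%:R by near: i; exact: nbhs_infty_ger.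
have h0 := mesh_gt0 R i.
have osc' u v : 0 <= u -> 0 <= v <= b -> `|u - v| <= mesh R i -> `|X u w - X v w| < e.
  by move=> u0 vb uv; apply: osc => //; exact: le_lt_trans hd.
have bl : s k0.+1 + mesh R i <= b by rewrite st /b lerD2l ltW.
have gp j : (j <= k0)%N -> running_max X (s j) w + 5 * e <= running_max X (s j.+1) w.
  by move=> jk; have := gapg j jk; lra.
have Jl : running_max X (s k0.+1) w + 5 * e <= J%:R * e.
  by rewrite st; apply: le_trans Jm; rewrite lerD2r.
have ea3 : 3 * e < a by lra.
have Nl : s k0.+1 + mesh R i <= mesh R i * (horizon i)%:R.
  by rewrite mesh_horizon st -natr1; lra.
have [l El lh] := upper_done X0 Xcont e0 h0 a_gt0 J1 osc' fin bl gp Jl ea3 Nl.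
rewrite SE /grid_reward El -lerBlDr.
rewrite st in lh.
have : expR (- (lambda * (t + mesh R i))) <= expR (- (lambda * mesh R i * l%:R)).
  by rewrite ler_expR lerN2 -mulrA ler_wpM2l// ltW.
apply: le_trans; rewrite mulrDr opprD expRD.
have t0 : 0 <= t by exact: drawdown_time_ge0 E.
have u1 : expR (- (lambda * t)) <= 1.
  by rewrite -[leRHS]expR0 ler_expR oppr_le0 mulr_ge0// ltW.
have lm : lambda * mesh R i < eta by rewrite mulrC -ltr_pdivlMr.
have := expR_ge1Dx (- (lambda * mesh R i)).
have := expR_ge0 (- (lambda * t)).
move: (expR _) (expR _) u1 => v u u1 u0 v1.
have := ler_wpM2l u0 v1.
have : u * (lambda * mesh R i) <= lambda * mesh R i.
  by rewrite ler_piMl// mulr_ge0// ltW.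
lra.
Unshelve. all: by end_near.
Qed.

End path_limits.

(** * Passage to the limit *)

Section covers.
Context d (T : measurableType d) (R : realType) (P : probability T R).
Implicit Types (f : T -> R) (c : R).

(* [c] bounds the upper integral of [f]: the stopped functionals of the path are
   not known to be measurable. *)
Definition covered f c := exists g : T -> \bar R,
  [/\ measurable_fun setT g, (forall w, 0 <= g w)%E,
      (forall w, (f w)%:E <= g w)%E & (\int[P]_w g w <= c%:E)%E].

Lemma limn_einf_ge (u : (\bar R)^nat) (x : R) :
  (forall eta : R, 0 < eta -> \forall i \near \oo, (x%:E <= u i + eta%:E)%E) ->
  (x%:E <= limn_einf u)%E.
Proof.
move=> H; apply/lee_addgt0Pr => eta eta0.
have [N _ HN] := H _ eta0.
rewrite -leeBlDr// limn_einf_lim (cvg_lim _ (@cvg_einfs_sup _ u))//.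
apply: (le_trans _ (ereal_sup_ubound _)); last by exists N.
apply: le_ereal_inf_tmp => _ [i /= Ni <-].
by rewrite -[(- eta)%:E]/(- eta%:E)%E leeBlDr//; exact: HN.
Qed.

Lemma limn_einf_le_cvg (u : (\bar R)^nat) (c : R^nat) (l : R) :
  (forall i, (u i <= (c i)%:E)%E) -> c @ \oo --> l -> (limn_einf u <= l%:E)%E.
Proof.
move=> uc cl; rewrite limn_einf_lim.
have cl' : (EFin \o c) @ \oo --> l%:E by apply: cvg_EFin => //; exact: nearW.
rewrite -(cvg_lim _ cl')//; apply: lee_lim.
- exact: is_cvg_einfs.
- by apply/cvg_ex; exists l%:E.
- apply: nearW => n /=; apply: (le_trans _ (uc n)).
  by apply: ereal_inf_lbound; exists n => //=.
Qed.

Lemma limn_einf_cover (D : nat -> T -> \bar R) (c : R^nat) (l : R) :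
  (forall i, measurable_fun setT (D i)) -> (forall i w, 0 <= D i w)%E ->
  (forall i, \int[P]_w D i w <= (c i)%:E)%E -> c @ \oo --> l ->
  [/\ measurable_fun setT (fun w => limn_einf (D ^~ w)),
      (forall w, 0 <= limn_einf (D ^~ w))%E &
      (\int[P]_w limn_einf (D ^~ w) <= l%:E)%E].
Proof.
move=> mD D0 Dc cl; split.
- rewrite /limn_einf; apply: measurableT_comp => //.
  by apply: measurable_fun_limn_esup => i; exact: measurableT_comp.
- move=> w; apply: limn_einf_ge => eta eta0; apply: nearW => i.
  by rewrite adde_ge0// lee_fin ltW.
- apply: (le_trans (fatou _ measurableT mD _)) => //.
  exact: limn_einf_le_cvg Dc cl.
Qed.

Lemma covered_limit f (D : nat -> T -> \bar R) (c : R^nat) (l : R) :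
  (forall i, measurable_fun setT (D i)) -> (forall i w, 0 <= D i w)%E ->
  (forall i, \int[P]_w D i w <= (c i)%:E)%E -> c @ \oo --> l ->
  {ae P, forall w, forall eta : R, 0 < eta ->
     \forall i \near \oo, ((f w)%:E <= D i w + eta%:E)%E} ->
  covered f l.
Proof.
move=> mD D0 Dc cl [A [mA PA0 HA]].
have [mg g0 gl] := limn_einf_cover mD D0 Dc cl.
set g := (fun w => limn_einf (D ^~ w)) in mg g0 gl.
(* Infinite on the null set: the majorant then holds everywhere and keeps its integral. *)
pose g' w := maxe (g w) (+oo%E * (\1_A w)%:E)%E.
have g'A w : A w -> g' w = +oo%E.
  by move=> Aw; rewrite /g' indicE mem_set// mule1 maxey.
have g'nA w : ~ A w -> g' w = g w.
  by move=> nAw; rewrite /g' indicE memNset// mule0 max_l// g0.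
have g'0 w : (0 <= g' w)%E by rewrite le_max g0.
have mg' : measurable_fun setT g'.
  apply: measurable_maxe => //; apply: emeasurable_funM => //.
  by apply/measurable_EFinP; exact: measurable_indic.
exists g'; split=> //.
- move=> w; have [wA|wA] := pselect (A w); first by rewrite g'A// leey.
  rewrite g'nA//; apply: limn_einf_ge => eta eta0.
  by apply: contrapT => H; apply: wA; apply: HA => /= /(_ eta eta0).
- have -> // : (\int[P]_w g' w = \int[P]_w g w)%E.
  apply: ge0_ae_eq_integral => //; first by move=> w _; exact: g0.
  exists A; split=> // w /= H; apply: contrapT => wA; apply: H => _.
  exact: g'nA.
Qed.

Lemma coveredD f1 f2 c1 c2 : covered f1 c1 -> covered f2 c2 ->
  covered (fun w => f1 w + f2 w) (c1 + c2).
Proof.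
move=> [g1 [m1 p1 l1 i1]] [g2 [m2 p2 l2 i2]].
exists (fun w => (g1 w + g2 w)%E); split.
- exact: emeasurable_funD.
- by move=> w; rewrite adde_ge0.
- by move=> w; rewrite EFinD leeD.
- by rewrite ge0_integralD// EFinD leeD.
Qed.

Lemma covered_ae_le f1 f2 c :
  {ae P, forall w, f1 w <= f2 w} -> covered f2 c -> covered f1 c.
Proof.
move=> f12 [g [mg g0 lg ig]].
apply: (@covered_limit _ (fun=> g) (fun=> c)) => //; first exact: cvg_cst.
apply: filterS f12 => w f12 eta eta0; apply: nearW => i.
rewrite -[X in (X <= _)%E]adde0; apply: leeD; last by rewrite lee_fin ltW.
by apply: le_trans (lg w); rewrite lee_fin.
Qed.

Import HBNNSimple.

(* The integral of the nonnegative function [f] is by definition a lower integral. *)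
Lemma integral_of_covers f (v : R) : (forall w, 0 <= f w) ->
  covered (fun w => 1 + f w) (1 + v) -> covered (fun w => 1 - f w) (1 - v) ->
  (\int[P]_w (f w)%:E = v%:E)%E.
Proof.
move=> f0 [g [mg g0 lg ig]] [g' [mg' g'0 lg' ig']].
have f0' w : (0 <= (f w)%:E)%E by rewrite lee_fin.
have c1 : (\int[P]_w cst 1 w = 1)%E.
  by rewrite integral_cst// mul1e; exact: probability_setT.
apply/eqP; rewrite eq_le; apply/andP; split.
  rewrite ge0_integralTE//; apply: ge_ereal_sup => _ [k /= kf <-].
  rewrite -integralT_nnsfun.
  have mk : measurable_fun setT (EFin \o k) by exact/measurable_EFinP.
  have k0 w : (0 <= (k w)%:E)%E by rewrite lee_fin.
  have : (\int[P]_w (cst 1 w + (k w)%:E) <= (1 + v)%:E)%E.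
    apply: le_trans ig; apply: ge0_le_integral => //.
    - by move=> w _; rewrite adde_ge0.
    - exact: emeasurable_funD.
    - move=> w _; apply: le_trans (lg w); rewrite EFinD leeD2l//.
  by rewrite ge0_integralD// c1 EFinD leeD2lE.
(* A measurable minorant of [f], obtained by truncating the majorant [g'] of 1 - f; it satisfies 1
   <= k + g'. *)
pose k w := maxe 0%E (1 - mine (g' w) 1)%E.
have mk : measurable_fun setT k.
  apply: measurable_maxe => //; apply: emeasurable_funB => //.
  exact: measurable_mine.
have k0 w : (0 <= k w)%E by rewrite /k le_max lexx.
have kf w : (k w <= (f w)%:E)%E.
  rewrite /k ge_max f0' /=.
  have := lg' w; have := g'0 w; have := f0 w.
  case: (g' w) => [r| |] //= fw r0.
    by rewrite -EFin_min -EFinB !lee_fin; case: (leP r 1); lra.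
  by move=> _; rewrite -EFinD lee_fin subrr.
have kg w : (1 <= k w + g' w)%E.
  rewrite /k; have := g'0 w; case: (g' w) => [r| |] //=.
    rewrite lee_fin -EFin_min -EFinB -EFin_max -EFinD lee_fin => r0.
    have h1 : 1 - Num.min r 1 <= Num.max 0 (1 - Num.min r 1) by rewrite le_max lexx orbT.
    have h2 : Num.min r 1 <= r by rewrite ge_min lexx.
    lra.
  by move=> _; rewrite addey ?leey// gt_eqF// (lt_le_trans (ltNyr 0))// le_max lexx.
have : (1 <= \int[P]_w k w + (1 - v)%:E)%E.
  apply: (@le_trans _ _ (\int[P]_w (k w + g' w))%E).
    by rewrite -c1; apply: ge0_le_integral => //; exact: emeasurable_funD.
  by rewrite ge0_integralD// leeD2l.
rewrite -leeBlDr// -EFinB (_ : 1 - (1 - v) = v); last by ring.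
move=> /le_trans; apply.
rewrite !ge0_integralTE//; apply: ereal_sup_le => _ [r /= rk <-].
by exists r => //= w; exact: le_trans (rk w) (kf w).
Qed.

End covers.

(** * Choice of the band widths and numbers of levels *)

Section band_mesh.
Context (R : realType).
Variable a : R.
Hypothesis a_gt0 : 0 < a.

(** At most [a / 4], so that a - 3 e stays positive for every [q]. *)
Definition band (q : nat) : R := a / 4 * q.+1%:R^-1.

Lemma band_gt0 q : 0 < band q.
Proof. by rewrite mulr_gt0 ?divr_gt0 ?invr_gt0. Qed.

Lemma band_le q : 4 * band q <= a.
Proof.
have : band q <= a / 4 by rewrite ler_piMr ?divr_ge0 ?(ltW a_gt0)// invf_le1// ler1n.
lra.
Qed.

Lemma band_cvg : band q @[q --> \oo] --> 0.
Proof.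
rewrite -(mulr0 (a / 4)); apply: cvgMl_tmp; exact: cvg_harmonic.
Qed.

Let band_small (t : R) : 0 < t -> \forall q \near \oo, band q <= t.
Proof.
move=> t0; have /cvgr0Pnorm_le/(_ _ t0) := band_cvg.
by apply: filterS => q; rewrite gtr0_norm// band_gt0.
Qed.

Let nlevels (m : R) q := Num.truncn (m / band q).

Let nlevelsP m q : 0 <= m -> (nlevels m q)%:R * band q <= m < ((nlevels m q)%:R + 1) * band q.
Proof.
move=> m0; have e0 := band_gt0 q.
have /truncn_itv : 0 <= m / band q by rewrite divr_ge0// ltW.
by rewrite natr1 -ler_pdivlMr// -ltr_pdivrMr.
Qed.

(** One level makes up for rounding down, five supply the margin 5 e of the comparison from
    above. *)
Definition levels_above m q := (nlevels m q + 6)%N.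
(** The maximum with 2 provides enough levels for every [q]; for narrow bands it is inactive up to
    rounding, and the next level is still at most [m]. *)
Definition levels_below m q := maxn 2 (nlevels m q).-1.

Lemma levels_above_large m q : 0 <= m ->
  (1 < levels_above m q)%N /\ m + 5 * band q <= (levels_above m q)%:R * band q.
Proof.
move=> m0; split; first by rewrite /levels_above; lia.
have /andP[_ h] := nlevelsP q m0; have := band_gt0 q.
by rewrite /levels_above natrD mulrDl; lra.
Qed.

Lemma levels_below_small m : 0 < m -> \forall q \near \oo,
  (1 < levels_below m q)%N /\ (levels_below m q).+1%:R * band q <= m.
Proof.
move=> m0; have m3 : 0 < m / 4 by rewrite divr_gt0.
have := band_small m3; apply: filterS => q mq.
have /andP[h1 h2] := nlevelsP q (ltW m0); have e0 := band_gt0 q.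
have n3 : (3 <= nlevels m q)%N.
  rewrite -(ler_nat R) -(ler_pM2r e0).
  by rewrite (le_trans _ (_ : m - band q <= _))//; lra.
rewrite /levels_below leq_max; split=> //.
have -> : (maxn 2 (nlevels m q).-1).+1 = nlevels m q by lia.
exact: h1.
Qed.

Lemma levels_above_cvg m : 0 <= m -> (levels_above m q).-1%:R * band q @[q --> \oo] --> m.
Proof.
move=> m0; apply/cvgrPdist_le => eps eps0.
have eps5 : 0 < eps / 5 by rewrite divr_gt0.
have := band_small eps5; apply: filterS => q eq5.
have /andP[h1 h2] := nlevelsP q m0; have e0 := band_gt0 q.
have -> : (levels_above m q).-1 = (nlevels m q + 5)%N by rewrite /levels_above; lia.
by rewrite natrD mulrDl distrC ler_norml; apply/andP; split; lra.
Qed.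

Lemma levels_below_cvg m : 0 < m -> (levels_below m q).-1%:R * band q @[q --> \oo] --> m.
Proof.
move=> m0; apply/cvgrPdist_le => eps eps0.
have eps5 : 0 < Num.min (eps / 5) (m / 4) by rewrite lt_min !divr_gt0.
have := band_small eps5; apply: filterS => q; rewrite le_min => /andP[eq5 mq].
have /andP[h1 h2] := nlevelsP q (ltW m0); have e0 := band_gt0 q.
have n3 : (3 <= nlevels m q)%N.
  rewrite -(ler_nat R) -(ler_pM2r e0).
  by rewrite (le_trans _ (_ : m - band q <= _))//; lra.
have -> : (levels_below m q).-1 = (nlevels m q - 2)%N by rewrite /levels_below; lia.
rewrite natrB; last by lia.
by rewrite mulrBl distrC ler_norml; apply/andP; split; lra.
Qed.

End band_mesh.

Section chain_limit.
Context (R : realType).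
Variables (bp bm a : R).
Hypotheses (bp_gt0 : 0 < bp) (bm_lt0 : bm < 0) (a_gt0 : 0 < a).

Local Notation band := (band a).
Local Notation band_gt0 := (band_gt0 a_gt0).
Local Notation band_cvg := (band_cvg a).

Lemma continuous_limit_value k : continuous (limit_value bp bm a k).
Proof.
move=> y; rewrite /limit_value; apply: cvgM; first exact: cvg_cst.
apply: cvgB; first exact: cvg_cst.
apply: (@continuous_comp _ _ _ ( *%R (rate_b bp bm a)) (gtail k) y).
  exact: mulrl_continuous.
exact: continuous_gtail.
Qed.

Definition chain_value kappa k J q : R :=
  level_value bp bm (band q) (a - kappa * band q) k J.-1 * expR (- (bp * band q)).

Lemma chain_value_cvg kappa k (J : nat -> nat) (m : R) : 0 <= m ->
  (J q).-1%:R * band q @[q --> \oo] --> m ->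
  chain_value kappa k (J q) q @[q --> \oo] --> limit_value bp bm a k m.
Proof.
move=> m0 Jm; rewrite -[X in _ --> X]mulr1.
apply: cvgM; last first.
  rewrite -[X in _ --> X]expR0 -oppr0 -(mulr0 bp).
  apply: continuous_cvg; first exact: continuous_expR.
  by apply: cvgN; apply: cvgMl_tmp; exact: band_cvg.
have U : limit_value bp bm a k ((J q).-1%:R * band q) @[q --> \oo]
    --> limit_value bp bm a k m.
  by apply: continuous_cvg => //; exact: continuous_limit_value.
apply/cvgrPdist_le => eps eps0.
have eps2 : 0 < eps / 2 by rewrite divr_gt0.
have Y0 : 0 <= m + 1 by rewrite addr_ge0.
have h1 := level_value_cvg kappa bp_gt0 bm_lt0 a_gt0 band_gt0 band_cvg Y0 k eps2.
have h2 : \forall q \near \oo, (J q).-1%:R * band q <= m + 1.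
  by apply: (cvgr_le _ Jm); rewrite ltrDl.
have h3 : \forall q \near \oo,
    `|limit_value bp bm a k m - limit_value bp bm a k ((J q).-1%:R * band q)| <= eps / 2.
  by have /cvgrPdist_le := U; apply.
near=> q.
have e1 : forall i, i%:R * band q <= m + 1 ->
    `|level_value bp bm (band q) (a - kappa * band q) k i
      - limit_value bp bm a k (i%:R * band q)| <= eps / 2.
  by near: q.
have e2 : (J q).-1%:R * band q <= m + 1 by near: q.
have e3 : `|limit_value bp bm a k m - limit_value bp bm a k ((J q).-1%:R * band q)|
    <= eps / 2 by near: q.
have e4 := e1 _ e2.
rewrite -(subrKA (limit_value bp bm a k ((J q).-1%:R * band q))).
apply: (le_trans (ler_normD _ _)).
rewrite [X in _ + X]distrC; lra.
Unshelve. all: by end_near.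
Qed.

(** The limit of [limit_value k] for large heights, where the bound on the maximum disappears. *)
Definition total_mass k : R :=
  (rate_c bp bm a / rate_b bp bm a) ^+ k.+1 * expR (- (bp * a)) ^+ k.

Lemma limit_value_total_cvg k : limit_value bp bm a k q%:R @[q --> \oo] --> total_mass k.
Proof.
have b0 := rate_b_gt0 bp_gt0 bm_lt0 a_gt0.
rewrite /limit_value -/(total_mass k).
rewrite [X in _ --> X](_ : _ = total_mass k * (1 - 0)); last by rewrite subr0 mulr1.
apply: cvgMl_tmp; apply: cvgB; first exact: cvg_cst.
apply/cvgrPdist_le => eps eps0; near=> q.
have q0 : (0 < q)%N by near: q; exact: nbhs_infty_gt.
have qR : 0 < q%:R :> R by rewrite ltr0n.
have bq : 0 < rate_b bp bm a * q%:R := mulr_gt0 b0 qR.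
have be : 0 < eps * rate_b bp bm a := mulr_gt0 eps0 b0.
rewrite sub0r normrN ger0_norm ?gtail_ge0 ?(ltW bq)//.
apply: (le_trans (gtail_decay k bq)); rewrite ler_pdivrMr// mulrA -ler_pdivrMl//.
by near: q; exact: nbhs_infty_ger.
Unshelve. all: by end_near.
Qed.

End chain_limit.

(** * Upper integrals of the drawdown functionals *)

Section drawdown_covers.
Context d (T : measurableType d) (R : realType).
Variables (P : probability T R) (W : R -> {RV P >-> R}).
Hypothesis hW : brownian_motion W.
Variables (mu sigma lambda bp bm a : R) (k0 : nat).
Hypotheses (bp_gt0 : 0 < bp) (bm_lt0 : bm < 0) (a_gt0 : 0 < a).
Hypothesis lambda_gt0 : 0 < lambda.
Hypothesis bp_root : bp * mu + bp ^+ 2 * sigma ^+ 2 / 2 = lambda.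
Hypothesis bm_root : bm * mu + bm ^+ 2 * sigma ^+ 2 / 2 = lambda.

Local Notation X := (drifted mu sigma (fun t w => W t w)).
Local Notation F m w := (stopped_below X w lambda a k0 m).
Local Notation U m := (limit_value bp bm a k0 m).

Lemma good_paths : {ae P, forall w, X 0 w = 0 /\
  {within `[0, +oo[, continuous (fun t => X t w)}}.
Proof.
apply: filterS2 (bm_start hW) (bm_continuous hW) => w W0 Wc.
split; first by rewrite /drifted W0 !mulr0 addr0.
rewrite /drifted => t; apply: cvgD; first apply: cvgMl_tmp.
  have : {within `[0, +oo[, continuous (fun s : R => s)}.
    by apply: continuous_subspaceT => s; exact: cvg_id.
  exact.
by apply: cvgMl_tmp; exact: Wc.
Qed.

Section chain.
Variables (e b : R) (J : nat).
Hypotheses (e_gt0 : 0 < e) (b_gt0 : 0 < b) (J_gt1 : (1 < J)%N).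

Definition chain_reward (i : nat) (w : T) : R :=
  reward (lambda * mesh R i) (grid_state W mu sigma e b J k0 (mesh R i) (horizon i) w).

Lemma chain_reward_ge0_le1 i w : 0 <= chain_reward i w <= 1.
Proof. by apply: reward_ge0_le1; rewrite mulr_ge0 ?(ltW lambda_gt0)// ltW// mesh_gt0. Qed.

Lemma measurable_chain_reward i : measurable_fun setT (chain_reward i).
Proof.
apply: (measurableT_comp (measurable_reward _)).
exact: measurable_grid_state.
Qed.

Lemma chain_rewardE i w : X 0 w = 0 ->
  chain_reward i w = grid_reward X w lambda k0 e b J (mesh R i) (horizon i).
Proof.
move=> X0; rewrite /chain_reward /grid_reward.
suff -> : grid_state W mu sigma e b J k0 (mesh R i) (horizon i) w =
    (grid_phase X w e (mesh R i) J k0 b (horizon i), X (mesh R i * (horizon i)%:R) w).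
  by rewrite /reward /=; case: (grid_phase _ _ _ _ _ _ _ _).
elim: (horizon i) => [|l IH].
  by rewrite /grid_state /= mulr0 X0.
rewrite -[LHS]/(grid_step e b J l
  (grid_state W mu sigma e b J k0 (mesh R i) l w, grid_increment W mu sigma (mesh R i) l w)).
rewrite IH /grid_step [(_, _).1.1]/= [(_, _).1.2]/= [(_, _).2]/= /grid_increment.
by rewrite subrKC.
Qed.

Let v := level_value bp bm e b k0 J.-1 * expR (- (bp * e)).

Let chain_cvg : (\int[P]_w chain_reward i w) @[i --> \oo] --> v.
Proof. exact: grid_reward_cvg. Qed.

Let int_chain i : P.-integrable setT (EFin \o chain_reward i).
Proof. by apply: integrable_reward => //; exact: mesh_gt0. Qed.

(** Mesh limits for fixed bands. Fatou's lemma is one-sided, so rewards are bounded from the other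
    side through the limit inferior of their complements. *)
Definition chain_inf w := limn_einf (fun i => (chain_reward i w)%:E).
Definition chain_coinf w := limn_einf (fun i => (1 - chain_reward i w)%:E).

Lemma chain_inf_cover : [/\ measurable_fun setT chain_inf,
  (forall w, 0 <= chain_inf w)%E & (\int[P]_w chain_inf w <= v%:E)%E].
Proof.
apply: (limn_einf_cover (c := fun i => \int[P]_w chain_reward i w)) => //.
- by move=> i; apply/measurable_EFinP; exact: measurable_chain_reward.
- by move=> i w; rewrite lee_fin; have /andP[] := chain_reward_ge0_le1 i w.
- move=> i; rewrite /Rintegral fineK//.
  exact: (integrable_fin_num measurableT (int_chain i)).
Qed.

Lemma chain_coinf_cover : [/\ measurable_fun setT chain_coinf,
  (forall w, 0 <= chain_coinf w)%E & (\int[P]_w chain_coinf w <= (1 - v)%:E)%E].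
Proof.
have i1 : P.-integrable setT (EFin \o (fun=> 1 : R)).
  by apply: (@bounded_RV_integrable _ _ _ _ _ 1) => // w; rewrite normr1.
apply: (limn_einf_cover (c := fun i => 1 - \int[P]_w chain_reward i w)) => //.
- move=> i; apply/measurable_EFinP; apply: measurable_funB => //.
  exact: measurable_chain_reward.
- by move=> i w; rewrite lee_fin subr_ge0; have /andP[] := chain_reward_ge0_le1 i w.
- move=> i; have -> : 1 - \int[P]_w chain_reward i w = \int[P]_w (1 - chain_reward i w).
    rewrite RintegralB// Rintegral_cst//.
    have -> : fine (P setT) = 1 by rewrite probability_setT.
    by rewrite mulr1.
  rewrite /Rintegral fineK//; apply: integrable_fin_num => //.
  have := integrableB measurableT i1 (int_chain i); apply: eq_integrable => //.
- by apply: cvgB => //; exact: cvg_cst.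
Qed.

End chain.

Lemma cover_stopped_below (m : R) : 0 <= m -> covered P (fun w => F m w) (U m).
Proof.
move=> m0.
have e0 := band_gt0 a_gt0.
have b0 q : 0 < a - 3 * band a q by have := band_le a_gt0 q; have := e0 q; lra.
have J1 q : (1 < levels_above a m q)%N by have [] := levels_above_large a_gt0 q m0.
pose D q := chain_inf (band a q) (a - 3 * band a q) (levels_above a m q).
have H q := chain_inf_cover (e0 q) (b0 q) (J1 q).
apply: (@covered_limit _ _ _ P _ D
  (fun q => chain_value bp bm a 3 k0 (levels_above a m q) q)).
- by move=> q; have [] := H q.
- by move=> q; have [] := H q.
- by move=> q; have [] := H q.
- by apply: chain_value_cvg => //; exact: levels_above_cvg.
apply: filterS good_paths => w [X0 Xc] eta eta0.
have [e1 e1_gt0 He] := grid_reward_upper X0 Xc k0 lambda_gt0 a_gt0 m.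
have : \forall q \near \oo, band a q < e1.
  by apply: (cvgr_lt _ (band_cvg a)).
apply: filterS => q qe1.
apply: (@le_trans _ _ (D q w)); last by rewrite leeDl// lee_fin ltW.
apply: limn_einf_ge => t t0.
have [_ Jm] := levels_above_large a_gt0 q m0.
have := He _ (e0 q) qe1 _ (J1 q) Jm t t0; apply: filterS => i.
by rewrite -EFinD lee_fin chain_rewardE.
Qed.

Lemma cover_co_stopped_below (m : R) : 0 <= m -> covered P (fun w => 1 - F m w) (1 - U m).
Proof.
rewrite le_eqVlt => /predU1P[<-|m0].
  (* At height 0 no level fits below the maximum, but the bound is 1 and the constant 1 already
     covers. *)
  rewrite limit_value0 subr0; exists (cst 1%E); split=> //.
  - by move=> w; rewrite lee_fin gerBl stopped_below_ge0.
  - by rewrite integral_cst// mul1e probability_le1.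
have e0 := band_gt0 a_gt0.
have J1 q : (1 < levels_below a m q)%N by rewrite leq_max.
pose D q := chain_coinf (band a q) a (levels_below a m q).
have H q := chain_coinf_cover (e0 q) a_gt0 (J1 q).
apply: (@covered_limit _ _ _ P _ D
  (fun q : nat => 1 - chain_value bp bm a 0 k0 (levels_below a m q) q : R)).
- by move=> q; have [] := H q.
- by move=> q; have [] := H q.
- by move=> q; rewrite /chain_value mul0r subr0; have [] := H q.
- apply: cvgB; first exact: cvg_cst.
  by apply: chain_value_cvg; [..|exact: ltW|exact: levels_below_cvg].
apply: filterS good_paths => w [X0 Xc] eta eta0.
have := levels_below_small a_gt0 m0; apply: filterS => q [_ Jm].
apply: (@le_trans _ _ (D q w)); last by rewrite leeDl// lee_fin ltW.
apply: limn_einf_ge => t t0.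
have := grid_reward_lower X0 Xc a k0 lambda_gt0 (e0 q) (J1 q) Jm t0.
by apply: filterS => i; rewrite -EFinD lee_fin chain_rewardE//; lra.
Qed.

Let tau := drawdown_time X a k0.+1.
Let C := total_mass bp bm a k0.

Let stopped_below_discount w m : F m w =
  if tau w is t%:E then (if running_max X t w <= m then discount lambda (tau w) else 0)
  else 0.
Proof. by rewrite /stopped_below -/(tau w); case: (tau w). Qed.

(** For each [w] the restriction on the maximum disappears once the integer height [q] exceeds the
    maximum at the drawdown. *)
Lemma cover_discount : covered P (fun w => discount lambda (tau w)) C.
Proof.
have /choice[g Hg] : forall q : nat, exists g : T -> \bar R,
    [/\ measurable_fun setT g, (forall w, 0 <= g w)%E,
      (forall w, (F q%:R w)%:E <= g w)%E & (\int[P]_w g w <= (U q%:R)%:E)%E].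
  by move=> q; exact: (cover_stopped_below (ler0n R q)).
apply: (@covered_limit _ _ _ P _ g (fun q => U q%:R)).
- by move=> q; have [] := Hg q.
- by move=> q; have [] := Hg q.
- by move=> q; have [] := Hg q.
- exact: limit_value_total_cvg.
apply: aeW => w eta eta0.
have H q : discount lambda (tau w) = F q%:R w ->
    ((discount lambda (tau w))%:E <= g q w + eta%:E)%E.
  move=> ->; have [_ _ + _] := Hg q => /(_ w) /le_trans; apply.
  by rewrite leeDl// lee_fin ltW.
case E : (tau w) => [t| |]; rewrite -E.
- near=> q; apply: H; rewrite stopped_below_discount E ifT//.
  by near: q; exact: nbhs_infty_ger.
- by apply: nearW => q; apply: H; rewrite stopped_below_discount E.
- by apply: nearW => q; apply: H; rewrite stopped_below_discount E.
Unshelve. all: by end_near.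
Qed.

Lemma cover_co_discount : covered P (fun w => 1 - discount lambda (tau w)) (1 - C).
Proof.
have /choice[g Hg] : forall q : nat, exists g : T -> \bar R,
    [/\ measurable_fun setT g, (forall w, 0 <= g w)%E,
      (forall w, (1 - F q%:R w)%:E <= g w)%E & (\int[P]_w g w <= (1 - U q%:R)%:E)%E].
  by move=> q; exact: (cover_co_stopped_below (ler0n R q)).
apply: (@covered_limit _ _ _ P _ g (fun q => 1 - U q%:R)).
- by move=> q; have [] := Hg q.
- by move=> q; have [] := Hg q.
- by move=> q; have [] := Hg q.
- by apply: cvgB; [exact: cvg_cst|exact: limit_value_total_cvg].
apply: aeW => w eta eta0; apply: nearW => q.
have [_ _ + _] := Hg q => /(_ w).
have FD : F q%:R w <= discount lambda (tau w).
  rewrite stopped_below_discount /discount; case: (tau w) => [t| |] //.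
  by case: ifP; rewrite ?expR_ge0.
move=> H; apply: (@le_trans _ _ (g q w)); last by rewrite leeDl// lee_fin ltW.
by apply: le_trans H; rewrite lee_fin lerB.
Qed.

(** At an attained drawdown X = M - a, so the integrand is almost surely D - F with D the discount
    factor and F its part where the maximum is at most x + a. The two covers of D and 1 - D and the
    two of F and 1 - F pin its integral down. *)
Lemma expectation_discount_above x : - a <= x ->
  (\int[P]_w (discount lambda (tau w) * \1_(stopped_above X tau x) w)%:E
   = (C * gtail k0 (rate_b bp bm a * (x + a)))%:E)%E.
Proof.
move=> xa; set m := x + a; have m0 : 0 <= m by rewrite /m; lra.
set f := fun w => discount lambda (tau w) * \1_(stopped_above X tau x) w.
have CE : C * gtail k0 (rate_b bp bm a * m) = C - U m.
  by rewrite /limit_value -/(total_mass bp bm a k0) -/C; ring.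
have D0 w : 0 <= discount lambda (tau w).
  by rewrite /discount; case: (tau w) => *; rewrite ?expR_ge0.
have fE : {ae P, forall w, f w = discount lambda (tau w) - F m w}.
  apply: filterS good_paths => w [X0 Xc].
  rewrite /f stopped_below_discount.
  case E : (tau w) => [t| |]; rewrite /= ?mul0r ?subr0//.
  have [r Er] := drawdown_time_prev E.
  have [_ Mx _] := drawdown_attained Xc a_gt0 Er E.
  rewrite indicE; case: ifP => Mm.
    rewrite memNset ?mulr0 ?subrr// => -[s]; rewrite E => -[<-].
    by move: Mm; rewrite /m; lra.
  rewrite mem_set ?mulr1 ?subr0//; exists t => //.
  by move/negbT: Mm; rewrite -ltNge /m; lra.
rewrite CE; apply: integral_of_covers.
- by move=> w; rewrite /f mulr_ge0// indicE.
- have -> : 1 + (C - U m) = C + (1 - U m) by ring.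
  apply: covered_ae_le (coveredD cover_discount (cover_co_stopped_below m0)).
  by apply: filterS fE => w fw; rewrite -/(f w) fw; lra.
- have -> : 1 - (C - U m) = (1 - C) + U m by ring.
  apply: covered_ae_le (coveredD cover_co_discount (cover_stopped_below m0)).
  by apply: filterS fE => w fw; rewrite -/(f w) fw; lra.
Qed.

End drawdown_covers.

(** * The exponents as roots of the characteristic equation *)

Section exponents.
Context (R : realType).
Variables (mu sigma lambda : R).
Hypotheses (sigma_gt0 : 0 < sigma) (lambda_gt0 : 0 < lambda).

Let disc := mu ^+ 2 + 2 * lambda * sigma ^+ 2.

Let sigma2_gt0 : 0 < sigma ^+ 2. Proof. exact: exprn_gt0. Qed.

Let sqr_sqrt_disc : Num.sqrt disc ^+ 2 = disc.
Proof. by rewrite sqr_sqrtr// addr_ge0 ?sqr_ge0// !mulr_ge0// ltW. Qed.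

Let abs_drift_lt : `|mu| < Num.sqrt disc.
Proof.
by rewrite -sqrtr_sqr ltr_sqrt ?ltrDl /disc ?ltr_pwDr ?sqr_ge0// !mulr_gt0.
Qed.

Lemma beta_plus_gt0 : 0 < beta_plus mu sigma lambda.
Proof.
by rewrite divr_gt0// addrC subr_gt0 (le_lt_trans (ler_norm mu)).
Qed.

Lemma beta_minus_lt0 : beta_minus mu sigma lambda < 0.
Proof.
rewrite pmulr_llt0 ?invr_gt0// subr_lt0 (le_lt_trans _ abs_drift_lt)//.
by rewrite -normrN ler_norm.
Qed.

Let exponent_root (s : R) : s ^+ 2 = disc -> let z := (- mu + s) / sigma ^+ 2 in
  z * mu + z ^+ 2 * sigma ^+ 2 / 2 = lambda.
Proof.
move=> sE /=; have s0 : sigma != 0 by rewrite gt_eqF.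
have -> : lambda = (s ^+ 2 - mu ^+ 2) / (2 * sigma ^+ 2).
  by rewrite sE /disc; field.
by field.
Qed.

Lemma beta_plus_root : let z := beta_plus mu sigma lambda in
  z * mu + z ^+ 2 * sigma ^+ 2 / 2 = lambda.
Proof. exact: exponent_root. Qed.

Lemma beta_minus_root : let z := beta_minus mu sigma lambda in
  z * mu + z ^+ 2 * sigma ^+ 2 / 2 = lambda.
Proof. by apply: exponent_root; rewrite sqrrN. Qed.

End exponents.

Theorem corollary3p2 (d : measure_display) (T : measurableType d)
    (R : realType) (P : probability T R) (W : R -> {RV P >-> R})
    (mu sigma a : R) (hW : brownian_motion W)
    (sigma_gt0 : 0 < sigma) (a_gt0 : 0 < a)
    (lambda : R) (n : nat) (x : R)
    (lambda_gt0 : 0 < lambda) (n_ge1 : (1 <= n)%N) (x_ge : - a <= x) :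
  let X := drifted mu sigma (fun t w => W t w) in
  let tau := drawdown_time X a n in
  let beta := beta_plus mu sigma lambda in
  let b := b_coef mu sigma a lambda in
  let c := c_coef mu sigma a lambda in
  ('E_P[(fun w => (discount lambda (tau w) * \1_(stopped_above X tau x) w)%R)]
   = ((c / b) ^+ n * expR (- ((n%:R - 1) * beta * a))
      * \sum_(0 <= m < n)
          ((b * (x + a)) ^+ m / (m`!)%:R * expR (- (b * (x + a)))))%R%:E)%E.
Proof.
move=> X tau beta b c; case: n n_ge1 @tau => // k _ tau.
have bp0 : 0 < beta := beta_plus_gt0 mu sigma_gt0 lambda_gt0.
have bm0 := beta_minus_lt0 mu sigma_gt0 lambda_gt0.
have := expectation_discount_above hW k bp0 bm0 a_gt0 lambda_gt0
  (beta_plus_root mu sigma_gt0 lambda_gt0) (beta_minus_root mu sigma_gt0 lambda_gt0) x_ge.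
rewrite unlock => ->; congr EFin.
rewrite /total_mass -[rate_b _ _ _]/b -[rate_c _ _ _]/c -expRM_natl.
congr (_ ^+ _ * expR _ * _).
by rewrite -natr1 addrK mulrN mulrA.
Qed.
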